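(* Let $n\in\mathbb{Z}_{>0}$ and $a,b\in\Bbbk\setminus\{0\}$. Assume that the $\mathcal{P}_n(a)$-module $X$ has a standard filtration and that the $\mathcal{P}_n(b)$-module $Y$ has a standard filtration. Then the $\mathcal{P}_n(ab)$-module $X\otimes_{\Bbbk} Y$ has a standard filtration as well.
   Context: $\Bbbk$ is an algebraically closed field of characteristic zero. For $x\in\Bbbk\setminus\{0\}$, the partition algebra $\mathcal{P}_n(x)$ has as basis the partition diagrams, i.e. set partitions of the disjoint union of two copies (upper and lower) of $\underline{n}=\{1,\dots,n\}$. The product of diagrams $\mathbf{d}$ and $\mathbf{d}'$ is $x^r\mathbf{d}''$: identify the copy of $\underline{n}$ on one side of $\mathbf{d}$ with the adjacent copy of $\mathbf{d}'$ (concatenation), form the finest common coarsening on the three copies, let $r$ be the number of its parts contained entirely in the middle copy, and let $\mathbf{d}''$ be its restriction to the two outer copies. The rank of a diagram is the number of its parts (propagating lines) meeting both copies of $\underline{n}$. Standard modules: for a partition diagram $\mathbf{d}$ of rank $i$, $0\le i\le n$, let $\mathbf{L}_{\mathbf{d}}$ be the set of all partition diagrams of rank $i$ obtained from $\mathbf{d}$ by left concatenation with other diagrams. The space $\Bbbk\mathbf{L}_{\mathbf{d}}$ with basis $\mathbf{L}_{\mathbf{d}}$ is a left $\mathcal{P}_n(x)$-module by left multiplication modulo diagrams of rank less than $i$, and a $\mathcal{P}_n(x)$-$\Bbbk[S_i]$-bimodule, free over $\Bbbk[S_i]$, where $S_i$ acts on the right by permuting the propagating lines. For $\lambda\vdash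 i$, with Specht module $\mathbf{S}^\lambda$, the standard module is $\mathbf{C}^\lambda:=\Bbbk\mathbf{L}_{\mathbf{d}}\otimes_{\Bbbk[S_i]}\mathbf{S}^\lambda$ (up to isomorphism independent of the choice of $\mathbf{d}$ of rank $i$). A standard filtration of a $\mathcal{P}_n(x)$-module is a (finite) filtration by submodules whose subquotients are standard modules. Tensor products: mapping each partition diagram $\mathbf{d}$ to $\mathbf{d}\otimes\mathbf{d}$ defines an algebra homomorphism $\mathcal{P}_n(ab)\to\mathcal{P}_n(a)\otimes_\Bbbk\mathcal{P}_n(b)$; via it, $X\otimes_\Bbbk Y$ is a $\mathcal{P}_n(ab)$-module for any $\mathcal{P}_n(a)$-module $X$ and $\mathcal{P}_n(b)$-module $Y$. *)

(* Defs.v *)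
From HB Require Import structures.
From mathcomp Require Import all_boot all_order all_algebra all_fingroup.
From mathcomp Require Import finmap.
From mathcomp.multinomials Require Import monalg.
From mathcomp Require Import boolp.

Set Implicit Arguments.
Unset Strict Implicit.
Unset Printing Implicit Defensive.

Import GRing.Theory.

Section Components.
Variable T : finType.
Implicit Types (e : rel T) (Z : {set T}).

(* The parts of the finest partition of T that is coarser than e. *)
Definition components e : {set {set T}} :=
  equivalence_partition (connect e) [set: T].

Definition comps_in e Z : {set {set T}} :=
  [set B in components e | B \subset Z].

Definition comp e u : {set T} := [set v | connect e u v].

Lemma in_components e B :
  reflect (exists u, B = comp e u) (B \in components e).
Proof.
apply: (iffP imsetP) => [[u _ ->]|[u ->]]; exists u => //;
by apply/setP=> v; rewrite !inE.
Qed.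

Lemma comps_inP e Z B :
  reflect (exists2 u, B = comp e u & B \subset Z) (B \in comps_in e Z).
Proof.
rewrite inE; apply: (iffP andP) => [[/in_components[u ->] ?]|[u -> ?]].
  by exists u.
by split=> //; apply/in_components; exists u.
Qed.

Lemma connect_eqv e : symmetric e ->
  {in [set: T] & &, equivalence_rel (connect e)}.
Proof.
move=> se x y z _ _ _; split; first exact: connect0.
move=> xy; apply/idP/idP; last exact: connect_trans.
by apply: connect_trans; rewrite (sym_connect_sym se).
Qed.

Lemma comp_eq e u v : symmetric e -> connect e u v -> comp e u = comp e v.
Proof.
move=> se uv; apply/setP=> w; rewrite !inE.
exact: (same_connect (sym_connect_sym se) uv).
Qed.

Lemma comp_eqE e u v : symmetric e -> comp e u = comp e v -> connect e u v.
Proof. by move=> se /setP/(_ v); rewrite !inE connect0. Qed.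

Lemma eq_comps_in e e' Z : connect e =2 connect e' -> comps_in e Z = comps_in e' Z.
Proof.
move=> E; apply/setP=> B; apply/comps_inP/comps_inP=> -[u -> sB]; exists u => //;
by [apply/setP=> v; rewrite !inE E | move: sB; congr (_ \subset _); apply/setP=> v; rewrite !inE E].
Qed.

Lemma connect_preserve (S : eqType) (e : rel T) (f : T -> S) u v :
  (forall x y, e x y -> f x = f y) -> connect e u v -> f u = f v.
Proof.
move=> ef /connectP[p pp ->] {v}; elim: p u pp => //= a p IH u /andP[ua pa].
by rewrite (ef _ _ ua); apply: IH.
Qed.

Lemma connect_ind (e : rel T) (P : T -> Prop) u v :
  (forall x y, e x y -> P x -> P y) -> connect e u v -> P u -> P v.
Proof.
move=> eP /connectP[p pp ->] {v}; elim: p u pp => //= a p IH u /andP[ua pa] Pu.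
by apply: IH => //; apply: eP Pu.
Qed.

End Components.

Section Gluing.
Variables (T : finType) (e1 e2 : rel T) (W : {set T}).
Hypothesis se1 : symmetric e1.
Hypothesis se2 : symmetric e2.
Hypothesis e2W : forall u v, e2 u v -> (u \in W) && (v \in W).

Let e := relU e1 e2.
Let e' := [rel u v | [&& u \in W, v \in W & connect e1 u v || e2 u v]].

Lemma glue_sym_e : symmetric e.
Proof. by move=> u v; rewrite /= se1 se2. Qed.

Lemma glue_sym_e' : symmetric e'.
Proof.
move=> u v; rewrite /= andbCA (sym_connect_sym se1) se2.
by case: (u \in W); case: (v \in W).
Qed.

Lemma glue_sub1 u v : connect e1 u v -> connect e u v.
Proof. by apply: connect_sub => x y xy; apply: connect1; rewrite /= xy. Qed.

Lemma glue_connect u v : u \in W -> v \in W -> connect e' u v = connect e u v.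
Proof.
move=> Wu Wv; apply/idP/idP.
  apply: connect_sub => x y /and3P[_ _ /orP[/glue_sub1//|xy]].
  by apply: connect1; rewrite /= xy orbT.
move=> uv.
pose P v := exists2 w, w \in W & connect e' u w && connect e1 w v.
have : P v.
  apply: (connect_ind (P := P) _ uv); last by exists u; rewrite ?connect0.
  move=> x y /= /orP[xy [w Ww /andP[uw wx]]|xy [w Ww /andP[uw wx]]].
    exists w => //; rewrite uw; apply: connect_trans wx _; exact: connect1.
  have /andP[Wx Wy] := e2W xy; exists y => //; rewrite connect0 andbT.
  apply: connect_trans uw _; apply: (@connect_trans _ _ x); apply: connect1.
    by rewrite /= Ww Wx wx.
  by rewrite /= Wx Wy xy orbT.
case=> w Ww /andP[uw wv]; apply: connect_trans uw _; apply: connect1.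
by rewrite /= Ww Wv wv.
Qed.

Lemma glue_compI u : u \in W -> comp e u :&: W = comp e' u.
Proof.
move=> Wu; apply/setP=> v; rewrite !inE; case: (boolP (v \in W)) => Wv.
  by rewrite andbT glue_connect.
rewrite andbF; apply/esym/negP=> uv.
have Wv' : v \in W.
  by apply: (connect_ind (P := fun x => x \in W) _ uv) => // x y /and3P[].
by rewrite Wv' in Wv.
Qed.

Lemma glue_count (K : {set T}) : K \subset W ->
  #|comps_in e (K :|: ~: W)| = #|comps_in e1 (~: W)| + #|comps_in e' K|.
Proof.
move=> sKW.
have := cardsID [set B : {set T} | B \subset ~: W] (comps_in e (K :|: ~: W)).
have -> : comps_in e (K :|: ~: W) :&: [set B : {set T} | B \subset ~: W]
          = comps_in e1 (~: W).
  apply/setP=> B; rewrite in_setI [X in _ && X]inE.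
  have key u : comp e1 u \subset ~: W -> comp e u = comp e1 u.
    move=> sB; apply/setP=> v; rewrite !inE; apply/idP/idP; last exact: glue_sub1.
    move=> uv; apply: (connect_ind (P := fun v => connect e1 u v) _ uv) => //.
    move=> x y /= /orP[xy ux|xy ux]; first exact: connect_trans ux (connect1 xy).
    have /andP[Wx _] := e2W xy.
    by have /subsetP/(_ x) := sB; rewrite !inE ux Wx => /(_ isT).
  apply/andP/comps_inP => [[/comps_inP[u -> _] sB]|[u -> sB]].
    have sB1 : comp e1 u \subset ~: W.
      apply: subset_trans sB; apply/subsetP=> v; rewrite !inE; exact: glue_sub1.
    by exists u; rewrite key.
  split=> //; apply/comps_inP; exists u; first by rewrite key.
  exact: subset_trans sB (subsetUr _ _).
move=> <-; congr (_ + _).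
set A := _ :\: _.
have AP B : B \in A -> exists2 u, u \in W & (B = comp e u) /\ comp e' u \subset K.
  rewrite !inE => /andP[/subsetPn[u Bu]]; rewrite inE negbK => Wu.
  move=> /andP[/in_components[w Bw] sB]; exists u => //.
  have Eu : B = comp e u.
    by rewrite Bw; apply: comp_eq; [exact: glue_sym_e | rewrite Bw inE in Bu].
  split=> //; rewrite -(glue_compI Wu) -Eu; apply/subsetP=> v.
  by rewrite inE => /andP[/(subsetP sB)]; rewrite !inE => /orP[//|/negPf->].
have <- : [set B :&: W | B in A] = comps_in e' K.
  apply/setP=> C; apply/imsetP/comps_inP=> [[B /AP[u Wu [-> sK] ->]]|[u -> sK]].
    by exists u; rewrite glue_compI.
  have Wu : u \in W by apply/(subsetP sKW)/(subsetP sK); rewrite inE connect0.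
  exists (comp e u); last by rewrite glue_compI.
  rewrite !inE; apply/and3P; split.
  - by apply/subsetPn; exists u; rewrite !inE ?connect0 ?negbK.
  - by apply/in_components; exists u.
  apply/subsetP=> v; rewrite !inE orbC; case: (boolP (v \in W)) => //= Wv uv.
  by apply: (subsetP sK); rewrite inE glue_connect.
rewrite card_in_imset // => B C /AP[u Wu [-> _]] /AP[v Wv [-> _]].
rewrite !glue_compI // => E; apply: comp_eq; first exact: glue_sym_e.
by rewrite -glue_connect //; apply: comp_eqE E; exact: glue_sym_e'.
Qed.

End Gluing.

(* The relation r transported to T along h; nothing outside the image of h is
   related to anything. *)
Definition rel_im (S T : finType) (h : S -> T) (r : rel S) : rel T :=
  [rel u v | [exists p, exists q, [&& h p == u, h q == v & r p q]]].

Section RelIm.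
Variables (S T : finType) (h : S -> T).
Implicit Types (r : rel S).

Lemma rel_imP r u v :
  reflect (exists p q, [/\ u = h p, v = h q & r p q]) (rel_im h r u v).
Proof.
apply: (iffP existsP) => [[p /existsP[q /and3P[/eqP<- /eqP<- pq]]]|[p [q [-> -> pq]]]].
  by exists p, q.
by exists p; apply/existsP; exists q; rewrite !eqxx.
Qed.

Lemma rel_im_sym r : symmetric r -> symmetric (rel_im h r).
Proof.
move=> sr u v; apply/rel_imP/rel_imP => -[p [q [-> -> pq]]];
by exists q, p; split; rewrite // sr.
Qed.

Hypothesis h_inj : injective h.

Lemma connect_rel_im r p q : connect (rel_im h r) (h p) (h q) = connect r p q.
Proof.
apply/idP/idP => [pq|].
  have [q' /h_inj-> //] : exists2 q', h q = h q' & connect r p q'.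
  apply: (connect_ind (P := fun x => exists2 q', x = h q' & connect r p q') _ pq).
    move=> x y /rel_imP[a [b [-> -> ab]]] [c /h_inj<- pc]; exists b => //.
    exact: connect_trans pc (connect1 ab).
  by exists p; rewrite ?connect0.
move=> pq; apply: (connect_ind (P := fun x => connect (rel_im h r) (h p) (h x)) _ pq).
  move=> x y xy; move/connect_trans; apply; apply: connect1.
  by apply/rel_imP; exists x, y.
exact: connect0.
Qed.

Lemma comp_rel_im r p : comp (rel_im h r) (h p) = h @: comp r p.
Proof.
apply/setP=> v; rewrite inE; apply/idP/imsetP => [pv|[q]]; last first.
  by rewrite inE => pq ->; rewrite connect_rel_im.
suff [q E] : exists q, v = h q.
  by exists q => //; rewrite inE -connect_rel_im -E.
apply: (connect_ind (P := fun x => exists q, x = h q) _ pv); last by exists p.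
by move=> x y /rel_imP[a [b [-> -> ab]]] _; exists b.
Qed.

Lemma comps_in_rel_im r (Z : {set S}) :
  #|comps_in (rel_im h r) (h @: Z)| = #|comps_in r Z|.
Proof.
rewrite -(card_imset (comps_in r Z) (imset_inj h_inj)); apply: eq_card => B.
apply/comps_inP/imsetP => [[u -> sZ]|[C /comps_inP[u -> sZ] ->]].
  have /imsetP[p Zp E] : u \in h @: Z.
    by apply: (subsetP sZ); rewrite inE connect0.
  exists (comp r p); last by rewrite E comp_rel_im.
  apply/comps_inP; exists p => //; move: sZ; rewrite E comp_rel_im.
  by move/subsetP=> s; apply/subsetP=> q /(imset_f h)/s/imsetP[q' ? /h_inj->].
by exists (h u); rewrite ?comp_rel_im // imsetS.
Qed.

End RelIm.

(* inl i is the point i of the upper copy, inr i the point i of the lower copy;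
   in pts3 the three copies are, from top to bottom, inl (inl i), inl (inr i)
   and inr i. *)
Notation pts n := ('I_n + 'I_n)%type.
Notation pts3 n := ('I_n + 'I_n + 'I_n)%type.

Record pdiag n := PDiag {
  blocks :> {set {set pts n}};
  blocks_partition : partition blocks [set: pts n] }.

HB.instance Definition _ n := [isSub for @blocks n].
HB.instance Definition _ n := [Finite of pdiag n by <:].

Definition same n (d : pdiag n) : rel (pts n) := [rel p q | q \in pblock d p].

(* The partition of the points into the fibres of key. *)
Definition ker_diag n (S : eqType) (key : pts n -> S) : pdiag n :=
  PDiag (preim_partitionP key [set: pts n]).

Definition bot23 n (p : pts n) : pts3 n :=
  match p with inl i => inl (inr i) | inr j => inr j end.

Definition outer13 n (p : pts n) : pts3 n :=
  match p with inl i => inl (inl i) | inr j => inr j end.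

Definition middle n : {set pts3 n} := [set inl (inr i) | i : 'I_n].

(* In the product of d and d', d sits on top: the lower copy of d is identified
   with the upper copy of d'. The components of glue d d' are the parts of the
   finest common coarsening on the three copies. *)
Definition glue n (d d' : pdiag n) : rel (pts3 n) :=
  relU (rel_im inl (same d)) (rel_im (@bot23 n) (same d')).

(* The restriction of the common coarsening to the two outer copies: two outer
   points are together when they lie in the same part of it. *)
HB.lock Definition dmul n (d d' : pdiag n) : pdiag n :=
  ker_diag (fun p => pblock (components (glue d d')) (outer13 p)).

HB.lock Definition dloops n (d d' : pdiag n) : nat :=
  #|comps_in (glue d d') (middle n)|.

Definition idkey n (p : pts n) : 'I_n := match p with inl i => i | inr i => i end.

Definition idd n : pdiag n := ker_diag (@idkey n).

Definition upper n : {set pts n} := [set inl i | i : 'I_n].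
Definition lower n : {set pts n} := [set inr i | i : 'I_n].

Definition propagating n (d : pdiag n) : {set {set pts n}} :=
  [set B in blocks d | (B :&: upper n != set0) && (B :&: lower n != set0)].

Definition rank n (d : pdiag n) : nat := #|propagating d|.

Section DiagTheory.
Variable n : nat.
Implicit Types d : pdiag n.

Lemma cover_diag d : cover d = [set: pts n].
Proof. exact: cover_partition (blocks_partition d). Qed.

Lemma trivI_diag d : trivIset d.
Proof. exact: partition_trivIset (blocks_partition d). Qed.

Lemma same_pblockE d p q : same d p q = (pblock d p == pblock d q).
Proof. by rewrite eq_pblock ?trivI_diag // cover_diag. Qed.

Lemma same_sym d : symmetric (same d).
Proof. by move=> p q; rewrite !same_pblockE eq_sym. Qed.

Lemma same_refl d p : same d p p.
Proof. by rewrite same_pblockE. Qed.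

Lemma same_trans d : transitive (same d).
Proof. by move=> q p r; rewrite !same_pblockE => /eqP->. Qed.

Lemma connect_same d : connect (same d) =2 same d.
Proof.
move=> p q; apply/idP/idP; last exact: connect1.
move=> pq; apply: (connect_ind (P := fun q => same d p q) _ pq).
  by move=> x y xy px; exact: same_trans px xy.
exact: same_refl.
Qed.

Lemma blocksE d B : reflect (exists p, B = pblock d p) (B \in blocks d).
Proof.
apply: (iffP idP) => [dB|[p ->]]; last by rewrite pblock_mem ?cover_diag.
have /set0Pn[p Bp] := partition_neq0 (blocks_partition d) dB.
by exists p; rewrite (def_pblock _ dB) ?trivI_diag.
Qed.

Lemma diag_eq d d' : same d =2 same d' -> d = d'.
Proof.
move=> E; apply: val_inj; apply/setP=> B.
have Ep p : pblock d p = pblock d' p by apply/setP=> q; apply: E.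
by apply/blocksE/blocksE=> -[p ->]; exists p.
Qed.

Lemma ker_diagE (S : eqType) (key : pts n -> S) p q :
  same (ker_diag key) p q = (key p == key q).
Proof.
rewrite /same /= /preim_partition pblock_equivalence_partition ?inE //.
by move=> x y z _ _ _; split=> // /eqP->.
Qed.

Lemma pblock_components (T : finType) (e : rel T) u :
  symmetric e -> pblock (components e) u = comp e u.
Proof.
move=> se; apply/setP=> v.
by rewrite pblock_equivalence_partition ?inE //; apply: connect_eqv.
Qed.

Lemma glue_sym d d' : symmetric (glue d d').
Proof.
move=> u v; rewrite /glue /=.
by rewrite (rel_im_sym inl (same_sym d)) (rel_im_sym _ (same_sym d')).
Qed.

Lemma dmulE d d' p q :
  same (dmul d d') p q = connect (glue d d') (outer13 p) (outer13 q).
Proof.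
rewrite dmul.unlock ker_diagE !pblock_components; try exact: glue_sym.
apply/eqP/idP; first exact/comp_eqE/glue_sym.
exact/comp_eq/glue_sym.
Qed.

End DiagTheory.

Lemma dloopsE n (d d' : pdiag n) :
  dloops d d' = #|comps_in (glue d d') (middle n)|.
Proof. by rewrite dloops.unlock. Qed.

Section Assoc.
Variable n : nat.
Implicit Types d : pdiag n.
Let T4 := ('I_n + 'I_n + 'I_n + 'I_n)%type.
Let hL : pts3 n -> T4 := inl.
Let hR (p : pts3 n) : T4 :=
  match p with
  | inl (inl i) => inl (inl (inr i)) | inl (inr i) => inl (inr i) | inr i => inr i
  end.
(* upper, third, lower copies *)
Let gL (p : pts3 n) : T4 :=
  match p with
  | inl (inl i) => inl (inl (inl i)) | inl (inr i) => inl (inr i) | inr i => inr i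
  end.
(* upper, second, lower copies *)
Let gR (p : pts3 n) : T4 :=
  match p with
  | inl (inl i) => inl (inl (inl i)) | inl (inr i) => inl (inl (inr i)) | inr i => inr i
  end.

Let hL_inj : injective hL. Proof. by move=> x y []. Qed.
Let hR_inj : injective hR.
Proof. by move=> [[i|i]|i] [[j|j]|j] //= [->]. Qed.
Let gL_inj : injective gL.
Proof. by move=> [[i|i]|i] [[j|j]|j] //= [->]. Qed.
Let gR_inj : injective gR.
Proof. by move=> [[i|i]|i] [[j|j]|j] //= [->]. Qed.

Let M1 : {set T4} := [set inl (inl (inr i)) | i : 'I_n].
Let M2 : {set T4} := [set inl (inr i) | i : 'I_n].

Let in1 (i : 'I_n) : inl (inl (inr i)) \in M1. Proof. exact: imset_f. Qed.
Let in2 (i : 'I_n) : inl (inr i) \in M2. Proof. exact: imset_f. Qed.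

Let inE1 (u : T4) : (u \in M1) = if u is inl (inl (inr _)) then true else false.
Proof.
by case: u => [[[i|i]|i]|i]; rewrite ?in1 //; apply/negP=> /imsetP[].
Qed.
Let inE2 (u : T4) : (u \in M2) = if u is inl (inr _) then true else false.
Proof.
by case: u => [[[i|i]|i]|i]; rewrite ?in2 //; apply/negP=> /imsetP[].
Qed.

Section Triple.
Variables d1 d2 d3 : pdiag n.

Let eL1 := rel_im hL (glue d1 d2).
Let eL2 := rel_im (hR \o @bot23 n) (same d3).
Let eR1 := rel_im hR (glue d2 d3).
Let eR2 := rel_im (hL \o inl) (same d1).

Lemma big_glueE : relU eL1 eL2 =2 relU eR1 eR2.
Proof.
move=> u v; rewrite /= ; apply/idP/idP.
  case/orP=> [/rel_imP[p [q [-> -> /orP[]/rel_imP[a [b [-> -> ab]]]]]]|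
              /rel_imP[p [q [-> -> pq]]]].
  - by apply/orP; right; apply/rel_imP; exists a, b.
  - apply/orP; left; apply/rel_imP; exists (inl a), (inl b); split.
    + by case: (a). + by case: (b).
    by apply/orP; left; apply/rel_imP; exists a, b.
  apply/orP; left; apply/rel_imP; exists (bot23 p), (bot23 q); split=> //.
  by apply/orP; right; apply/rel_imP; exists p, q.
case/orP=> [/rel_imP[p [q [-> -> /orP[]/rel_imP[a [b [-> -> ab]]]]]]|
              /rel_imP[p [q [-> -> pq]]]].
- apply/orP; left; apply/rel_imP; exists (bot23 a), (bot23 b); split.
  + by case: (a). + by case: (b).
  by apply/orP; right; apply/rel_imP; exists a, b.
- by apply/orP; right; apply/rel_imP; exists a, b.
apply/orP; left; apply/rel_imP; exists (inl p), (inl q); split=> //.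
by apply/orP; left; apply/rel_imP; exists p, q.
Qed.

Let eq_big : connect (relU eL1 eL2) =2 connect (relU eR1 eR2).
Proof. exact: eq_connect big_glueE. Qed.

Let seL1 : symmetric eL1. Proof. exact/rel_im_sym/glue_sym. Qed.
Let seR1 : symmetric eR1. Proof. exact/rel_im_sym/glue_sym. Qed.
Let seL2 : symmetric eL2. Proof. exact/rel_im_sym/same_sym. Qed.
Let seR2 : symmetric eR2. Proof. exact/rel_im_sym/same_sym. Qed.

Let WL := ~: M1.
Let WR := ~: M2.

Let eL2W u v : eL2 u v -> (u \in WL) && (v \in WL).
Proof. by move=> /rel_imP[[i|i] [[j|j] [-> -> _]]]; rewrite !inE !inE1. Qed.
Let eR2W u v : eR2 u v -> (u \in WR) && (v \in WR).
Proof. by move=> /rel_imP[[i|i] [[j|j] [-> -> _]]]; rewrite !inE !inE2. Qed.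

Let eL' := [rel u v | [&& u \in WL, v \in WL & connect eL1 u v || eL2 u v]].
Let eR' := [rel u v | [&& u \in WR, v \in WR & connect eR1 u v || eR2 u v]].

Let connect_eL1_bot i v : connect eL1 (inr i) v -> v = inr i.
Proof.
move=> c; apply: (connect_ind (P := fun v => v = inr i) _ c) => //.
by move=> x y /rel_imP[p [q [-> _ _]]].
Qed.

Let connect_eR1_top i v : connect eR1 (inl (inl (inl i))) v -> v = inl (inl (inl i)).
Proof.
move=> c; apply: (connect_ind (P := fun v => v = inl (inl (inl i))) _ c) => //.
by move=> x y /rel_imP[[[p|p]|p] [q [-> _ _]]].
Qed.

Let eL'E : connect eL' =2 connect (rel_im gL (glue (dmul d1 d2) d3)).
Proof.
move=> u v; apply/idP/idP; apply: connect_sub => x y.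
  case/and3P=> Wx Wy /orP[xy|/rel_imP[p [q [-> -> pq]]]]; last first.
    apply: connect1; apply/rel_imP; exists (bot23 p), (bot23 q).
    split; [by case: (p)|by case: (q)|].
    by apply/orP; right; apply/rel_imP; exists p, q.
  have H w : w \in WL -> (exists i, w = inr i) \/
             exists2 p, w = gL (inl p) & w = hL (outer13 p).
    case: w => [[[i|i]|i]|i]; rewrite !inE inE1 //= => _.
    - by right; exists (inl i).
    - by right; exists (inr i).
    by left; exists i.
  case: (H _ Wx) => [[i Ei]|[p Ep Ep']].
    by rewrite Ei in xy *; rewrite (connect_eL1_bot xy) connect0.
  case: (H _ Wy) => [[i Ei]|[q Eq Eq']].
    have yx : connect eL1 y x by have /(_ x y)<- := sym_connect_sym seL1.
    by rewrite Ei in yx *; rewrite (connect_eL1_bot yx) connect0.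
  rewrite Ep Eq; apply: connect1; apply/rel_imP; exists (inl p), (inl q).
  split=> //; apply/orP; left; apply/rel_imP; exists p, q; split=> //.
  by rewrite dmulE -(connect_rel_im hL_inj) -Ep' -Eq'.
move=> /rel_imP[p [q [-> -> /orP[]/rel_imP[a [b [-> -> ab]]]]]].
  apply: connect1; apply/and3P; split.
  - by rewrite inE inE1; case: (a). - by rewrite inE inE1; case: (b).
  have E c : gL (inl c) = hL (outer13 c) by case: c.
  by rewrite !E connect_rel_im // -dmulE ab.
apply: connect1; apply/and3P; split.
- by rewrite inE inE1; case: (a). - by rewrite inE inE1; case: (b).
apply/orP; right; apply/rel_imP; exists a, b; split=> //.
  by case: (a). by case: (b).
Qed.

Let eR'E : connect eR' =2 connect (rel_im gR (glue d1 (dmul d2 d3))).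
Proof.
move=> u v; apply/idP/idP; apply: connect_sub => x y.
  case/and3P=> Wx Wy /orP[xy|/rel_imP[p [q [-> -> pq]]]]; last first.
    apply: connect1; apply/rel_imP; exists (inl p), (inl q).
    split; [by case: (p)|by case: (q)|].
    by apply/orP; left; apply/rel_imP; exists p, q.
  have H w : w \in WR -> (exists i, w = inl (inl (inl i))) \/
             exists2 p, w = gR (bot23 p) & w = hR (outer13 p).
    case: w => [[[i|i]|i]|i]; rewrite !inE inE2 //= => _.
    - by left; exists i.
    - by right; exists (inl i).
    by right; exists (inr i).
  case: (H _ Wx) => [[i Ei]|[p Ep Ep']].
    by rewrite Ei in xy *; rewrite (connect_eR1_top xy) connect0.
  case: (H _ Wy) => [[i Ei]|[q Eq Eq']].
    have yx : connect eR1 y x by have /(_ x y)<- := sym_connect_sym seR1.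
    by rewrite Ei in yx *; rewrite (connect_eR1_top yx) connect0.
  rewrite Ep Eq; apply: connect1; apply/rel_imP; exists (bot23 p), (bot23 q).
  split=> //; apply/orP; right; apply/rel_imP; exists p, q; split=> //.
  by rewrite dmulE -(connect_rel_im hR_inj) -Ep' -Eq'.
move=> /rel_imP[p [q [-> -> /orP[]/rel_imP[a [b [-> -> ab]]]]]]; last first.
  apply: connect1; apply/and3P; split.
  - by rewrite inE inE2; case: (a). - by rewrite inE inE2; case: (b).
  have E c : gR (bot23 c) = hR (outer13 c) by case: c.
  by rewrite !E connect_rel_im // -dmulE ab.
apply: connect1; apply/and3P; split.
- by rewrite inE inE2; case: (a). - by rewrite inE inE2; case: (b).
apply/orP; right; apply/rel_imP; exists a, b; split=> //.
  by case: (a). by case: (b).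
Qed.

Lemma dmulA : dmul d1 (dmul d2 d3) = dmul (dmul d1 d2) d3.
Proof.
apply: diag_eq => p q; rewrite (dmulE d1) (dmulE _ d3).
have E c : gR (outer13 c) = gL (outer13 c) by case: c.
have EL c : gL (outer13 c) \in WL by rewrite inE inE1; case: c.
have ER c : gL (outer13 c) \in WR by rewrite inE inE2; case: c.
have {}EL := @glue_connect _ eL1 _ _ eL2W _ _ (EL p) (EL q).
have {}ER := @glue_connect _ eR1 _ _ eR2W _ _ (ER p) (ER q).
have EL1 := connect_rel_im gL_inj (glue (dmul d1 d2) d3) (outer13 p) (outer13 q).
have ER1 := connect_rel_im gR_inj (glue d1 (dmul d2 d3)) (outer13 p) (outer13 q).
have EL2 := eL'E (gL (outer13 p)) (gL (outer13 q)).
have ER2 := eR'E (gL (outer13 p)) (gL (outer13 q)).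
rewrite (E p) (E q) in ER1.
apply: (etrans (esym ER1)); apply: (etrans (esym ER2)); apply: (etrans ER).
apply: (etrans (esym (eq_big _ _))); apply: (etrans (esym EL)).
exact: (etrans EL2 EL1).
Qed.

Lemma dloopsA :
  (dloops d1 d2 + dloops (dmul d1 d2) d3 = dloops d2 d3 + dloops d1 (dmul d2 d3))%N.
Proof.
have h1 : hL @: middle n = M1.
  by rewrite /middle -imset_comp.
have h2 : hR @: middle n = M2 by rewrite /middle -imset_comp.
have h3 : gL @: middle n = M2 by rewrite /middle -imset_comp.
have h4 : gR @: middle n = M1 by rewrite /middle -imset_comp.
have sL : M2 \subset WL by apply/subsetP=> u; rewrite inE inE1 inE2; case: u => [[]|].
have sR : M1 \subset WR by apply/subsetP=> u; rewrite inE inE1 inE2; case: u => [[[]|]|].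
have EL := glue_count seL1 seL2 eL2W sL; have ER := glue_count seR1 seR2 eR2W sR.
rewrite /WL /WR !setCK -/WL -/WR in EL ER.
have L1 := comps_in_rel_im hL_inj (glue d1 d2) (middle n).
have R1 := comps_in_rel_im hR_inj (glue d2 d3) (middle n).
have L2 := comps_in_rel_im gL_inj (glue (dmul d1 d2) d3) (middle n).
have R2 := comps_in_rel_im gR_inj (glue d1 (dmul d2 d3)) (middle n).
have L3 := congr1 (fun A : {set {set T4}} => #|A|) (eq_comps_in M2 eL'E).
have R3 := congr1 (fun A : {set {set T4}} => #|A|) (eq_comps_in M1 eR'E).
have B := congr1 (fun A : {set {set T4}} => #|A|) (eq_comps_in (M2 :|: M1) eq_big).
rewrite h1 in L1; rewrite h2 in R1; rewrite h3 in L2; rewrite h4 in R2.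
have {L2}L2 : #|comps_in eL' M2| = dloops (dmul d1 d2) d3 := etrans L3 (etrans L2 (esym (dloopsE _ _))).
have {R2}R2 : #|comps_in eR' M1| = dloops d1 (dmul d2 d3) := etrans R3 (etrans R2 (esym (dloopsE _ _))).
have {}EL := etrans EL (congr2 addn (etrans L1 (esym (dloopsE _ _))) L2).
have {}ER := etrans ER (congr2 addn (etrans R1 (esym (dloopsE _ _))) R2).
apply: (etrans (esym EL)); apply: (etrans B); apply: etrans ER.
by rewrite setUC.
Qed.

End Triple.
End Assoc.

(* The diagram with parts {upper i, lower (s i)}; see perm_diagM. *)
Definition perm_diag n (s : 'S_n) : pdiag n :=
  ker_diag (fun p => match p with inl i => s i | inr j => j end).

Definition std_key n (i : nat) (p : pts n) : pts n :=
  match p with inl j => inl j | inr j => if j < i then inl j else inr j end.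

(* Parts {upper j, lower j} for j < i, all other points being singletons; for
   i <= n it has rank i (rank_std). It is the diagram of rank i chosen below to
   build the standard modules. *)
Definition std_diag n i : pdiag n := ker_diag (@std_key n i).

(* s on {0, .., i-1}, extended by the identity. *)
Definition ext_fun n i (s : 'S_i) (j : 'I_n) : 'I_n :=
  if insub (val j) is Some j' then insubd j (val (s j')) else j.

Definition left_cell n (d : pdiag n) : {set pdiag n} :=
  [set l | (rank l == rank d) && [exists e, l == dmul e d]].

Section MorePdiag.
Variable n : nat.
Implicit Types (d e : pdiag n) (s : 'S_n).

Lemma edge_top d d' p q : same d p q -> glue d d' (inl p) (inl q).
Proof. by move=> pq; apply/orP; left; apply/rel_imP; exists p, q. Qed.

Lemma edge_bot d d' p q : same d' p q -> glue d d' (bot23 p) (bot23 q).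
Proof. by move=> pq; apply/orP; right; apply/rel_imP; exists p, q. Qed.

Lemma glueP d d' u v :
  glue d d' u v ->
  (exists p q, [/\ u = inl p, v = inl q & same d p q]) \/
  (exists p q, [/\ u = bot23 p, v = bot23 q & same d' p q]).
Proof. by case/orP=> /rel_imP; [left|right]. Qed.

Definition low_map (f : 'I_n -> 'I_n) (p : pts n) : pts n :=
  match p with inl i => inl i | inr j => inr (f j) end.
Definition up_map (f : 'I_n -> 'I_n) (p : pts n) : pts n :=
  match p with inl i => inl (f i) | inr j => inr j end.

Lemma dmul_permE d s p q :
  same (dmul d (perm_diag s)) p q = same d (low_map (s^-1)%g p) (low_map (s^-1)%g q).
Proof.
rewrite dmulE.
pose phi (u : pts3 n) : pts n :=
  match u with inl x => x | inr j => inr ((s^-1)%g j) end.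
have phiE r : phi (outer13 r) = low_map (s^-1)%g r by case: r.
apply/idP/idP => [c|pq].
  rewrite -!phiE same_pblockE; apply/eqP.
  apply: (connect_preserve (f := fun u => pblock d (phi u)) _ c).
  move=> x y /glueP[[a [b [-> -> /= ab]]]|[a [b [-> -> ab]]]].
    by apply/eqP; rewrite -same_pblockE.
  congr (pblock d _); move: ab; rewrite ker_diagE => /eqP.
  case: a b => a [] b /=; first by move=> /perm_inj->.
  - by move=> <-; rewrite permK.
  - by move=> ->; rewrite permK.
  by move=> ->.
have C r : connect (glue d (perm_diag s)) (outer13 r) (inl (low_map (s^-1)%g r)).
  case: r => j /=; first exact: connect0.
  apply: connect1; apply: (@edge_bot _ _ (inr j) (inl _)).
  by rewrite ker_diagE permKV.
apply: connect_trans (C p) _; rewrite (sym_connect_sym (glue_sym _ _)).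
apply: connect_trans (C q) _; rewrite (sym_connect_sym (glue_sym _ _)).
by apply: connect1; apply: edge_top.
Qed.

Lemma perm_dmulE d s p q :
  same (dmul (perm_diag s) d) p q = same d (up_map s p) (up_map s q).
Proof.
rewrite dmulE.
pose phi (u : pts3 n) : pts n :=
  match u with inl (inl i) => inl (s i) | inl (inr i) => inl i | inr j => inr j end.
have phiE r : phi (outer13 r) = up_map s r by case: r.
have phib r : phi (bot23 r) = r by case: r.
apply/idP/idP => [c|pq].
  rewrite -!phiE same_pblockE; apply/eqP.
  apply: (connect_preserve (f := fun u => pblock d (phi u)) _ c).
  move=> x y /glueP[[a [b [-> -> /= ab]]]|[a [b [-> -> ab]]]]; last first.
    by rewrite !phib; apply/eqP; rewrite -same_pblockE.
  congr (pblock d _); move: ab; rewrite ker_diagE => /eqP.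
  by case: a b => a [] b //= ->.
have C r : connect (glue (perm_diag s) d) (outer13 r) (bot23 (up_map s r)).
  case: r => j /=; last exact: connect0.
  by apply: connect1; apply: (@edge_top _ _ (inl j) (inr _)); rewrite ker_diagE.
apply: connect_trans (C p) _; rewrite (sym_connect_sym (glue_sym _ _)).
apply: connect_trans (C q) _; rewrite (sym_connect_sym (glue_sym _ _)).
by apply: connect1; apply: edge_bot.
Qed.

Lemma dloops_eq0 d d' :
  (forall i, exists2 v, v \notin middle n & connect (glue d d') (inl (inr i)) v) ->
  dloops d d' = 0.
Proof.
move=> H; rewrite dloopsE; apply/eqP; rewrite cards_eq0; apply/eqP/setP=> B.
rewrite [RHS]inE; apply/negbTE/comps_inP=> -[u -> sB].
have /imsetP[i _ Eu] : u \in middle n.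
  by apply: (subsetP sB); rewrite inE connect0.
have [v /negP nv uv] := H i; apply: nv; apply: (subsetP sB).
by rewrite inE Eu.
Qed.

Lemma dloops_perm d s : dloops d (perm_diag s) = 0.
Proof.
apply: dloops_eq0 => i; exists (inr (s i)); first by apply/imsetP=> -[].
apply: connect1; apply: (@edge_bot _ _ (inl i) (inr _)).
by rewrite ker_diagE.
Qed.

Lemma perm_dloops d s : dloops (perm_diag s) d = 0.
Proof.
apply: dloops_eq0 => i; exists (inl (inl ((s^-1)%g i))); first by apply/imsetP=> -[].
apply: connect1; apply: (@edge_top _ _ (inr i) (inl _)).
by rewrite ker_diagE permKV.
Qed.

Lemma perm_diag1 : perm_diag 1 = idd n.
Proof.
by apply: diag_eq => -[p|p] [q|q]; rewrite !ker_diagE ?perm1.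
Qed.

Lemma dmul_idl d : dmul (idd n) d = d.
Proof.
apply: diag_eq => p q; rewrite -perm_diag1 perm_dmulE.
by case: p q => p [] q; rewrite /= ?perm1.
Qed.

Lemma dmul_idr d : dmul d (idd n) = d.
Proof.
apply: diag_eq => p q; rewrite -perm_diag1 dmul_permE invg1.
by case: p q => p [] q; rewrite /= ?perm1.
Qed.

Lemma dloops_idl d : dloops (idd n) d = 0.
Proof. by rewrite -perm_diag1 perm_dloops. Qed.

Lemma dloops_idr d : dloops d (idd n) = 0.
Proof. by rewrite -perm_diag1 dloops_perm. Qed.

Lemma perm_diagM s t : perm_diag (s * t) = dmul (perm_diag s) (perm_diag t).
Proof.
apply: diag_eq => p q; rewrite perm_dmulE !ker_diagE.
by case: p q => p [] q; rewrite /= ?permM.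
Qed.

Lemma propagatingP d B :
  reflect (exists i j, B = pblock d (inl i) /\ same d (inl i) (inr j))
          (B \in propagating d).
Proof.
rewrite inE; apply: (iffP and3P) => [[dB /set0Pn[p Bp] /set0Pn[q Bq]]|[i [j [-> ij]]]].
  move: Bp Bq; rewrite !inE => /andP[Bp /imsetP[i _ Ei]] /andP[Bq /imsetP[j _ Ej]].
  rewrite {p}Ei {q}Ej in Bp Bq; exists i, j.
  by rewrite /same /= (def_pblock (trivI_diag d) dB Bp).
split; first by apply/blocksE; exists (inl i).
  by apply/set0Pn; exists (inl i); rewrite !inE mem_pblock cover_diag inE imset_f.
by apply/set0Pn; exists (inr j); rewrite !inE imset_f ?andbT.
Qed.

Lemma rank_dmulr d d' : rank (dmul d d') <= rank d'.
Proof.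
pose F (B : {set pts n}) : {set pts n} :=
  if [pick j | inr j \in B] is Some j then pblock (dmul d d') (inr j) else set0.
suff /subset_leq_card : propagating (dmul d d') \subset F @: propagating d'.
  move/leq_trans; apply; exact: leq_imset_card.
apply/subsetP=> B /propagatingP[i [j [-> ij]]].
have c : connect (glue d d') (inr j) (inl (inl i)).
  by rewrite (sym_connect_sym (glue_sym _ _)); move: ij; rewrite dmulE.
case: (boolP [exists k, exists m,
    connect (glue d d') (inr j) (inr k) && same d' (inr k) (inl m)]).
  case/existsP=> k /existsP[m /andP[jk km]].
  apply/imsetP; exists (pblock d' (inl m)).
    by apply/propagatingP; exists m, k; rewrite same_sym.
  rewrite /F; case: pickP => [k' Hk'|/(_ k)]; last first.
    by rewrite same_sym /same /= in km; rewrite km.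
  apply/eqP; rewrite -same_pblockE; apply: (same_trans ij); rewrite dmulE.
  apply: connect_trans jk _; apply: connect1; apply: (@edge_bot _ _ (inr k) (inr k')).
  by apply: same_trans km _.
move=> /negP nH.
have : exists k, inl (inl i) = inr k :> pts3 n; last by case.
suff [k [-> _]] : exists k, inl (inl i) = inr k :> pts3 n /\ connect (glue d d') (inr j) (inr k).
  by exists k.
apply: (connect_ind (P := fun u => exists k, u = inr k :> pts3 n /\ connect (glue d d') (inr j) (inr k)) _ c).
  move=> x y xy [k [Ex jk]]; rewrite {x}Ex in xy.
  case/glueP: xy => -[p [q []]] // Ep Ey pq.
  case: p Ep pq => // k' [<-] kq; case: q Ey kq => m Ey km.
    by case: nH; apply/existsP; exists k; apply/existsP; exists m; rewrite jk.
  exists m; split=> //; apply: connect_trans jk _; apply: connect1.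
  exact: (@edge_bot _ _ (inr k) (inr m)).
by exists j.
Qed.

Lemma rank_dmull d d' : rank (dmul d d') <= rank d.
Proof.
pose F (B : {set pts n}) : {set pts n} :=
  if [pick j | inl j \in B] is Some j then pblock (dmul d d') (inl j) else set0.
suff /subset_leq_card : propagating (dmul d d') \subset F @: propagating d.
  move/leq_trans; apply; exact: leq_imset_card.
apply/subsetP=> B /propagatingP[i [j [-> ij]]].
have c : connect (glue d d') (inl (inl i)) (inr j).
  by move: ij; rewrite dmulE.
case: (boolP [exists k, exists m,
    connect (glue d d') (inl (inl i)) (inl (inl k)) && same d (inl k) (inr m)]).
  case/existsP=> k /existsP[m /andP[jk km]].
  apply/imsetP; exists (pblock d (inl k)).
    by apply/propagatingP; exists k, m.
  rewrite /F; case: pickP => [k' Hk'|/(_ k)]; last first.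
    by move: (same_refl d (inl k)); rewrite /same /= => ->.
  apply/eqP; rewrite -same_pblockE dmulE.
  by apply: connect_trans jk _; apply: connect1; apply: edge_top.
move=> /negP nH.
suff [k [//]] : exists k, inr j = inl (inl k) :> pts3 n /\ connect (glue d d') (inl (inl i)) (inl (inl k)).
apply: (connect_ind (P := fun u => exists k, u = inl (inl k) :> pts3 n /\ connect (glue d d') (inl (inl i)) (inl (inl k))) _ c).
  move=> x y xy [k [Ex jk]]; rewrite {x}Ex in xy.
  case/glueP: xy => -[p [q []]]; last by case: p.
  move=> [<-] Ey kq; case: q Ey kq => m Ey km; last first.
    by case: nH; apply/existsP; exists k; apply/existsP; exists m; rewrite jk.
  exists m; split=> //; apply: connect_trans jk _; apply: connect1.
  exact: edge_top.
by exists i.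
Qed.

Lemma dmul_permK d s : dmul (dmul d (perm_diag s)) (perm_diag (s^-1)%g) = d.
Proof. by rewrite -dmulA -perm_diagM mulgV perm_diag1 dmul_idr. Qed.

Lemma rank_dmul_perm d s : rank (dmul d (perm_diag s)) = rank d.
Proof.
apply/eqP; rewrite eqn_leq rank_dmull /= -{1}(dmul_permK d s).
exact: rank_dmull.
Qed.

Section Ext.
Variables (i : nat) (le_i_n : i <= n).

Lemma ext_funE (s : 'S_i) (j : 'I_n) (lt_j : j < i) :
  ext_fun s j = s (Ordinal lt_j) :> nat.
Proof.
rewrite /ext_fun insubT /= val_insubd.
by rewrite (leq_trans (ltn_ord _) le_i_n).
Qed.

Lemma ext_fun_out (s : 'S_i) (j : 'I_n) : i <= j -> ext_fun s j = j.
Proof. by move=> le; rewrite /ext_fun insubN // -leqNgt. Qed.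

Lemma ext_fun_lt (s : 'S_i) (j : 'I_n) : (ext_fun s j < i) = (j < i).
Proof.
case: (ltnP j i) => [lt|le]; last by rewrite ext_fun_out // ltnNge le.
by rewrite ext_funE ltn_ord.
Qed.

Lemma ext_fun_inj (s : 'S_i) : injective (@ext_fun n i s).
Proof.
move=> j k E; have := ext_fun_lt s j; rewrite E ext_fun_lt.
case: (ltnP j i) => [lt_j|le_j]; case: (ltnP k i) => [lt_k|le_k] // _.
  have := congr1 val E; rewrite /= !ext_funE => /val_inj/perm_inj[?].
  exact: val_inj.
by rewrite !ext_fun_out in E.
Qed.

End Ext.

End MorePdiag.

Definition ext_perm n i (le_i_n : i <= n) (s : 'S_i) : 'S_n :=
  perm (ext_fun_inj le_i_n (s := s)).

Section Cell.
Variables (n i : nat) (le_i_n : i <= n).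
Implicit Types (d e l : pdiag n) (s : 'S_i).

Lemma std_perm_comm s :
  dmul (std_diag n i) (perm_diag (ext_perm le_i_n s)) =
  dmul (perm_diag (ext_perm le_i_n s)) (std_diag n i).
Proof.
set t := ext_perm _ _.
have tlt j : ((t : 'S_n) j < i) = (j < i) by rewrite permE ext_fun_lt.
have tlt' j : ((t^-1)%g j < i) = (j < i) by rewrite -tlt permKV.
have inle (a b : 'I_n) : (inl a == inl b :> pts n) = (a == b) by [].
have inre (a b : 'I_n) : (inr a == inr b :> pts n) = (a == b) by [].
have fix_t (a : 'I_n) : i <= a -> t a = a by move=> ?; rewrite permE ext_fun_out.
apply: diag_eq => p q; rewrite dmul_permE perm_dmulE !ker_diagE.
case: p q => p [] q /=; rewrite ?tlt'.
- by rewrite !inle (inj_eq perm_inj).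
- by case: ltnP => //= _; rewrite !inle -(inj_eq (@perm_inj _ t)) permKV.
- by case: ltnP => //= _; rewrite !inle -(inj_eq (@perm_inj _ t)) permKV.
by case: (ltnP p i) => lp; case: (ltnP q i) => lq; rewrite //= ?inle ?inre (inj_eq perm_inj).
Qed.

Lemma left_cell_perm l s :
  (dmul l (perm_diag (ext_perm le_i_n s)) \in left_cell (std_diag n i)) =
  (l \in left_cell (std_diag n i)).
Proof.
rewrite !inE rank_dmul_perm; congr (_ && _).
apply/existsP/existsP => -[e /eqP E].
  exists (dmul e (perm_diag (ext_perm le_i_n s)^-1)); apply/eqP.
  rewrite -[l](dmul_permK _ (ext_perm le_i_n s)) E -!dmulA; congr dmul.
  have := std_perm_comm s; set t := ext_perm _ _ => C.
  rewrite -[LHS]dmul_idl -perm_diag1 -(mulVg t) perm_diagM -dmulA; congr dmul.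
  by rewrite dmulA -C -dmulA -perm_diagM mulgV perm_diag1 dmul_idr.
exists (dmul e (perm_diag (ext_perm le_i_n s))); apply/eqP.
by rewrite E -!dmulA std_perm_comm.
Qed.

End Cell.

Lemma left_cell_mul n (d e l : pdiag n) :
  l \in left_cell d -> rank (dmul e l) = rank d -> dmul e l \in left_cell d.
Proof.
rewrite !inE => /andP[_ /existsP[f /eqP->]] ->; rewrite eqxx /=.
by apply/existsP; exists (dmul e f); rewrite dmulA.
Qed.

Lemma left_cell_mulr n (d e e' l : pdiag n) : l \in left_cell d ->
  dmul e (dmul e' l) \in left_cell d -> dmul e' l \in left_cell d.
Proof.
move=> dl; rewrite inE => /andP[/eqP rE _]; apply: left_cell_mul => //.
apply/eqP; rewrite eqn_leq -{2}rE rank_dmulr andbT.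
by move: dl; rewrite inE => /andP[/eqP<- _]; rewrite rank_dmulr.
Qed.

Lemma rank_std n i : i <= n -> rank (std_diag n i) = i.
Proof.
move=> le; rewrite /rank.
pose F (j : 'I_i) := pblock (std_diag n i) (inl (widen_ord le j)).
have -> : propagating (std_diag n i) = F @: [set: 'I_i].
  apply/setP=> B; apply/propagatingP/imsetP => [[a [b [->]]]|[j _ ->]].
    rewrite ker_diagE /=; case: ltnP => // lt /eqP[E].
    rewrite -E in lt; exists (Ordinal lt); rewrite ?inE // /F.
    by have -> : widen_ord le (Ordinal lt) = a by apply: val_inj.
  by exists (widen_ord le j), (widen_ord le j); rewrite ker_diagE /= ltn_ord.
rewrite card_imset ?cardsT ?card_ord // => j k /eqP.
by rewrite /F -same_pblockE ker_diagE /= => /eqP[/val_inj].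
Qed.

Local Open Scope ring_scope.

(* u : partalg n x is the linear combination of the diagrams d with coefficients
   u d. *)
Definition partalg (k : fieldType) (n : nat) (x : k) : Type :=
  {ffun pdiag n -> k^o}.

HB.instance Definition _ (k : fieldType) n (x : k) :=
  GRing.Lmodule.on (partalg n x).

HB.lock Definition dbasis (k : fieldType) n (x : k) (d : pdiag n) : partalg n x :=
  [ffun e => (e == d)%:R].

HB.lock Definition pa_mul (k : fieldType) n (x : k) (u v : partalg n x) :
  partalg n x :=
  \sum_d \sum_e (u d * v e * x ^+ dloops d e) *: dbasis x (dmul d e).

Section PartAlg.
Variables (k : fieldType) (n : nat) (x : k).
Local Notation A := (partalg n x).
Local Notation dbasis := (@dbasis k n x).
Local Notation pa_mul := (@pa_mul k n x).

Lemma dbasisE d e : dbasis d e = (e == d)%:R.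
Proof. by rewrite dbasis.unlock ffunE. Qed.

Lemma pa_mulE u v :
  pa_mul u v = \sum_d \sum_e (u d * v e * x ^+ dloops d e) *: dbasis (dmul d e).
Proof. by rewrite pa_mul.unlock. Qed.

Lemma dbasis_expand (u : A) : u = \sum_d u d *: dbasis d.
Proof.
apply/ffunP=> e.
rewrite sum_ffunE.
rewrite (bigD1 e) //=.
rewrite big1 => [|d de].
  rewrite addr0 ffunE dbasisE eqxx.
  exact/esym/mulr1.
rewrite ffunE dbasisE eq_sym (negPf de).
exact: mulr0.
Qed.

Lemma pa_mulDl : left_distributive pa_mul +%R.
Proof.
move=> u v w; rewrite !pa_mulE -big_split; apply: eq_bigr => d _.
rewrite -big_split; apply: eq_bigr => e _ /=.
by rewrite -scalerDl ffunE !mulrDl.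
Qed.

Lemma pa_mulDr : right_distributive pa_mul +%R.
Proof.
move=> u v w; rewrite !pa_mulE -big_split; apply: eq_bigr => d _.
rewrite -big_split; apply: eq_bigr => e _ /=.
by rewrite -scalerDl ffunE mulrDr mulrDl.
Qed.

Lemma pa_mulZl a u v : pa_mul (a *: u) v = a *: pa_mul u v.
Proof.
rewrite !pa_mulE scaler_sumr; apply: eq_bigr => d _.
rewrite scaler_sumr; apply: eq_bigr => e _.
by rewrite scalerA ffunE -!mulrA.
Qed.

Lemma pa_mulZr a u v : pa_mul u (a *: v) = a *: pa_mul u v.
Proof.
rewrite !pa_mulE scaler_sumr; apply: eq_bigr => d _.
rewrite scaler_sumr; apply: eq_bigr => e _.
by rewrite scalerA ffunE -!mulrA mulrCA !mulrA.
Qed.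

Lemma pa_mul_sumr (I : Type) (r : seq I) (u : A) (F : I -> A) :
  pa_mul u (\sum_(i <- r) F i) = \sum_(i <- r) pa_mul u (F i).
Proof.
have H0 : pa_mul u 0 = 0 by rewrite -(scale0r (0 : A)) pa_mulZr !scale0r.
exact: (big_morph (pa_mul u) (pa_mulDr u) H0).
Qed.

Lemma pa_mul_suml (I : Type) (r : seq I) (u : A) (F : I -> A) :
  pa_mul (\sum_(i <- r) F i) u = \sum_(i <- r) pa_mul (F i) u.
Proof.
have H0 : pa_mul 0 u = 0 by rewrite -(scale0r (0 : A)) pa_mulZl !scale0r.
exact: (big_morph (fun v => pa_mul v u) (fun v w => pa_mulDl v w u) H0).
Qed.

Lemma pa_mul_basis d e :
  pa_mul (dbasis d) (dbasis e) = x ^+ dloops d e *: dbasis (dmul d e).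
Proof.
rewrite pa_mulE (bigD1 d) //= (bigD1 e) //= !dbasisE !eqxx !mul1r.
rewrite big1 ?addr0 => [|f fe]; last first.
  by rewrite !dbasisE (negPf fe) mulr0 mul0r scale0r.
rewrite big1 ?addr0 // => f fd; rewrite big1 // => g _.
by rewrite !dbasisE (negPf fd) !mul0r scale0r.
Qed.

Lemma pa_mul_l u v : pa_mul u v = \sum_d u d *: pa_mul (dbasis d) v.
Proof.
by rewrite {1}[u]dbasis_expand pa_mul_suml; apply: eq_bigr => d _; rewrite pa_mulZl.
Qed.

Lemma pa_mul_r u v : pa_mul u v = \sum_d v d *: pa_mul u (dbasis d).
Proof.
by rewrite {1}[v]dbasis_expand pa_mul_sumr; apply: eq_bigr => d _; rewrite pa_mulZr.
Qed.

Lemma pa_mulA : associative pa_mul.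
Proof.
move=> u v w; rewrite [LHS]pa_mul_l [pa_mul u v]pa_mul_l pa_mul_suml.
apply: eq_bigr => d _; rewrite pa_mulZl; congr (_ *: _).
rewrite [pa_mul v w]pa_mul_l [pa_mul _ v]pa_mul_r pa_mul_sumr pa_mul_suml.
apply: eq_bigr => e _; rewrite pa_mulZl pa_mulZr; congr (_ *: _).
rewrite [RHS]pa_mul_r [pa_mul _ w]pa_mul_r pa_mul_sumr.
apply: eq_bigr => f _; rewrite pa_mulZr; congr (_ *: _).
rewrite !pa_mul_basis pa_mulZl pa_mulZr !pa_mul_basis !scalerA -!exprD.
by rewrite dmulA dloopsA.
Qed.

Lemma pa_mul1l : left_id (dbasis (idd n)) pa_mul.
Proof.
move=> u; rewrite pa_mul_r [RHS]dbasis_expand; apply: eq_bigr => d _.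
by rewrite pa_mul_basis dloops_idl dmul_idl expr0 scale1r.
Qed.

Lemma pa_mul1r : right_id (dbasis (idd n)) pa_mul.
Proof.
move=> u; rewrite pa_mul_l [RHS]dbasis_expand; apply: eq_bigr => d _.
by rewrite pa_mul_basis dloops_idr dmul_idr expr0 scale1r.
Qed.

Lemma pa_one_neq0 : dbasis (idd n) != 0.
Proof.
apply/eqP=> /ffunP/(_ (idd n)); rewrite dbasisE ffunE eqxx => /eqP.
by rewrite oner_eq0.
Qed.

HB.instance Definition _ := GRing.Zmodule_isNzRing.Build A
  pa_mulA pa_mul1l pa_mul1r pa_mulDl pa_mulDr pa_one_neq0.

Lemma pa_scaleAl (a : k) (u v : A) : a *: (u * v) = a *: u * v.
Proof. exact/esym/pa_mulZl. Qed.

Lemma pa_scaleAr (a : k) (u v : A) : a *: (u * v) = u * (a *: v).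
Proof. exact/esym/pa_mulZr. Qed.

HB.instance Definition _ := GRing.Lmodule_isLalgebra.Build k A pa_scaleAl.
HB.instance Definition _ := GRing.Lalgebra_isAlgebra.Build k A pa_scaleAr.

Lemma dbasisM d e :
  dbasis d * dbasis e = x ^+ dloops d e *: dbasis (dmul d e).
Proof. exact: pa_mul_basis. Qed.

Lemma dbasis1 : dbasis (idd n) = 1.
Proof. by []. Qed.

End PartAlg.


Definition submodule (R : nzRingType) (V : lmodType R) (U : submodClosed V) : Type :=
  {v : V | v \in U}.

Section Submodule.
Variables (R : nzRingType) (V : lmodType R) (U : submodClosed V).
HB.instance Definition _ := [isSub of submodule U for @sval V _].
HB.instance Definition _ := [Choice of submodule U by <:].
HB.instance Definition _ := [SubChoice_isSubLmodule of submodule U by <:].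
End Submodule.

Definition in_submodule (R : nzRingType) (V : lmodType R) (U : submodClosed V) :
  {pred V} := [pred v | v \in U].

Lemma in_submodule_closed (R : nzRingType) (V : lmodType R) (U : submodClosed V) :
  submod_closed (in_submodule U).
Proof. exact: (submodClosedP U). Qed.

HB.instance Definition _ (R : nzRingType) (V : lmodType R) (U : submodClosed V) :=
  GRing.isSubmodClosed.Build R V (in_submodule U) (in_submodule_closed U).

Definition quotmod (R : nzRingType) (V : lmodType R) (U : submodClosed V) : Type :=
  Quotient.quot (in_submodule U).

Section Quotmod.
Variables (R : nzRingType) (V : lmodType R) (U : submodClosed V).
Local Notation Q := (quotmod U).

HB.instance Definition _ := GRing.Zmodule.on Q.

Definition to_quot (v : V) : Q :=
  (\pi_(Quotient.quot (in_submodule U)) v)%qT.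

Lemma to_quot_eqP v w : reflect (to_quot v = to_quot w) (v - w \in U).
Proof.
rewrite -[_ \in U]/(_ \in in_submodule U) Quotient.idealrBE; exact: eqP.
Qed.

Lemma to_quotD : {morph to_quot : v w / v + w}.
Proof. exact: Quotient.pi_add. Qed.

Lemma to_quot_surj q : exists v, q = to_quot v.
Proof. by exists (generic_quotient.repr (q : Quotient.quot _)); rewrite /to_quot reprK. Qed.

Definition quot_scale (a : R) (q : Q) : Q :=
  to_quot (a *: generic_quotient.repr (q : Quotient.quot (in_submodule U))).

Lemma quot_scaleE a v : quot_scale a (to_quot v) = to_quot (a *: v).
Proof.
apply/to_quot_eqP; rewrite -scalerBr rpredZ //.
by apply/to_quot_eqP; rewrite /to_quot reprK.
Qed.

Lemma quot_scaleA a b q : quot_scale a (quot_scale b q) = quot_scale (a * b) q.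
Proof. by have [v ->] := to_quot_surj q; rewrite !quot_scaleE scalerA. Qed.

Lemma quot_scale1 : left_id 1 quot_scale.
Proof. by move=> q; have [v ->] := to_quot_surj q; rewrite quot_scaleE scale1r. Qed.

Lemma quot_scaleDr : right_distributive quot_scale +%R.
Proof.
move=> a q r; have [v ->] := to_quot_surj q; have [w ->] := to_quot_surj r.
by rewrite -to_quotD !quot_scaleE scalerDr to_quotD.
Qed.

Lemma quot_scaleDl q : {morph quot_scale^~ q : a b / a + b}.
Proof.
by move=> a b; have [v ->] := to_quot_surj q; rewrite !quot_scaleE scalerDl to_quotD.
Qed.

HB.instance Definition _ := GRing.Zmodule_isLmodule.Build R Q
  quot_scaleA quot_scale1 quot_scaleDr quot_scaleDl.

Lemma to_quot_is_linear : linear to_quot.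
Proof. by move=> a v w; rewrite to_quotD -quot_scaleE. Qed.

HB.instance Definition _ := GRing.isLinear.Build R V Q _ to_quot to_quot_is_linear.

Lemma to_quotZ a v : to_quot (a *: v) = a *: to_quot v.
Proof. exact: linearZ. Qed.

Lemma to_quot_eq0 v : (to_quot v == 0) = (v \in U).
Proof.
rewrite -{2}[v]subr0; apply/eqP/to_quot_eqP; by rewrite linear0.
Qed.

End Quotmod.

(* F :&: G as a submodule of F; equal to G when G is contained in F. *)
Definition relative (R : nzRingType) (V : lmodType R) (F G : submodClosed V) :
  {pred submodule F} := [pred u | val u \in G].
Arguments relative {R V} F G.

Lemma relative_closed (R : nzRingType) (V : lmodType R) (F G : submodClosed V) :
  submod_closed (relative F G).
Proof.
split=> [|a u v]; rewrite !inE ?raddf0 ?rpred0 // => Gu Gv.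
by rewrite linearP rpredD ?rpredZ.
Qed.

HB.instance Definition _ (R : nzRingType) (V : lmodType R) (F G : submodClosed V) :=
  GRing.isSubmodClosed.Build R (submodule F) (relative F G) (relative_closed F G).

(* The module F / G, for G contained in F. *)
Definition subquotient (R : nzRingType) (V : lmodType R) (F G : submodClosed V) :=
  quotmod (relative F G).

(* The smallest submodule containing P. *)
Definition span_pred (R : nzRingType) (V : lmodType R) (P : V -> Prop) : {pred V} :=
  [pred v | `[< forall U : submodClosed V, (forall w, P w -> w \in U) -> v \in U >]].

Lemma span_pred_closed (R : nzRingType) (V : lmodType R) (P : V -> Prop) :
  submod_closed (span_pred P).
Proof.
split=> [|a u v /asboolP Pu /asboolP Pv]; apply/asboolP=> U PU; first exact: rpred0.
by rewrite rpredD ?rpredZ ?Pu ?Pv.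
Qed.

HB.instance Definition _ (R : nzRingType) (V : lmodType R) (P : V -> Prop) :=
  GRing.isSubmodClosed.Build R V (span_pred P) (span_pred_closed P).

Lemma mem_span_pred (R : nzRingType) (V : lmodType R) (P : V -> Prop) v :
  P v -> v \in span_pred P.
Proof. by move=> Pv; apply/asboolP=> U; apply. Qed.

Lemma span_pred_sub (R : nzRingType) (V : lmodType R) (P : V -> Prop)
    (U : submodClosed V) :
  (forall w, P w -> w \in U) -> {subset span_pred P <= U}.
Proof. by move=> PU v /asboolP; apply. Qed.

Section Tensor.
Variables (k : fieldType) (X Y : lmodType k) (S : Type).
Variables (ra : S -> X -> X) (la : S -> Y -> Y).

Local Notation XY := (X * Y)%type.
Local Notation pure x y := (<< (x, y) >> : {malg k[XY]}).

(* X is seen as a right module and Y as a left module, the elements s of S acting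
   by ra s and la s. tens is the quotient of the free vector space on X * Y that
   makes tmk the universal balanced k-bilinear map. For S a group G acting
   linearly this is the tensor product over k[G], since k-bilinear maps that are
   G-balanced are k[G]-balanced. *)
Inductive tens_rel : {malg k[XY]} -> Prop :=
| TensDl x x' y : tens_rel (pure (x + x') y - (pure x y + pure x' y))
| TensDr x y y' : tens_rel (pure x (y + y') - (pure x y + pure x y'))
| TensZl a x y : tens_rel (pure (a *: x) y - a *: pure x y)
| TensZr a x y : tens_rel (pure x (a *: y) - a *: pure x y)
| TensB s x y : tens_rel (pure (ra s x) y - pure x (la s y)).

Definition tens : Type := quotmod (span_pred tens_rel).
HB.instance Definition _ := GRing.Lmodule.on tens.

Definition tmk (x : X) (y : Y) : tens := to_quot (span_pred tens_rel) (pure x y).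

Record balanced (V : lmodType k) (f : X -> Y -> V) : Prop := Balanced {
  balDl : forall x x' y, f (x + x') y = f x y + f x' y;
  balDr : forall x y y', f x (y + y') = f x y + f x y';
  balZl : forall a x y, f (a *: x) y = a *: f x y;
  balZr : forall a x y, f x (a *: y) = a *: f x y;
  balB : forall s x y, f (ra s x) y = f x (la s y) }.

Lemma tmk_balanced : balanced tmk.
Proof.
split=> [x x' y|x y y'|a x y|a x y|s x y]; rewrite /tmk.
- by rewrite -to_quotD; apply/to_quot_eqP/mem_span_pred/TensDl.
- by rewrite -to_quotD; apply/to_quot_eqP/mem_span_pred/TensDr.
- by rewrite -to_quotZ; apply/to_quot_eqP/mem_span_pred/TensZl.
- by rewrite -to_quotZ; apply/to_quot_eqP/mem_span_pred/TensZr.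
by apply/to_quot_eqP/mem_span_pred/TensB.
Qed.

Definition free_lift (V : lmodType k) (f : X -> Y -> V) (g : {malg k[XY]}) : V :=
  \sum_(p <- msupp g) g@_p *: f p.1 p.2.

Section FreeLift.
Variables (V : lmodType k) (f : X -> Y -> V).

Lemma free_liftw (D : {fset XY}) g : (msupp g `<=` D)%fset ->
  free_lift f g = \sum_(p <- D) g@_p *: f p.1 p.2.
Proof.
move=> le; rewrite [LHS](big_fset_incl _ le) => //= x xd /mcoeff_outdom ->.
by rewrite scale0r.
Qed.

Lemma free_lift_is_linear : linear (free_lift f).
Proof.
move=> a g h.
pose D := (msupp g `|` msupp h `|` msupp (a *: g + h))%fset.
have sg : (msupp g `<=` D)%fset by rewrite /D -fsetUA fsubsetUl.
have sh : (msupp h `<=` D)%fset.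
  by apply: fsubset_trans (fsubsetUl _ _); rewrite fsubsetUr.
have sgh : (msupp (a *: g + h) `<=` D)%fset by rewrite /D fsubsetUr.
rewrite (free_liftw sg) (free_liftw sh) (free_liftw sgh).
rewrite scaler_sumr -big_split; apply: eq_bigr => p _ /=.
by rewrite mcoeffD mcoeffZ scalerDl scalerA.
Qed.

HB.instance Definition _ :=
  GRing.isLinear.Build k {malg k[XY]} V _ (free_lift f) free_lift_is_linear.

Lemma free_liftB g h : free_lift f (g - h) = free_lift f g - free_lift f h.
Proof. exact: linearB. Qed.

Lemma free_liftD g h : free_lift f (g + h) = free_lift f g + free_lift f h.
Proof. exact: linearD. Qed.

Lemma free_liftZ a g : free_lift f (a *: g) = a *: free_lift f g.
Proof. exact: linearZ. Qed.

Lemma free_lift_pure x y : free_lift f (pure x y) = f x y.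
Proof.
by rewrite (free_liftw msuppU_le) big_seq_fset1 mcoeffUU scale1r.
Qed.

Definition free_ker : {pred {malg k[XY]}} := [pred g | free_lift f g == 0].

Lemma in_free_ker g : (g \in free_ker) = (free_lift f g == 0).
Proof. by []. Qed.

Lemma free_ker_closed : submod_closed free_ker.
Proof.
split=> [|a u v]; rewrite !inE ?linear0 // => /eqP u0 /eqP v0.
by rewrite free_lift_is_linear u0 v0 scaler0 addr0.
Qed.

HB.instance Definition _ :=
  GRing.isSubmodClosed.Build k {malg k[XY]} free_ker free_ker_closed.

Definition tens_lift (t : tens) : V :=
  free_lift f (generic_quotient.repr (t : Quotient.quot (in_submodule (span_pred tens_rel)))).

Hypothesis bal_f : balanced f.

Lemma tens_lift_quot g : tens_lift (to_quot (span_pred tens_rel) g) = free_lift f g.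
Proof.
apply/eqP; rewrite -subr_eq0 -linearB.
set h := _ - _; have : h \in span_pred tens_rel.
  by apply/to_quot_eqP; rewrite /to_quot reprK.
apply: (span_pred_sub (U := free_ker)) => _ [x x' y|x y y'|b x y|b x y|s x y];
rewrite in_free_ker free_liftB subr_eq0.
- by rewrite free_liftD !free_lift_pure (balDl bal_f).
- by rewrite free_liftD !free_lift_pure (balDr bal_f).
- by rewrite free_liftZ !free_lift_pure (balZl bal_f).
- by rewrite free_liftZ !free_lift_pure (balZr bal_f).
by rewrite !free_lift_pure (balB bal_f).
Qed.

Lemma tens_liftE x y : tens_lift (tmk x y) = f x y.
Proof. by rewrite tens_lift_quot free_lift_pure. Qed.

Lemma tens_lift_is_linear : linear tens_lift.
Proof.
move=> a t u; have [g ->] := to_quot_surj t; have [h ->] := to_quot_surj u.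
by rewrite -linearP !tens_lift_quot linearP.
Qed.

End FreeLift.

Lemma tens_lin_ext (V : lmodType k) (f g : {linear tens -> V}) :
  (forall x y, f (tmk x y) = g (tmk x y)) -> f =1 g.
Proof.
move=> E t; have [m ->] := to_quot_surj t.
rewrite (monalgE m) !linear_sum; apply: eq_bigr => -[x y] _ /=.
have -> : << m@_(x, y) *g (x, y) >> = m@_(x, y) *: pure x y.
  by apply/malgP=> p; rewrite mcoeffZ !mcoeffU mulrnAr mulr1.
by rewrite !linearZ /= E.
Qed.

End Tensor.

Section TensMap.
Variables (k : fieldType) (X Y : lmodType k) (S : Type).
Variables (ra : S -> X -> X) (la : S -> Y -> Y).
Local Notation T := (tens ra la).

Lemma tens_ext (V : lmodType k) (f g : T -> V) : linear f -> linear g ->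
  (forall x y, f (tmk ra la x y) = g (tmk ra la x y)) -> f =1 g.
Proof.
move=> lf lg E.
pose f' : {linear T -> V} := HB.pack f (GRing.isLinear.Build k T V _ f lf).
pose g' : {linear T -> V} := HB.pack g (GRing.isLinear.Build k T V _ g lg).
exact: (@tens_lin_ext _ _ _ _ ra la V f' g').
Qed.

Definition tens_map (f : X -> X) (g : Y -> Y) : T -> T :=
  tens_lift (fun x y => tmk ra la (f x) (g y)).

Lemma tens_map_balanced (f : X -> X) (g : Y -> Y) : linear f -> linear g ->
  (forall s x, f (ra s x) = ra s (f x)) -> (forall s y, g (la s y) = la s (g y)) ->
  balanced ra la (fun x y => tmk ra la (f x) (g y)).
Proof.
move=> lf lg fs gs; have [Dl Dr Zl Zr B] := tmk_balanced ra la.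
have fD x x' : f (x + x') = f x + f x' by have := lf 1 x x'; rewrite !scale1r.
have gD y y' : g (y + y') = g y + g y' by have := lg 1 y y'; rewrite !scale1r.
have f0 : f 0 = 0 by apply: (addrI (f 0)); rewrite -fD !addr0.
have g0 : g 0 = 0 by apply: (addrI (g 0)); rewrite -gD !addr0.
have fZ a x : f (a *: x) = a *: f x by have := lf a x 0; rewrite f0 !addr0.
have gZ a y : g (a *: y) = a *: g y by have := lg a y 0; rewrite g0 !addr0.
split=> *.
- by rewrite fD Dl.
- by rewrite gD Dr.
- by rewrite fZ Zl.
- by rewrite gZ Zr.
by rewrite fs gs B.
Qed.

End TensMap.

(* A module over partalg n x, presented by the action of the basis of diagrams. *)
Record diag_rep (k : fieldType) (n : nat) (x : k) := DiagRep {
  dr_space : lmodType k;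
  dr_act : pdiag n -> dr_space -> dr_space;
  dr_linear : forall d, linear (dr_act d);
  dr_act1 : forall v, dr_act (idd n) v = v;
  dr_actM : forall d e v,
    dr_act d (dr_act e v) = x ^+ dloops d e *: dr_act (dmul d e) v }.

(* The space of V with the partalg n x-module structure extending the action of
   the diagrams linearly. *)
Definition rep_mod (k : fieldType) (n : nat) (x : k) (V : diag_rep n x) : Type :=
  dr_space V.

Section RepMod.
Variables (k : fieldType) (n : nat) (x : k) (V : diag_rep n x).
HB.instance Definition _ := GRing.Zmodule.on (rep_mod V).

Definition rep_scale (u : partalg n x) (v : rep_mod V) : rep_mod V :=
  \sum_d u d *: dr_act d (v : dr_space V).

Let act0 d : dr_act d (0 : dr_space V) = 0.
Proof. by have := dr_linear d (-1) (0 : dr_space V) 0; rewrite scaler0 addr0 scaleN1r addNr. Qed.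

Let actD d (v w : dr_space V) : dr_act d (v + w) = dr_act d v + dr_act d w.
Proof. by have := dr_linear d 1 v w; rewrite !scale1r. Qed.

Let actZ d a (v : dr_space V) : dr_act d (a *: v) = a *: dr_act d v.
Proof. by have := dr_linear d a v 0; rewrite act0 !addr0. Qed.

Let act_sum d (I : Type) (r : seq I) (F : I -> dr_space V) :
  dr_act d (\sum_(i <- r) F i) = \sum_(i <- r) dr_act d (F i).
Proof. exact: (big_morph _ (actD d) (act0 d)). Qed.

Lemma rep_scaleDl v : {morph rep_scale^~ v : a b / a + b}.
Proof.
move=> a b; rewrite /rep_scale -big_split; apply: eq_bigr => d _.
by rewrite ffunE scalerDl.
Qed.

Lemma rep_scaleDr : right_distributive rep_scale +%R.
Proof.
move=> a v w; rewrite /rep_scale -big_split; apply: eq_bigr => d _.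
by rewrite actD scalerDr.
Qed.

Lemma rep_scale_basis d v : rep_scale (dbasis x d) v = dr_act d (v : dr_space V).
Proof.
rewrite /rep_scale (bigD1 d) //= dbasisE eqxx scale1r big1 ?addr0 // => e ed.
by rewrite dbasisE (negPf ed) scale0r.
Qed.

Lemma rep_scaleZ (c : k) u v :
  rep_scale (c *: u) v = c *: (rep_scale u v : dr_space V) :> dr_space V.
Proof.
rewrite /rep_scale scaler_sumr; apply: eq_bigr => d _.
by rewrite ffunE scalerA.
Qed.

Lemma rep_scale_suml (I : Type) (r : seq I) (F : I -> partalg n x) v :
  rep_scale (\sum_(i <- r) F i) v = \sum_(i <- r) rep_scale (F i) v.
Proof.
have H0 : rep_scale 0 v = 0.
  by rewrite /rep_scale big1 // => d _; rewrite ffunE scale0r.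
exact: (big_morph (rep_scale^~ v) (rep_scaleDl v) H0).
Qed.

Lemma rep_scaleA a b v : rep_scale a (rep_scale b v) = rep_scale (a * b) v.
Proof.
rewrite [a * b](pa_mulE a b) rep_scale_suml {1}/rep_scale; apply: eq_bigr => d _.
rewrite rep_scale_suml {1}/rep_scale act_sum scaler_sumr; apply: eq_bigr => e _.
by rewrite rep_scaleZ rep_scale_basis actZ dr_actM !scalerA.
Qed.

Lemma rep_scale1 : left_id 1 rep_scale.
Proof. by move=> v; rewrite -dbasis1 rep_scale_basis dr_act1. Qed.

HB.instance Definition _ := GRing.Zmodule_isLmodule.Build (partalg n x) (rep_mod V)
  rep_scaleA rep_scale1 rep_scaleDr rep_scaleDl.

End RepMod.

(* X as a k-vector space, by restriction of scalars along k -> A. *)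
Definition kmod (k : fieldType) (A : algType k) (X : lmodType A) : Type := X.

Section Kmod.
Variables (k : fieldType) (A : algType k) (X : lmodType A).
HB.instance Definition _ := GRing.Zmodule.on (kmod X).

Definition kmod_scale (c : k) (v : kmod X) : kmod X := c%:A *: (v : X).

Lemma kmod_scaleA a b v : kmod_scale a (kmod_scale b v) = kmod_scale (a * b) v.
Proof. by rewrite /kmod_scale scalerA -scalerAl mul1r scalerA. Qed.

Lemma kmod_scale1 : left_id 1 kmod_scale.
Proof. by move=> v; rewrite /kmod_scale !scale1r. Qed.

Lemma kmod_scaleDr : right_distributive kmod_scale +%R.
Proof. by move=> a v w; rewrite /kmod_scale scalerDr. Qed.

Lemma kmod_scaleDl v : {morph kmod_scale^~ v : a b / a + b}.
Proof. by move=> a b; rewrite /kmod_scale !scalerDl. Qed.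

HB.instance Definition _ := GRing.Zmodule_isLmodule.Build k (kmod X)
  kmod_scaleA kmod_scale1 kmod_scaleDr kmod_scaleDl.

Definition kmod_act (u : A) (v : kmod X) : kmod X := u *: (v : X).

Lemma kmod_scaleE c (v : kmod X) : c *: v = c%:A *: (v : X).
Proof. by []. Qed.

Lemma kmod_act_linear u : linear (kmod_act u).
Proof.
move=> c v w; apply: (etrans (scalerDr u (c%:A *: (v : X)) (w : X))).
congr +%R; rewrite kmod_scaleE /kmod_act !scalerA.
by rewrite -scalerAl -scalerAr mul1r mulr1.
Qed.

Lemma kmod_actM (u w : A) (v : kmod X) :
  kmod_act u (kmod_act w v) = kmod_act (u * w) v.
Proof. exact: (scalerA u w (v : X)). Qed.

Lemma kmod_actZ c u v : kmod_act (c *: u) v = c *: kmod_act u v.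
Proof. by rewrite kmod_scaleE /kmod_act scalerA -scalerAl mul1r. Qed.

Lemma kmod_act0 u : kmod_act u 0 = 0.
Proof. exact: (@scaler0 A X u). Qed.

Lemma kmod_act1 v : kmod_act 1 v = v.
Proof. exact: (@scale1r A X v). Qed.

Lemma kmod_actC (u : A) c v : kmod_act u (c *: v) = c *: kmod_act u v.
Proof. by have := kmod_act_linear u c v 0; rewrite kmod_act0 !addr0. Qed.

End Kmod.

Section TensorProduct.
Variables (k : fieldType) (n : nat) (a b : k).
Variables (X : lmodType (partalg n a)) (Y : lmodType (partalg n b)).

(* The tensor product over k of the underlying vector spaces. *)
Definition ktens : lmodType k :=
  tens (fun (c : k) (x : kmod X) => c *: x) (fun (c : k) (y : kmod Y) => c *: y).

Definition ktens_act (d : pdiag n) : ktens -> ktens :=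
  tens_map (kmod_act (dbasis a d)) (kmod_act (dbasis b d)).

Lemma ktens_bal d : balanced (fun (c : k) (x : kmod X) => c *: x)
  (fun (c : k) (y : kmod Y) => c *: y)
  (fun x y => tmk (fun (c : k) (x : kmod X) => c *: x)
     (fun (c : k) (y : kmod Y) => c *: y)
     (kmod_act (dbasis a d) x) (kmod_act (dbasis b d) y)).
Proof.
apply: tens_map_balanced => [||c v|c v]; try exact: kmod_act_linear.
- exact: kmod_actC.
- exact: kmod_actC.
Qed.

Lemma ktens_act_linear d : linear (ktens_act d).
Proof. exact: tens_lift_is_linear (ktens_bal d). Qed.

Lemma ktens_actE d x y : ktens_act d (tmk _ _ x y) =
  tmk _ _ (kmod_act (dbasis a d) x) (kmod_act (dbasis b d) y).
Proof. exact: tens_liftE (ktens_bal d) x y. Qed.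

Lemma id_linear (V : lmodType k) : linear (fun v : V => v).
Proof. by []. Qed.

Lemma comp_linear (U V W : lmodType k) (f : V -> W) (g : U -> V) :
  linear f -> linear g -> linear (f \o g).
Proof. by move=> lf lg c u v /=; rewrite lg lf. Qed.

Lemma scale_linear (U V : lmodType k) (c : k) (f : U -> V) :
  linear f -> linear (fun u => c *: f u).
Proof. by move=> lf e u v /=; rewrite lf scalerDr !scalerA mulrC. Qed.

Lemma ktens_act1 v : ktens_act (idd n) v = v.
Proof.
move: v; apply: tens_ext (ktens_act_linear _) (@id_linear _) _ => x y.
by rewrite ktens_actE !dbasis1 !kmod_act1.
Qed.

Lemma ktens_actM d e v : ktens_act d (ktens_act e v) =
  (a * b) ^+ dloops d e *: ktens_act (dmul d e) v.
Proof.
move: v; apply: tens_ext => [||x y].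
- exact: comp_linear (ktens_act_linear d) (ktens_act_linear e).
- exact: scale_linear (ktens_act_linear _).
rewrite !ktens_actE !kmod_actM !dbasisM !kmod_actZ.
have [Dl Dr Zl Zr B] := tmk_balanced (fun (c : k) (x : kmod X) => c *: x)
  (fun (c : k) (y : kmod Y) => c *: y).
by rewrite Zl Zr scalerA exprMn.
Qed.

Definition tensor_rep : diag_rep n (a * b) :=
  DiagRep ktens_act_linear ktens_act1 ktens_actM.

(* The diagram d acts as d on X tensored with d on Y: this is the restriction of
   the external tensor product along the homomorphism mapping d to d (x) d. *)
Definition tensor_product : lmodType (partalg n (a * b)) := rep_mod tensor_rep.

End TensorProduct.

(* The basis of the bimodule from which the standard modules of rank i are built. *)
Definition cell n (i : 'I_n.+1) : Type := {l : pdiag n | l \in left_cell (std_diag n i)}.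
HB.instance Definition _ n (i : 'I_n.+1) := Finite.on (cell i).

Lemma regularZ (k : fieldType) (c z : k) : c *: (z : k^o) = c * z.
Proof. by []. Qed.

Lemma cell_eqE n (i : 'I_n.+1) (l : cell i) d (Cd : d \in left_cell (std_diag n i)) :
  (l == Sub d Cd) = (d == val l).
Proof. by rewrite eq_sym. Qed.

Section CellModule.
Variables (k : fieldType) (n : nat) (x : k) (i : 'I_n.+1).

Definition cell_space : lmodType k := {ffun cell i -> k^o}.

(* Left multiplication by e modulo the diagrams of rank less than i: the terms
   dmul e l that drop rank are those that are not in the cell (left_cell_mul). *)
Definition cell_act (e : pdiag n) (v : cell_space) : cell_space :=
  [ffun m : cell i => \sum_(l : cell i | dmul e (val l) == val m)
     x ^+ dloops e (val l) * v l].

(* Right concatenation with the permutation diagram of s, which permutes the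
   propagating lines; it creates no loops and preserves the cell
   (dloops_perm, left_cell_perm). *)
Definition cell_ract (s : 'S_i) (v : cell_space) : cell_space :=
  [ffun m : cell i => \sum_(l : cell i |
     dmul (val l) (perm_diag (ext_perm (leq_ord i) s)) == val m) v l].

Lemma cell_act_linear e : linear (cell_act e).
Proof.
move=> c v w; apply/ffunP=> m; rewrite !ffunE regularZ mulr_sumr -big_split.
by apply: eq_bigr => l _; rewrite !ffunE regularZ mulrDr mulrCA.
Qed.

Lemma cell_act1 v : cell_act (idd n) v = v.
Proof.
apply/ffunP=> m; rewrite ffunE (big_pred1 m) => [|l /=].
  by rewrite dloops_idl mul1r.
by rewrite dmul_idl.
Qed.

Lemma cell_actM d e v : cell_act d (cell_act e v) =
  x ^+ dloops d e *: cell_act (dmul d e) v.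
Proof.
apply/ffunP=> m; rewrite !ffunE regularZ mulr_sumr.
rewrite [RHS](eq_bigr (fun l : cell i =>
   x ^+ dloops d (dmul e (val l)) * x ^+ dloops e (val l) * v l)); last first.
  by move=> l _; rewrite mulrA -!exprD dloopsA addnC.
rewrite (eq_bigr (fun l' : cell i => \sum_(l : cell i | dmul e (val l) == val l')
   x ^+ dloops d (dmul e (val l)) * x ^+ dloops e (val l) * v l)); last first.
  move=> l' _; rewrite ffunE mulr_sumr; apply: eq_bigr => l /eqP->.
  by rewrite mulrA.
rewrite (exchange_big_dep predT) //= [RHS]big_mkcond; apply: eq_bigr => l _.
case: ifPn => [/eqP E|nE].
  have Cl : dmul e (val l) \in left_cell (std_diag n i).
    by apply: (@left_cell_mulr _ _ d e) (valP l) _; rewrite dmulA E (valP m).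
  rewrite (big_pred1 (Sub (dmul e (val l)) Cl : cell i)) // => l' /=.
  rewrite cell_eqE andbC; case: eqP => [<-|//].
  by rewrite dmulA E eqxx.
rewrite big_pred0 // => l'; apply/negbTE/negP=> /andP[/eqP E1 /eqP E2].
by case/eqP: nE; rewrite -dmulA E2.
Qed.

Definition cell_rep : diag_rep n x := DiagRep cell_act_linear cell_act1 cell_actM.

Lemma cell_actC e s v : cell_act e (cell_ract s v) = cell_ract s (cell_act e v).
Proof.
set t := perm_diag (ext_perm (leq_ord i) s).
have tcell l : (dmul l t \in left_cell (std_diag n i)) = (l \in left_cell (std_diag n i)).
  exact: left_cell_perm.
apply/ffunP=> m; rewrite !ffunE.
rewrite (eq_bigr (fun l' : cell i => \sum_(l : cell i | dmul (val l) t == val l')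
   x ^+ dloops e (val l) * v l)); last first.
  move=> l' _; rewrite ffunE mulr_sumr; apply: eq_bigr => l /eqP<-.
  have := dloopsA e (val l) t; rewrite !dloops_perm addn0 add0n.
  by move=> ->.
rewrite [RHS](eq_bigr (fun l' : cell i => \sum_(l : cell i | dmul e (val l) == val l')
   x ^+ dloops e (val l) * v l)); last by move=> l' _; rewrite ffunE.
rewrite (exchange_big_dep predT) //= [RHS](exchange_big_dep predT) //=.
apply: eq_bigr => l _.
have Cl : dmul (val l) t \in left_cell (std_diag n i) by rewrite tcell (valP l).
rewrite (eq_bigl (fun l' => (dmul e (dmul (val l) t) == val m) &&
   (l' == Sub (dmul (val l) t) Cl :> cell i))); last first.
  by move=> l'; rewrite cell_eqE andbC [RHS]andbC; case: eqP => [<-|].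
rewrite [RHS](eq_bigl (fun l' : cell i => (dmul e (dmul (val l) t) == val m) &&
   (dmul e (val l) == val l'))); last first.
  by move=> l'; rewrite andbC [RHS]andbC; case: eqP => [<-|//]; rewrite dmulA.
rewrite [LHS]big_mkcondl [RHS]big_mkcondl; case: ifP => [/eqP E|_].
  rewrite big_pred1_eq.
  have Ce : dmul e (val l) \in left_cell (std_diag n i).
    by rewrite -tcell -dmulA E (valP m).
  rewrite (big_pred1 (Sub (dmul e (val l)) Ce : cell i)) //.
by rewrite !big1.
Qed.

End CellModule.

Section Specht.
Variables (k : fieldType) (i : nat) (la : seq nat).

(* A tableau of shape la is given by the position (row, column), counted from 0,
   of each entry. When la is a partition of i, injectivity makes it a bijection
   onto the cells of the Young diagram. *)
Definition is_tableau (t : {ffun 'I_i -> 'I_i * 'I_i}) : bool :=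
  injectiveb t && [forall a, (t a).2 < nth 0%N la (t a).1]%N.

Definition row_map (t : {ffun 'I_i -> 'I_i * 'I_i}) : {ffun 'I_i -> 'I_i} :=
  [ffun a => (t a).1].

(* The permutation module on all row-assignment functions; the tabloids of shape
   la span a summand of it, which contains all the polytabloids of shape la. *)
Definition tabloid_space : vectType k := {ffun {ffun 'I_i -> 'I_i} -> k^o}.

Definition tabloid (f : {ffun 'I_i -> 'I_i}) : tabloid_space :=
  [ffun g => (g == f)%:R].

(* Products of permutations are composed from left to right, so that
   precomposition is a left action (precompM). *)
Definition precomp (s : 'S_i) (f : {ffun 'I_i -> 'I_i}) : {ffun 'I_i -> 'I_i} :=
  [ffun a => f (s a)].

Definition tabloid_act (s : 'S_i) (v : tabloid_space) : tabloid_space :=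
  [ffun g => v (precomp (s^-1)%g g)].

(* The sum is over the column stabilizer of t. *)
Definition polytabloid (t : {ffun 'I_i -> 'I_i * 'I_i}) : tabloid_space :=
  \sum_(s : 'S_i | [forall a, (t (s a)).2 == (t a).2])
     (-1) ^+ s *: tabloid (precomp s (row_map t)).

Definition specht_space : {vspace tabloid_space} :=
  <<[seq polytabloid t | t <- enum is_tableau]>>%VS.

Definition specht : vectType k := subvs_of specht_space.

(* The projection is only a cast: specht_space is stable (specht_actE). *)
Definition specht_act (s : 'S_i) (u : specht) : specht :=
  vsproj specht_space (tabloid_act s (vsval u)).

Lemma tabloid_act_linear s : linear (tabloid_act s).
Proof. by move=> c v w; apply/ffunP=> g; rewrite !ffunE. Qed.

Lemma precompM s t f : precomp (s * t) f = precomp s (precomp t f).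
Proof. by apply/ffunP=> a; rewrite !ffunE permM. Qed.

Lemma precompK s : cancel (precomp s) (precomp (s^-1)%g).
Proof. by move=> f; rewrite -precompM mulVg; apply/ffunP=> a; rewrite ffunE perm1. Qed.

Lemma precompKV s : cancel (precomp (s^-1)%g) (precomp s).
Proof. by move=> f; rewrite -precompM mulgV; apply/ffunP=> a; rewrite ffunE perm1. Qed.

Lemma tabloid_actE s f : tabloid_act s (tabloid f) = tabloid (precomp s f).
Proof.
apply/ffunP=> g; rewrite !ffunE; congr (_%:R); congr nat_of_bool.
by apply/eqP/eqP => [<-|->]; rewrite ?precompKV ?precompK.
Qed.

Lemma tabloid_actM s t v : tabloid_act s (tabloid_act t v) = tabloid_act (s * t) v.
Proof. by apply/ffunP=> g; rewrite !ffunE -precompM invMg. Qed.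

Definition move_tableau (s : 'S_i) (t : {ffun 'I_i -> 'I_i * 'I_i}) :
  {ffun 'I_i -> 'I_i * 'I_i} := [ffun a => t (s a)].

Lemma tabloid_act_poly s t :
  tabloid_act s (polytabloid t) = polytabloid (move_tableau s t).
Proof.
have aD v w : tabloid_act s (v + w) = tabloid_act s v + tabloid_act s w.
  by have := tabloid_act_linear s 1 v w; rewrite !scale1r.
have a0 : tabloid_act s 0 = 0 by apply: (addrI (tabloid_act s 0)); rewrite -aD !addr0.
have aZ c v : tabloid_act s (c *: v) = c *: tabloid_act s v.
  by have := tabloid_act_linear s c v 0; rewrite a0 !addr0.
rewrite /polytabloid (big_morph _ aD a0).
rewrite [RHS](reindex_inj (@conjg_inj _ (s^-1)%g)) /=; apply: eq_big => [r|r _].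
  have conjE a : s ((r ^ s^-1)%g a) = r (s a).
    by rewrite conjgE invgK !permM permKV.
  apply/forallP/forallP=> H a; first by rewrite !ffunE conjE.
  by have := H ((s^-1)%g a); rewrite !ffunE conjE !permKV.
rewrite aZ tabloid_actE odd_permJ; congr (_ *: tabloid _).
by apply/ffunP=> a; rewrite !ffunE conjgE invgK !permM permKV.
Qed.

Lemma specht_stable s v :
  v \in specht_space -> tabloid_act s v \in specht_space.
Proof.
move=> Sv; rewrite (coord_span Sv).
have lin := tabloid_act_linear s.
have aD v1 w : tabloid_act s (v1 + w) = tabloid_act s v1 + tabloid_act s w.
  by have := lin 1 v1 w; rewrite !scale1r.
have a0 : tabloid_act s 0 = 0 by apply: (addrI (tabloid_act s 0)); rewrite -aD !addr0.
have aZ c w : tabloid_act s (c *: w) = c *: tabloid_act s w.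
  by have := lin c w 0; rewrite a0 !addr0.
rewrite (big_morph _ aD a0); apply: memv_suml => j _; rewrite aZ memvZ //.
set w := _`_j; have /mapP[t] : w \in [seq polytabloid t | t <- enum is_tableau].
  by apply: mem_nth; rewrite (leq_trans (ltn_ord j)) ?size_tuple.
rewrite mem_enum => tt ->; rewrite tabloid_act_poly; apply: memv_span.
apply: map_f; rewrite mem_enum; case/andP: tt => /injectiveP ti /forallP tl.
apply/andP; split; last by apply/forallP=> a; rewrite ffunE.
by apply/injectiveP=> a b; rewrite !ffunE => /ti/perm_inj.
Qed.

Lemma specht_actE s u : vsval (specht_act s u) = tabloid_act s (vsval u).
Proof. by rewrite vsprojK // specht_stable // subvsP. Qed.

Lemma specht_actM s t u : specht_act s (specht_act t u) = specht_act (s * t) u.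
Proof. by apply: val_inj; rewrite /= !specht_actE tabloid_actM. Qed.

End Specht.

Section Standard.
Variables (k : fieldType) (n : nat) (x : k) (i : 'I_n.+1) (la : seq nat).

Definition standard_space : lmodType k :=
  tens (@cell_ract k n i) (@specht_act k i la).

Definition standard_act (e : pdiag n) : standard_space -> standard_space :=
  tens_map (cell_act x e) id.

Lemma standard_bal e : balanced (@cell_ract k n i) (@specht_act k i la)
  (fun v u => tmk (@cell_ract k n i) (@specht_act k i la) (cell_act x e v) u).
Proof.
apply: (@tens_map_balanced _ _ _ _ (@cell_ract k n i) (@specht_act k i la)
          (cell_act x e) id) => // [|s v]; [exact: cell_act_linear|exact: cell_actC].
Qed.

Lemma standard_act_linear e : linear (standard_act e).
Proof. exact: tens_lift_is_linear (standard_bal e). Qed.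

Lemma standard_actE e v u : standard_act e (tmk _ _ v u) = tmk _ _ (cell_act x e v) u.
Proof. exact: tens_liftE (standard_bal e) v u. Qed.

Lemma standard_act1 v : standard_act (idd n) v = v.
Proof.
move: v; apply: tens_ext (standard_act_linear _) (@id_linear _ _) _ => v u.
by rewrite standard_actE cell_act1.
Qed.

Lemma standard_actM d e v : standard_act d (standard_act e v) =
  x ^+ dloops d e *: standard_act (dmul d e) v.
Proof.
move: v; apply: tens_ext => [||v u].
- exact: comp_linear (standard_act_linear d) (standard_act_linear e).
- exact: scale_linear (standard_act_linear _).
rewrite !standard_actE cell_actM.
by rewrite (balZl (tmk_balanced (@cell_ract k n i) (@specht_act k i la))).
Qed.

Definition standard_rep : diag_rep n x :=
  DiagRep standard_act_linear standard_act1 standard_actM.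

Definition standard : lmodType (partalg n x) := rep_mod standard_rep.

End Standard.

Definition is_partition_of (la : seq nat) (i : nat) : bool :=
  [&& sorted geq la, 0%N \notin la & sumn la == i].

Definition has_standard_filtration (k : fieldType) (n : nat) (x : k)
    (X : lmodType (partalg n x)) : Prop :=
  exists (m : nat) (F : nat -> submodClosed X),
    [/\ F 0%N =i pred1 0, F m =i predT &
      forall j, (j < m)%N ->
        {subset F j <= F j.+1} /\
        exists (i : 'I_n.+1) (la : seq nat), is_partition_of la i /\
          exists f : {linear subquotient (F j.+1) (F j) -> standard x i la},
            bijective f].

(* Main.v *)
(* Tensoring over a field is exact, so it suffices to filter the tensor product of
   two standard modules. In characteristic zero coinvariants are invariants, and the
   standard module of la |- i is the space of S_i-equivariant functions from the cell
   L_i of rank i to the Specht module; the tensor product thus consists of equivariant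
   functions on pairs (l, m) in L_i x L_j. An element of L_i is a set partition of the
   upper points with i labelled blocks. Let the size of (l, m) be the number of blocks
   of the common refinement of the two partitions, not counting the blocks that belong
   to both and are unlabelled in both. A pair of size s can be written (e l0, e m0)
   with e in L_s and (l0, m0) minimal, uniquely up to S_s, and multiplication by a
   diagram never increases the size. Hence the functions supported on pairs of size
   less than s form a submodule, and the successive quotients are induced, in the same
   way as the standard modules, from representations of S_s on functions on the minimal
   pairs. Such a representation is a sum of Specht modules: these are irreducible and
   pairwise non isomorphic, and there are as many of them as conjugacy classes. *)
From HB Require Import structures.
From mathcomp Require Import all_boot all_order all_algebra all_fingroup.
From mathcomp Require Import all_solvable all_character boolp.
Require Import Defs.

Set Implicit Arguments.
Unset Strict Implicit.
Unset Printing Implicit Defensive.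

Import GRing.Theory VectorInternalTheory.

(** * Cycle types and conjugacy of permutations *)

(** The delicate point is the parameter. A diagram [d] moves the value at a pair (l, m) with the
    coefficient [a ^+ dloops d l * b ^+ dloops d m], whereas a layer of the filtration has to be a
    module for [a * b], so the two exponents must agree there. This is why an unlabelled block
    common to l and m is not counted: it becomes an unlabelled block of the upward diagram e, and
    closing it creates the same loop on both sides. Every other block of the refinement is
    propagating in e. When [d] closes or merges some of these, the rank of [dmul d e] drops, the
    size of the pair drops with it, and the term vanishes in the layer. What remains has both
    exponents equal to [dloops d e]. Characteristic zero enters through averages over symmetric
    groups, through Maschke complements, and because the order of a column stabilizer is the
    eigenvalue of a signed column sum on a polytabloid. Algebraic closure enters in the count of
    irreducible representations by conjugacy classes. *)

Lemma perm_map_match (I J : eqType) (S : eqType) (f : I -> S) (g : J -> S)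
    (s1 : seq I) (s2 : seq J) :
  uniq s1 -> uniq s2 -> perm_eq (map f s1) (map g s2) ->
  exists h : I -> option J, {in s1 &, injective h} /\
    {in s1, forall x, exists2 y, h x = Some y & y \in s2 /\ g y = f x}.
Proof.
elim: s1 s2 => [|x s1 IH] s2 /=; first by exists (fun=> None).
case/andP=> xs1 us1 us2 E.
have /mapP[y ys2 fgx] : f x \in map g s2 by rewrite -(perm_mem E) mem_head.
have Ey : perm_eq s2 (y :: rem y s2) by exact: perm_to_rem.
have {}E : perm_eq (map f s1) (map g (rem y s2)).
  rewrite -(perm_cons (f x)); apply: perm_trans E _.
  by rewrite fgx -[g y :: _]/(map g (y :: rem y s2)) perm_map.
have [h [hi hP]] := IH _ us1 (rem_uniq y us2) E.
exists (fun z => if z == x then Some y else h z); split.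
  have hy z : z \in s1 -> h z = Some y -> False.
    by move=> /hP[y' -> [+ _]] [E']; rewrite E' mem_rem_uniq // inE eqxx.
  move=> z w; rewrite !inE; case: eqP => [->|_] /= zs; case: eqP => [->|_] //= ws.
  - by move/esym/hy; case/(_ ws).
  - by move/hy; case/(_ zs).
  exact: hi.
move=> z; rewrite inE; case: eqP => [->|_] /= zs; first by exists y.
by have [y' ? [/mem_rem ? ?]] := hP z zs; exists y'.
Qed.

Section CycleType.
Variable T : finType.
Implicit Types s t : {perm T}.

Definition cycle_type s : seq nat :=
  sort geq [seq #|B| | B : {set T} in porbits s].

Lemma cycle_type_sorted s : sorted geq (cycle_type s).
Proof. by apply: sort_sorted => a b; exact: leq_total. Qed.

Lemma cycle_type_neq0 s : 0 \notin cycle_type s.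
Proof.
rewrite mem_sort; apply/mapP=> -[B]; rewrite mem_enum => /imsetP[x _ ->] /esym/eqP.
by rewrite (negPf (card_porbit_neq0 s x)).
Qed.

Lemma sumn_cycle_type s : sumn (cycle_type s) = #|T|.
Proof.
rewrite sumnE (perm_big _ (permEl (perm_sort _ _))) big_map big_enum /=.
rewrite -cardsT; apply/esym/card_partition/and3P; split.
- apply/eqP/setP=> x; rewrite inE; apply/bigcupP.
  by exists (porbit s x); rewrite ?imset_f ?porbit_id.
- apply/trivIsetP=> _ _ /imsetP[x _ ->] /imsetP[y _ ->] nxy.
  rewrite -setI_eq0; apply: contraR nxy => /set0Pn[z]; rewrite inE.
  by case/andP; rewrite -!eq_porbit_mem => /eqP-> /eqP->.
apply/imsetP=> -[x _ E]; have := porbit_id s x; by rewrite -E inE.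
Qed.

Lemma iter_modn_porbit s x a : iter (a %% #|porbit s x|) s x = iter a s x.
Proof.
rewrite [in RHS](divn_eq a #|porbit s x|) addnC iterD; congr (iter _ _ _).
elim: (_ %/ _) => [|m IH] //=; by rewrite mulSn addnC iterD iter_porbit.
Qed.

Lemma eq_iter_porbit s x a b :
  (iter a s x == iter b s x) = (a == b %[mod #|porbit s x|]).
Proof.
set N := #|_|; have N0 : 0 < N by rewrite lt0n card_porbit_neq0.
rewrite -(iter_modn_porbit s x a) -(iter_modn_porbit s x b) -/N.
rewrite -!(nth_traject s (_ : _ %% N < N)) ?ltn_pmod //.
by rewrite nth_uniq ?size_traject ?ltn_pmod ?uniq_traject_porbit.
Qed.

(** Orbits of equal length are matched by [perm_map_match]. With a base point in each orbit, [p]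
    carries the k-th iterate of a base point under [s] to the k-th iterate of the matched base point
    under [t]. *)
Lemma cycle_type_conj s t : cycle_type s = cycle_type t -> exists p, (s ^ p)%g = t.
Proof.
move=> E; have {}E : perm_eq [seq #|B| | B : {set T} in porbits s]
                          [seq #|B| | B : {set T} in porbits t].
  by rewrite -(perm_sort geq) perm_sym -(perm_sort geq) perm_sym -/(cycle_type s) E.
have [h [hi hP]] := perm_map_match (enum_uniq _) (enum_uniq _) E.
(* The base point of an orbit. The default is never reached since orbits are not empty, so the
   choice depends on the orbit alone ([rE]). *)
pose r (B : {set T}) x := odflt x [pick y in B].
have rE x y : y \in porbit s x -> r (porbit s x) x = r (porbit s y) y.
  move=> yx; have -> : porbit s y = porbit s x by apply/eqP; rewrite eq_porbit_mem.
  by rewrite /r; case: pickP => [//|/(_ y)]; rewrite yx.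
have r_in x : r (porbit s x) x \in porbit s x.
  by rewrite /r; case: pickP => [//|/(_ x)]; rewrite porbit_id.
pose r' x := odflt x [pick y in odflt set0 (h (porbit s x))].
have r'P x : h (porbit s x) = Some (porbit t (r' x)) /\
             #|porbit t (r' x)| = #|porbit s (r (porbit s x) x)|.
  have [|C hC []] := hP (porbit s x); first by rewrite mem_enum imset_f.
  have -> : porbit s (r (porbit s x) x) = porbit s x.
    by apply/eqP; rewrite eq_porbit_mem.
  rewrite mem_enum => /imsetP[z _ Cz] CC.
  suff -> : porbit t (r' x) = C by [].
  rewrite /r' hC /=; case: pickP => [y|/(_ z)]; rewrite Cz ?porbit_id //=.
  by rewrite -eq_porbit_mem => /eqP.
have r'E x y : y \in porbit s x -> r' x = r' y.
  move=> yx; have Eo : porbit s y = porbit s x by apply/eqP; rewrite eq_porbit_mem.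
  have [hx _] := r'P x.
  rewrite /r' Eo; case: pickP => // /(_ (r' x)).
  by rewrite hx /= porbit_id.
have kP x : exists k, x == iter k s (r (porbit s x) x).
  have := r_in x; rewrite porbit_sym => /porbitP[k Ek].
  by exists k; apply/eqP; rewrite -permX.
pose p x := iter (xchoose (kP x)) t (r' x).
(* Any exponent that reaches [x] gives the same value: the two matched orbits have the same length,
   and exponents matter only modulo it. *)
have pE x k : x = iter k s (r (porbit s x) x) -> p x = iter k t (r' x).
  move=> Ek; apply/eqP; rewrite eq_iter_porbit (r'P x).2 -eq_iter_porbit -Ek.
  by rewrite eq_sym (xchooseP (kP x)).
have ps x : p (s x) = t (p x).
  have sx : s x \in porbit s x by rewrite -[s x]/(iter 1 s x) -permX mem_porbit.
  rewrite (pE (s x) (xchoose (kP x)).+1); first by rewrite -(r'E _ _ sx).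
  by rewrite -(rE _ _ sx) /= -(eqP (xchooseP (kP x))).
have pi : injective p.
  move=> x y Exy.
  have por z : porbit t (p z) = porbit t (r' z).
    by apply/eqP; rewrite eq_porbit_mem /p -permX mem_porbit.
  have Eo : porbit s x = porbit s y.
    apply: hi; rewrite ?mem_enum ?imset_f //.
    by rewrite (r'P x).1 (r'P y).1 -!por Exy.
  have xy : x \in porbit s y by rewrite -Eo porbit_id.
  move: Exy (eqP (xchooseP (kP x))) (eqP (xchooseP (kP y))); rewrite /p.
  move: (xchoose (kP x)) (xchoose (kP y)) => c d; rewrite -(rE _ _ xy) (r'E _ _ xy).
  move=> /eqP Exy Ex Ey; apply: (etrans Ex); apply: (etrans _ (esym Ey)).
  apply/eqP; move: Exy; rewrite (rE _ _ xy).
  by rewrite !eq_iter_porbit (r'P x).2.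
exists (perm pi); apply/permP=> x.
have -> : x = perm pi ((perm pi)^-1%g x) by rewrite permKV.
by rewrite permJ !(permE pi) ps.
Qed.

End CycleType.

(** * Pairs of diagrams *)

Section Pairs.
Variable n : nat.
Implicit Types (d e l m : pdiag n) (u v p q : 'I_n).

Definition labelled l u := [exists p, same l (inl u) (inr p)].

Definition mclass l m u : {set 'I_n} :=
  [set v | same l (inl u) (inl v) && same m (inl u) (inl v)].

(* The block of u carries no label and is the same in l and in m: such a block can
   be split off from both diagrams at once by an upward diagram. *)
Definition dead l m u := [&& ~~ labelled l u, ~~ labelled m u &
  [forall v, same l (inl u) (inl v) == same m (inl u) (inl v)]].

Definition psize l m := #|[set mclass l m u | u in [set u | ~~ dead l m u]]|.

Lemma same_l d x y z : same d x y -> same d x z = same d y z.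
Proof. by rewrite !same_pblockE => /eqP->. Qed.

Lemma same_r d x y z : same d x y -> same d z x = same d z y.
Proof. by rewrite !same_pblockE => /eqP->. Qed.

Lemma labelled_same d u v : same d (inl u) (inl v) -> labelled d u = labelled d v.
Proof. by move=> uv; apply: eq_existsb => p; rewrite (same_l _ uv). Qed.

Lemma mclass_id l m u : u \in mclass l m u.
Proof. by rewrite inE !same_refl. Qed.

Lemma mclass_eqE l m u v : (mclass l m u == mclass l m v) = (v \in mclass l m u).
Proof.
apply/eqP/idP => [->|]; first exact: mclass_id.
rewrite inE => /andP[luv muv]; apply/setP=> w.
by rewrite !inE (same_l _ luv) (same_l _ muv).
Qed.

Lemma dead_mclass l m u v : v \in mclass l m u -> dead l m u = dead l m v.
Proof.
rewrite inE => /andP[luv muv]; rewrite /dead (labelled_same luv) (labelled_same muv).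
by congr [&& _, _ & _]; apply: eq_forallb => w; rewrite (same_l _ luv) (same_l _ muv).
Qed.

(** The two diagrams share only the lower points of [d], so a walk that starts in a block without
    lower points never leaves it. *)
Lemma unlabelled_connect d l u y : ~~ labelled d u ->
  connect (glue d l) (inl (inl u)) y -> exists2 v, y = inl (inl v) & same d (inl u) (inl v).
Proof.
move=> nu c; apply: (connect_ind (P := fun y => exists2 v, y = inl (inl v) & same d (inl u) (inl v)) _ c).
  move=> x z xy [v Ev uv]; rewrite {}Ev in xy.
  case/glueP: xy => -[a [b []]]; last by case: a.
  move=> [<-] -> vb; case: b vb => w vw; first by exists w; rewrite // (same_l _ uv).
  by case/negP: nu; apply/existsP; exists w; rewrite (same_l _ uv).
by exists u; rewrite ?same_refl.
Qed.

Lemma unlabelled_mul d l u v : ~~ labelled d u ->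
  same (dmul d l) (inl u) (inl v) = same d (inl u) (inl v).
Proof.
move=> nu; apply/idP/idP; rewrite dmulE.
  by case/(unlabelled_connect nu) => w [<-].
by move=> uv; apply: connect1; apply: edge_top.
Qed.

Lemma unlabelled_mul_labelled d l u : ~~ labelled d u -> ~~ labelled (dmul d l) u.
Proof.
move=> nu; apply/existsP=> -[p]; rewrite dmulE.
by case/(unlabelled_connect nu).
Qed.

(** An unlabelled block of [d] passes unchanged into both products, hence is common to them and
    unlabelled in both. *)
Lemma unlabelled_dead d l m u : ~~ labelled d u -> dead (dmul d l) (dmul d m) u.
Proof.
move=> nu; apply/and3P; split; try exact: unlabelled_mul_labelled.
by apply/forallP=> v; rewrite !unlabelled_mul.
Qed.

Lemma same_mul d l x y : same d (inl x) (inl y) -> same (dmul d l) (inl x) (inl y).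
Proof. by move=> xy; rewrite dmulE; apply: connect1; apply: edge_top. Qed.

(** By [unlabelled_dead] a live class contains an upper point of a propagating block of [d], and the
    points of one block of [d] lie in one class of the products. The live classes are thus among the
    images of the propagating blocks. *)
Lemma psize_mul d l m : psize (dmul d l) (dmul d m) <= rank d.
Proof.
pose F (B : {set pts n}) : {set 'I_n} :=
  if [pick v | inl v \in B] is Some v then mclass (dmul d l) (dmul d m) v else set0.
apply: (leq_trans _ (leq_imset_card F (propagating d))); apply: subset_leq_card.
apply/subsetP=> _ /imsetP[u + ->]; rewrite inE => nd.
have /existsP[p up] : labelled d u by apply: contraR nd; exact: unlabelled_dead.
apply/imsetP; exists (pblock d (inl u)); first by apply/propagatingP; exists u, p.
rewrite /F; case: pickP => [v uv|/(_ u)]; last by have := same_refl d (inl u); rewrite /same /= => ->.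
by apply/eqP; rewrite mclass_eqE inE !same_mul.
Qed.

(* The elements of the left cell of std_diag n s: set partitions of the upper points
   with s blocks labelled by the lower points below s (in_cellP). *)
Record in_cell s l : Prop := InCell {
  cell_low : forall p q, same l (inr p) (inr q) -> p = q;
  cell_out : forall p u, s <= p -> same l (inl u) (inr p) = false;
  cell_in : forall p, p < s -> exists u, same l (inl u) (inr p) }.

Lemma in_cell_std s l : in_cell s l -> dmul l (std_diag n s) = l.
Proof.
move=> hl; apply: diag_eq => x y; rewrite dmulE; apply/idP/idP => [c|xy].
  (* The pattern for products of diagrams from here on: an invariant that is constant along the
     edges of [glue] bounds connectivity from above, and explicit paths give the converse. *)
  pose phi (w : pts3 n) : pts n := match w with inl w => w | inr p => inr p end.
  have -> : x = phi (outer13 x) by case: x c.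
  have -> : y = phi (outer13 y) by case: y c.
  rewrite same_pblockE; apply/eqP.
  apply: (connect_preserve (f := fun w => pblock l (phi w)) _ c).
  move=> a b /glueP[[p [q [-> -> /=]]]|[p [q [-> -> ]]]].
    by rewrite same_pblockE => /eqP.
  rewrite ker_diagE; case: p q => [p|p] [q|q] /=; try by move/eqP=> [->].
    by case: ifP => // _ /eqP[->].
    by case: ifP => // _ /eqP[->].
  by do 2!case: ifP => // _; move=> /eqP[->].
have low p : same l x (inr p) -> (x = inr p) \/ (p < s /\ exists u, x = inl u).
  case: x xy => u _ up; last by left; rewrite (cell_low hl up).
  right; split; last by exists u.
  by rewrite ltnNge; apply/negP=> le; rewrite (cell_out hl u le) in up.
have C p u : p < s -> same l (inl u) (inr p) -> connect (glue l (std_diag n s)) (inl (inl u)) (inr p).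
  move=> lt up; apply: (@connect_trans _ _ (inl (inr p))); apply: connect1.
    exact: edge_top.
  by apply: (@edge_bot _ _ _ (inl p) (inr p)); rewrite ker_diagE /= lt.
have ps u p : same l (inl u) (inr p) -> p < s.
  by move=> up; rewrite ltnNge; apply/negP=> le; rewrite (cell_out hl u le) in up.
case: x y xy {low} => [u|p] [v|q] xy.
- by apply: connect1; apply: edge_top.
- exact: C (ps _ _ xy) xy.
- by rewrite (sym_connect_sym (glue_sym _ _)); rewrite same_sym in xy; exact: C (ps _ _ xy) xy.
by rewrite (cell_low hl xy) connect0.
Qed.

Lemma in_cell_propagating s l : in_cell s l -> s <= n -> rank l = s.
Proof.
move=> hl le; rewrite /rank; pose F (p : 'I_s) := pblock l (inr (widen_ord le p)).
have -> : propagating l = F @: [set: 'I_s].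
  apply/setP=> B; apply/propagatingP/imsetP=> [[u [p [-> up]]]|[p _ ->]].
    have lt : p < s by rewrite ltnNge; apply/negP=> ge; rewrite (cell_out hl u ge) in up.
    exists (Ordinal lt) => //; apply/eqP.
    rewrite /F -same_pblockE (_ : widen_ord _ _ = p) //; exact: val_inj.
  have [u up] := cell_in hl (p := widen_ord le p) (ltn_ord p).
  exists u, (widen_ord le p); split=> //; apply/eqP.
  by rewrite /F -same_pblockE same_sym.
rewrite card_imset ?cardsT ?card_ord // => p q /eqP.
by rewrite /F -same_pblockE => /(cell_low hl)/(congr1 val)/= /val_inj.
Qed.

(** Right multiplication by [std_diag n s] isolates the lower points from s on, so each propagating
    block is the block of one of the s remaining lower points. Rank s forces these s blocks to be
    distinct and all of them to be propagating. *)
Lemma in_cellP s l : s <= n -> reflect (in_cell s l) (l \in left_cell (std_diag n s)).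
Proof.
move=> le; apply: (iffP idP) => [|hl]; last first.
  rewrite inE rank_std // (in_cell_propagating hl) // eqxx /=.
  by apply/existsP; exists l; rewrite in_cell_std.
rewrite inE rank_std // => /andP[/eqP rl /existsP[e /eqP El]].
have iso p x : s <= p -> same l (inr p) x -> x = inr p.
  move=> ge; rewrite El dmulE => c.
  have : outer13 x = inr p.
    apply: (connect_ind (P := fun w => w = inr p) _ c) => // a b ab Ea.
    rewrite {a}Ea in ab; case/glueP: ab => -[a [b' []]] //.
    case: a => a // [<-] ->; rewrite ker_diagE /= ltnNge ge /=.
    by case: b' => b' /=; [|case: ifP => // _]; move/eqP => // [->].
  by case: x c => x _ //= [->].
pose F (p : 'I_s) := pblock l (inr (widen_ord le p)).
have sub : propagating l \subset F @: [set: 'I_s].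
  apply/subsetP=> B /propagatingP[u [p [-> up]]].
  have lt : p < s.
    rewrite ltnNge; apply/negP=> ge; rewrite same_sym in up.
    by have := iso _ _ ge up.
  apply/imsetP; exists (Ordinal lt) => //; apply/eqP.
  rewrite /F -same_pblockE (_ : widen_ord _ _ = p) //; exact: val_inj.
have cF : #|F @: [set: 'I_s]| = #|[set: 'I_s]|.
  apply/eqP; rewrite eqn_leq leq_imset_card cardsT card_ord -{1}rl.
  exact: subset_leq_card.
have Fi : injective F.
  by move=> p q; apply: (imset_injP (introT eqP cF)); rewrite inE.
have EF : propagating l = F @: [set: 'I_s].
  by apply/eqP; rewrite eqEcard sub cF cardsT card_ord -/(rank l) rl leqnn.
split=> [p q pq|p u ge|p lt].
- case: (ltnP p s) => [lt|ge]; last by have [] := iso _ _ ge pq.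
  case: (ltnP q s) => [lt'|ge]; last by rewrite same_sym in pq; have [] := iso _ _ ge pq.
  have /Fi/(congr1 val)/= : F (Ordinal lt) = F (Ordinal lt').
    rewrite /F; apply/eqP; rewrite -same_pblockE.
    by move: pq; congr same; congr inr; apply: val_inj.
  exact: val_inj.
- by apply/negP; rewrite same_sym => /(iso _ _ ge).
have /propagatingP[u [q [Eu uq]]] : F (Ordinal lt) \in propagating l by rewrite EF imset_f.
exists u; rewrite same_sym same_pblockE -Eu /F.
by apply/eqP; congr pblock; congr inr; apply: val_inj.
Qed.

End Pairs.

Section Pairs2.
Variables (n s : nat).
Hypothesis le_s : s <= n.
Implicit Types (d e l m : pdiag n) (u v p q : 'I_n) (t : 'S_s).
Local Notation std := (std_diag n s).
Local Notation Pm t := (perm_diag (ext_perm le_s t)).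

Lemma label_lt e u p : in_cell s e -> same e (inl u) (inr p) -> p < s.
Proof. by move=> he up; rewrite ltnNge; apply/negP=> le; rewrite (cell_out he u le) in up. Qed.

Lemma label_uniq e u p q : in_cell s e ->
  same e (inl u) (inr p) -> same e (inl u) (inr q) -> p = q.
Proof. by move=> he up uq; apply: (cell_low he); rewrite -(same_l _ up). Qed.

Lemma in_cell_std_diag : in_cell s std.
Proof.
split=> [p q|p u le|p lt]; rewrite ?ker_diagE /=.
- by do 2![case: ifP => _]; move=> /eqP[].
- by rewrite ltnNge le.
by exists p; rewrite ker_diagE /= lt.
Qed.

Lemma std_std : dmul std std = std.
Proof. exact/in_cell_std/in_cell_std_diag. Qed.

(** * Products with an upward diagram *)

Section Up.
Variables (e l : pdiag n).
Hypothesis he : in_cell s e.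

(** The product [dmul e l] is [l] pulled back along the labels of [e]: a labelled upper point takes
    the block of [l] at its label, an unlabelled one keeps its block of [e]. The sum type keeps the
    two kinds apart. *)
Let phi (w : pts3 n) : {set pts n} + {set pts n} :=
  match w with
  | inl (inl u) => if [pick p | same e (inl u) (inr p)] is Some p
                   then inr (pblock l (inl p)) else inl (pblock e (inl u))
  | inl (inr p) => inr (pblock l (inl p))
  | inr r => inr (pblock l (inr r))
  end.

Let phi_label u p : same e (inl u) (inr p) -> phi (inl (inl u)) = phi (inl (inr p)).
Proof.
move=> up /=; case: pickP => [q uq|/(_ p)]; last by rewrite up.
by rewrite (label_uniq he up uq).
Qed.

Lemma up_connect w w' : connect (glue e l) w w' -> phi w = phi w'.
Proof.
apply: connect_preserve => {w w'} x y /glueP[[a [b [-> -> ab]]]|[a [b [-> -> ab]]]].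
  case: a b ab => [u|p] [v|q] ab; last 1 first.
  - by rewrite (cell_low he ab).
  - case: (boolP (labelled e u)) => [/existsP[p up]|nu].
      by rewrite (phi_label up) -(@phi_label v p) // -(same_l _ ab).
    have nv : ~~ labelled e v by rewrite -(labelled_same ab).
    rewrite /=; case: pickP => [p up|_]; first by case/existsP: nu; exists p.
    case: pickP => [p up|_]; first by case/existsP: nv; exists p.
    by congr inl; apply/eqP; rewrite -same_pblockE.
  - exact: phi_label.
  by rewrite (@phi_label v p) // same_sym.
by move: ab; rewrite same_pblockE => /eqP; case: a b => a [] b /= ->.
Qed.

Lemma up_upper u v p q : same e (inl u) (inr p) -> same e (inl v) (inr q) ->
  same (dmul e l) (inl u) (inl v) = same l (inl p) (inl q).
Proof.
move=> up vq; rewrite dmulE; apply/idP/idP => [/up_connect|pq].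
  by rewrite /= -/(phi (inl (inl u))) -/(phi (inl (inl v))) (phi_label up) (phi_label vq)
     => -[/eqP]; rewrite -same_pblockE.
apply: (@connect_trans _ _ (inl (inr p))); first exact: connect1 (edge_top _ up).
apply: (@connect_trans _ _ (inl (inr q))).
  exact: connect1 (@edge_bot _ _ _ (inl p) (inl q) pq).
by apply: connect1; rewrite glue_sym; apply: edge_top.
Qed.

Lemma up_lower u p r : same e (inl u) (inr p) ->
  same (dmul e l) (inl u) (inr r) = same l (inl p) (inr r).
Proof.
move=> up; rewrite dmulE; apply/idP/idP => [/up_connect|pq].
  by rewrite /= -/(phi (inl (inl u))) (phi_label up) => -[/eqP]; rewrite -same_pblockE.
apply: (@connect_trans _ _ (inl (inr p))); first exact: connect1 (edge_top _ up).
exact: connect1 (@edge_bot _ _ _ (inl p) (inr r) pq).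
Qed.

Lemma up_labelled u p : same e (inl u) (inr p) -> labelled (dmul e l) u = labelled l p.
Proof. by move=> up; apply: eq_existsb => r; rewrite (up_lower _ up). Qed.

End Up.

Definition swap_pt (p : pts n) : pts n := match p with inl i => inr i | inr i => inl i end.

Definition dswap e : pdiag n := ker_diag (fun x => pblock e (swap_pt x)).

Lemma dswapE e x y : same (dswap e) x y = same e (swap_pt x) (swap_pt y).
Proof. by rewrite ker_diagE same_pblockE. Qed.

(** Labels of [e] are distinct, so a label that goes up into its block through the flipped copy can
    only come back as itself. The flip is therefore a left inverse of [e] up to the standard
    diagram, which lets [e] be cancelled on the left. *)
Lemma dswap_mul e : in_cell s e -> dmul (dswap e) e = std.
Proof.
move=> he; apply: diag_eq => x y; rewrite dmulE ker_diagE.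
have C p : p < s -> connect (glue (dswap e) e) (inl (inl p)) (inr p).
  move=> /(cell_in he)[u up]; apply: (@connect_trans _ _ (inl (inr u))); apply: connect1.
    by apply: (@edge_top _ _ _ (inl p) (inr u)); rewrite dswapE same_sym.
  exact: (@edge_bot _ _ _ (inl u) (inr p)).
apply/idP/eqP => [c|].
  (* The flag separates an upper point from s on from the lower point of the same index: they are
     not joined in the standard diagram although they name the same singleton of [e]. *)
  pose phi (w : pts3 n) := match w with
    | inl (inl p) => (pblock e (inr p), s <= p)
    | inl (inr u) => (pblock e (inl u), false)
    | inr p => (pblock e (inr p), false) end.
  have E : phi (outer13 x) = phi (outer13 y).
    apply: connect_preserve c => {C x y} x y /glueP[[a [b [-> -> ]]]|[a [b [-> -> ab]]]].
      rewrite dswapE; case: a b => [p|u] [q|v] /= ab.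
      - by rewrite (cell_low he ab).
      - rewrite same_sym in ab; rewrite leqNgt (label_lt he ab) /=; congr (_, _).
        by apply/eqP; rewrite -same_pblockE same_sym.
      - rewrite leqNgt (label_lt he ab) /=; congr (_, _).
        by apply/eqP; rewrite -same_pblockE.
      by congr (_, _); apply/eqP; rewrite -same_pblockE.
    by move: ab; rewrite same_pblockE => /eqP; case: a b => a [] b /= ->.
  have inj p q : pblock e (inr p) = pblock e (inr q) -> p = q.
    by move/eqP; rewrite -same_pblockE => /(cell_low he).
  case: x y {c} E => [p|p] [q|q] /= [/inj->] //.
    by rewrite leqNgt => /negbFE->.
  by rewrite leqNgt => /esym/negbFE->.
case: x y => [p|p] [q|q] /=.
- by case=> ->; exact: connect0.
- by case: ifP => // lt [->]; exact: C.
- by case: ifP => // lt [<-]; rewrite (sym_connect_sym (glue_sym _ _)); exact: C.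
by case: ifP => lp; case: ifP => lq // [->]; exact: connect0.
Qed.

(* Minimal pairs: the upper points from s on are isolated in both diagrams, and
   no further upward diagram can be extracted from the first s points. *)
Record min_pair l m : Prop := MinPair {
  min_l : dmul std l = l;
  min_m : dmul std m = m;
  min_dead : forall p, p < s -> ~~ dead l m p;
  min_sep : forall p q, p < s -> q < s -> q \in mclass l m p -> p = q }.

Lemma std_isolated l p : dmul std l = l -> s <= p ->
  (forall v, same l (inl p) (inl v) = (p == v)) /\ ~~ labelled l p.
Proof.
move=> El ge; have np : ~~ labelled std p.
  by apply/existsP=> -[r]; rewrite ker_diagE /=; case: ltnP => // lt /eqP[E]; rewrite -E ltnNge ge in lt.
split=> [v|]; last by rewrite -El; exact: unlabelled_mul_labelled.
by rewrite -El unlabelled_mul // ker_diagE /=.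
Qed.

(** * Recovering the upward diagram from the pair *)

Section MinUp.
Variables (e l m : pdiag n).
Hypotheses (he : in_cell s e) (hz : min_pair l m).

(** If [u] has label [p], its blocks in the products mirror the blocks of [p] in the minimal pair,
    where [p] is live. The points from s on are isolated on both sides and do not disturb the
    comparison. *)
Lemma min_up_dead u : dead (dmul e l) (dmul e m) u = ~~ labelled e u.
Proof.
apply/idP/idP => [du|]; last exact: unlabelled_dead.
apply/existsP=> -[p up]; have lt := label_lt he up.
have /negP := min_dead hz lt; apply.
case/and3P: du; rewrite !(up_labelled _ he up) => nl nm /forallP E.
rewrite /dead nl nm /=; apply/forallP=> q.
case: (ltnP q s) => [/(cell_in he)[v vq]|ge].
  by have := E v; rewrite !(up_upper _ he up vq).
have [El _] := std_isolated (min_l hz) ge; have [Em _] := std_isolated (min_m hz) ge.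
by rewrite ![same _ _ (inl q)]same_sym El Em.
Qed.

(** Together with [min_up_dead], this reads off from the two products the upper blocks of [e] and
    which of them are labelled, that is, all of [e] except the numbering of its labels. *)
Lemma min_up_class u v : (v \in mclass (dmul e l) (dmul e m) u) = same e (inl u) (inl v).
Proof.
apply/idP/idP => [uv|uv]; last by rewrite inE !same_mul.
case: (boolP (labelled e u)) => [/existsP[p up]|nu]; last first.
  by move: uv; rewrite inE unlabelled_mul // => /andP[].
case: (boolP (labelled e v)) => [/existsP[q vq]|nv]; last first.
  by move: uv; rewrite inE same_sym unlabelled_mul // same_sym => /andP[].
move: uv; rewrite inE !(up_upper _ he up vq) => pq.
have Epq : p = q by apply: (min_sep hz); [exact: label_lt up|exact: label_lt vq|rewrite inE].
by rewrite (same_l _ up) same_sym Epq.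
Qed.

Lemma min_up_psize : psize (dmul e l) (dmul e m) = s.
Proof.
pose F (p : 'I_s) := [set v | same e (inl v) (inr (widen_ord le_s p))].
have FE u (p : 'I_s) : same e (inl u) (inr (widen_ord le_s p)) ->
    mclass (dmul e l) (dmul e m) u = F p.
  move=> up; apply/setP=> v; rewrite min_up_class inE.
  by rewrite -(same_r _ up) same_sym.
rewrite /psize (_ : [set _ | _ in _] = F @: [set: 'I_s]); last first.
  apply/setP=> B; apply/imsetP/imsetP => [[u + ->]|[p _ ->]].
    rewrite inE min_up_dead negbK => /existsP[p up].
    exists (Ordinal (label_lt he up)) => //; apply: FE.
    by rewrite (_ : widen_ord _ _ = p) //; apply: val_inj.
  have [u up] := cell_in he (p := widen_ord le_s p) (ltn_ord p).
  exists u; last by rewrite (FE _ _ up).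
  by rewrite inE min_up_dead negbK; apply/existsP; exists (widen_ord le_s p).
rewrite card_imset ?cardsT ?card_ord // => p q E.
have [u up] := cell_in he (p := widen_ord le_s p) (ltn_ord p).
have : u \in F p by rewrite inE.
by rewrite E inE => /(label_uniq he up)/(congr1 val)/= /val_inj.
Qed.

End MinUp.

Lemma ext_perm_lt t p : (ext_perm le_s t p < s) = (p < s).
Proof. by rewrite permE ext_fun_lt. Qed.

Lemma ext_permM t t' : ext_perm le_s (t * t')%g = (ext_perm le_s t * ext_perm le_s t')%g.
Proof.
apply/permP=> p; apply: val_inj; rewrite permM !permE /=; case: (ltnP p s) => [lt|ge].
  have lt' : ext_fun t p < s by rewrite ext_fun_lt.
  rewrite (ext_funE le_s _ lt) (ext_funE le_s _ lt') permM; congr (val (t' _)).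
  by apply: val_inj; rewrite /= (ext_funE le_s _ lt).
by rewrite !ext_fun_out // ext_fun_out.
Qed.

Lemma ext_perm1 : ext_perm le_s 1%g = 1%g.
Proof.
apply/permP=> p; apply: val_inj; rewrite perm1 permE /=; case: (ltnP p s) => [lt|ge].
  by rewrite (ext_funE le_s _ lt) perm1.
by rewrite ext_fun_out.
Qed.

Lemma ext_permV t : ((ext_perm le_s t)^-1)%g = ext_perm le_s (t^-1)%g.
Proof. by apply: (mulgI (ext_perm le_s t)); rewrite mulgV -ext_permM mulgV ext_perm1. Qed.

Lemma min_pair_perm l m t : min_pair l m -> min_pair (dmul (Pm t) l) (dmul (Pm t) m).
Proof.
move=> hz; have std_t d : dmul std d = d -> dmul std (dmul (Pm t) d) = dmul (Pm t) d.
  by move=> Ed; rewrite dmulA std_perm_comm -dmulA Ed.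
have cl p q : (q \in mclass (dmul (Pm t) l) (dmul (Pm t) m) p) =
    (ext_perm le_s t q \in mclass l m (ext_perm le_s t p)).
  by rewrite !inE !perm_dmulE.
split; [exact: std_t (min_l hz)|exact: std_t (min_m hz)| |].
  move=> p lt; apply: contra (min_dead hz (p := ext_perm le_s t p) _); last by rewrite ext_perm_lt.
  have lab d : labelled (dmul (Pm t) d) p = labelled d (ext_perm le_s t p).
    by apply: eq_existsb => r; rewrite perm_dmulE.
  case/and3P; rewrite !lab => nl nm /forallP E; rewrite /dead nl nm /=.
  apply/forallP=> v; have := E ((ext_perm le_s t)^-1%g v).
  by rewrite !perm_dmulE /= permKV.
move=> p q lp lq; rewrite cl => /(min_sep hz)E; apply: (@perm_inj _ (ext_perm le_s t)).
by apply: E; rewrite ext_perm_lt.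
Qed.

(** The block with label p would also have label t p, and a block has only one label. *)
Lemma up_free e t : in_cell s e -> dmul e (Pm t) = e -> t = 1%g.
Proof.
move=> he E; apply/permP=> p; rewrite perm1; apply: val_inj.
have [u up] := cell_in he (p := widen_ord le_s p) (ltn_ord p).
have := dmul_permE e (ext_perm le_s t) (inl u) (inr (ext_perm le_s t (widen_ord le_s p))).
rewrite E /= permK up => /(label_uniq he up)/(congr1 val) /=.
rewrite permE (ext_funE le_s _ (ltn_ord p : widen_ord le_s p < s)) => E2.
apply: (etrans _ (esym E2)); by congr (val (t _)); apply: val_inj.
Qed.

(** By [min_up_class] and [min_up_dead] the two upward diagrams differ only in the numbering of
    their labelled blocks, which is a permutation [t]. Cancelling the upward diagram by its flip
    then compares the minimal pairs. *)
Lemma min_up_eq e e' l m l' m' : in_cell s e -> in_cell s e' ->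
  min_pair l m -> min_pair l' m' -> dmul e l = dmul e' l' -> dmul e m = dmul e' m' ->
  exists t, [/\ e' = dmul e (Pm t), l = dmul (Pm t) l' & m = dmul (Pm t) m'].
Proof.
move=> he he' hz hz' El Em.
have same_e u v : same e (inl u) (inl v) = same e' (inl u) (inl v).
  by rewrite -(min_up_class he hz) -(min_up_class he' hz') El Em.
have lab_e u : labelled e u = labelled e' u.
  by apply: negb_inj; rewrite -(min_up_dead he hz) -(min_up_dead he' hz') El Em.
(* The permutation sends the label that a block has in [e] to the label that it has in [e']. *)
have H (p : 'I_s) : exists q : 'I_s, [exists u, same e (inl u) (inr (widen_ord le_s p)) &&
    same e' (inl u) (inr (widen_ord le_s q))].
  have [u up] := cell_in he (p := widen_ord le_s p) (ltn_ord p).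
  have /existsP[q uq] : labelled e' u by rewrite -lab_e; apply/existsP; exists (widen_ord le_s p).
  exists (Ordinal (label_lt he' uq)); apply/existsP; exists u; rewrite up /=.
  by rewrite (_ : widen_ord _ _ = q) //; apply: val_inj.
pose f (p : 'I_s) := xchoose (H p).
have fP (p : 'I_s) : exists2 u, same e (inl u) (inr (widen_ord le_s p)) &
    same e' (inl u) (inr (widen_ord le_s (f p))).
  by have /existsP[u /andP[]] := xchooseP (H p); exists u.
have fi : injective f.
  move=> p q E; have [u up uq] := fP p; have [v vp vq] := fP q.
  have uv : same e (inl u) (inl v) by rewrite same_e (same_l _ uq) same_sym E.
  rewrite -(same_l _ uv) in vp; have /(congr1 val) := label_uniq he up vp.
  by move=> /= /val_inj.
pose t := perm fi; have Ee' : e' = dmul e (Pm t).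
  have lab u (p : 'I_s) : same e (inl u) (inr (widen_ord le_s p)) =
      same e' (inl u) (inr (widen_ord le_s (f p))).
    have [v vp vq] := fP p; apply/idP/idP => h.
      by rewrite (same_l _ (_ : same e' (inl u) (inl v))) // -same_e (same_l _ h) same_sym.
    by rewrite (same_l _ (_ : same e (inl u) (inl v))) // same_e (same_l _ h) same_sym.
  have lab' u q : same e' (inl u) (inr q) = same e (inl u) (inr ((ext_perm le_s t)^-1%g q)).
    case: (ltnP q s) => [lt|ge]; last first.
      have ge' : s <= (ext_perm le_s t)^-1%g q by rewrite leqNgt ext_permV ext_perm_lt -leqNgt.
      by rewrite (cell_out he' _ ge) (cell_out he _ ge').
    rewrite ext_permV; have -> : ext_perm le_s t^-1 q = widen_ord le_s ((t^-1)%g (Ordinal lt)).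
      by apply: val_inj; rewrite permE /= (ext_funE le_s _ lt).
    rewrite lab -[f _](permE fi) permKV.
    by congr (same _ _ (inr _)); apply: val_inj.
  apply: diag_eq => x y; rewrite dmul_permE; case: x y => [u|p] [v|q] /=.
  - by rewrite same_e.
  - exact: lab'.
  - by rewrite same_sym [RHS]same_sym.
  apply/idP/idP => [/(cell_low he')->|/(cell_low he)/perm_inj->]; exact: same_refl.
exists t; rewrite -!Ee'; split=> //.
  (* The standard diagram in front of [l] is written as the flip of [e] times [e], so that the
     equality of products applies. *)
  rewrite -(min_l hz) -(dswap_mul he) -dmulA El Ee' -!dmulA [dmul _ (dmul e _)]dmulA dswap_mul //.
  by rewrite dmulA std_perm_comm -dmulA (min_l hz').
rewrite -(min_m hz) -(dswap_mul he) -dmulA Em Ee' -!dmulA [dmul _ (dmul e _)]dmulA dswap_mul //.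
by rewrite dmulA std_perm_comm -dmulA (min_m hz').
Qed.

(** A middle point from s on is isolated in both diagrams, and any other middle point is a label of
    [e], hence joined to an upper point. The closed components depend on s alone. *)
Lemma min_loops e l : in_cell s e -> dmul std l = l ->
  comps_in (glue e l) (middle n) = (fun p => set1 (inl (inr p) : pts3 n)) @: [set p | s <= nat_of_ord p].
Proof.
move=> he El; have single p : s <= p -> Defs.comp (glue e l) (inl (inr p)) = set1 (inl (inr p) : pts3 n).
  move=> ge; apply/setP=> w; rewrite !inE; apply/idP/eqP => [c|->]; last exact: connect0.
  apply: (connect_ind (P := fun w => w = inl (inr p)) _ c) => // a b ab Ea.
  rewrite {a}Ea in ab; have [Is Nl] := std_isolated El ge.
  case/glueP: ab => -[a [b' []]].
    case: a => // a [<-] ->; case: b' => v ab; last by rewrite (cell_low he ab).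
    by rewrite same_sym (cell_out he) in ab.
  case: a => // a [<-] ->; case: b' => v; first by rewrite Is => /eqP->.
  by move=> ab; case/existsP: Nl; exists v.
apply/setP=> B; apply/comps_inP/imsetP => [[w -> sub]|[p]].
  have /imsetP[p _ Ew] : w \in middle n by apply: (subsetP sub); rewrite inE connect0.
  suff ge : s <= p by exists p; rewrite ?inE // Ew single.
  rewrite leqNgt; apply/negP=> /(cell_in he)[u up].
  have : inl (inl u) \in middle n.
    apply: (subsetP sub); rewrite inE Ew; apply: connect1.
    by apply: (@edge_top _ _ _ (inr p) (inl u)); rewrite same_sym.
  by case/imsetP.
rewrite inE => ge ->; exists (inl (inr p)); first by rewrite single.
by rewrite sub1set imset_f.
Qed.

(** In the associativity of loop counts, the loops of [e] with [l] and of [dmul d e] with [l] are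
    equally many by [min_loops], and they cancel. The count no longer involves [l], so it is the
    same for both members of a minimal pair: this turns the powers of a and b into a power of their
    product. *)
Lemma min_dloops d e l : in_cell s e -> in_cell s (dmul d e) -> dmul std l = l ->
  dloops d (dmul e l) = dloops d e.
Proof.
move=> he hde El; apply/esym/eqP.
have := dloopsA d e l; rewrite [dloops (dmul d e) l]dloopsE [dloops e l]dloopsE.
by rewrite !min_loops // addnC => /addnI ->.
Qed.

End Pairs2.

(** * Existence of a factorization through a minimal pair *)

Section Factor.
Variables (n : nat) (l m : pdiag n).
Local Notation s := (psize l m).
Local Notation std := (std_diag n s).
Implicit Types (u v p q : 'I_n).

Lemma psize_le : s <= n.
Proof.
apply: leq_trans (leq_imset_card _ _) _.
by apply: leq_trans (max_card _) _; rewrite card_ord.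
Qed.

Let classes := enum [set mclass l m u | u in [set u | ~~ dead l m u]].

Let size_classes : size classes = s. Proof. by rewrite -cardE. Qed.

(* The upward diagram of the pair: the live classes, numbered by their position in
   classes, are its propagating blocks, and the dead classes its other upper blocks. *)
Let key (x : pts n) : (nat + {set 'I_n}) + 'I_n :=
  match x with
  | inl u => if dead l m u then inl (inr (mclass l m u)) else inl (inl (index (mclass l m u) classes))
  | inr p => if p < s then inl (inl (val p)) else inr p
  end.

Let e : pdiag n := ker_diag key.

Let classesP u : ~~ dead l m u -> mclass l m u \in classes.
Proof. by move=> nd; rewrite mem_enum imset_f ?inE. Qed.

Let e_up u v : same e (inl u) (inl v) = (v \in mclass l m u).
Proof.
rewrite ker_diagE /= -mclass_eqE.
case: ifPn => du; case: ifPn => dv.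
- by [].
- apply/esym/negbTE; apply: contra dv; rewrite mclass_eqE => /dead_mclass <-; exact: du.
- apply/esym/negbTE; apply: contra du; rewrite mclass_eqE => /dead_mclass ->; exact: dv.
apply/eqP/eqP => [[]|-> //].
by move/(congr1 (nth set0 classes)); rewrite !nth_index ?classesP.
Qed.

Let e_cell : in_cell s e.
Proof.
split=> [p q|p u le|p lt].
- by rewrite ker_diagE /=; do 2![case: ifP => _] => /eqP // [] //; exact: val_inj.
- by rewrite ker_diagE /= ltnNge le; case: ifP.
have : nth set0 classes p \in classes by rewrite mem_nth // size_classes.
rewrite mem_enum => /imsetP[u]; rewrite inE => nd Eu; exists u.
by rewrite ker_diagE /= (negPf nd) lt -Eu index_uniq ?enum_uniq ?size_classes.
Qed.

Let e_lab u : labelled e u = ~~ dead l m u.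
Proof.
apply/existsP/idP => [[p]|nd]; rewrite ?ker_diagE /=.
  by case: ifP => // _; case: ifP.
have lt : index (mclass l m u) classes < s by rewrite -size_classes index_mem classesP.
exists (Ordinal (leq_trans lt psize_le)); by rewrite ker_diagE /= (negPf nd) lt.
Qed.

(** A partial identity attached to the pair. It fixes [l] and [m] ([D_l], [D_m]), so going down by
    the flip of [e] and up again by [e] loses nothing. *)
Let D := dmul e (dswap e).

Let D_up u v : (v \in mclass l m u) -> same D (inl u) (inl v).
Proof. by rewrite -e_up; exact: same_mul. Qed.

Let D_low u v : same D (inl u) (inr v) = ~~ dead l m u && (v \in mclass l m u).
Proof.
rewrite -e_lab -e_up; case: (boolP (labelled e u)) => [/existsP[p up]|nu] /=.
  by rewrite (up_lower (dswap e) e_cell v up) dswapE /= (same_l _ up) same_sym.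
by apply/negbTE; apply: contra (unlabelled_mul_labelled (dswap e) nu) => h; apply/existsP; exists v.
Qed.

Let D_lowlow u v : same D (inr u) (inr v) -> v \in mclass l m u.
Proof.
rewrite dmulE => /(up_connect e_cell) E.
have {}E : pblock (dswap e) (inr u) = pblock (dswap e) (inr v) by case: E.
by move/eqP: E; rewrite -same_pblockE dswapE /= e_up.
Qed.

(** [D] joins the upper and lower copies of a live class and leaves the two copies of a dead class
    apart. A dead class is required to be a full unlabelled block of [d]: in the product its middle
    copy is closed and discarded, and the upper copy in [D] replaces it. *)
Let D_mul d : (forall u v, v \in mclass l m u -> same d (inl u) (inl v)) ->
  (forall u, labelled d u -> ~~ dead l m u) ->
  (forall u v, dead l m u -> same d (inl u) (inl v) -> v \in mclass l m u) -> dmul D d = d.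
Proof.
move=> dcl dlab dd; apply: diag_eq => x y; rewrite dmulE; apply/idP/idP => [c|xy].
  pose phi (w : pts3 n) : pts n := match w with
    | inl (inl u) => inl u | inl (inr u) => inl u | inr p => inr p end.
  have -> : x = phi (outer13 x) by case: x c.
  have -> : y = phi (outer13 y) by case: y c.
  rewrite same_pblockE; apply/eqP.
  apply: (connect_preserve (f := fun w => pblock d (phi w)) _ c).
  move=> {x y c} _ _ /glueP[[a [b [-> -> ab]]]|[a [b [-> -> ab]]]]; apply/eqP.
    rewrite -same_pblockE; case: a b ab => [u|u] [v|v] /=.
    - case: (boolP (dead l m u)) => [du|nd].
        rewrite unlabelled_mul ?e_lab ?negbK // e_up; exact: dcl.
      case: (boolP (dead l m v)) => [dv|ndv].
        by rewrite same_sym unlabelled_mul ?e_lab ?negbK // e_up same_sym; exact: dcl.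
      move: nd ndv; rewrite -!e_lab => /existsP[p up] /existsP[q vq].
      rewrite (up_upper _ e_cell up vq) dswapE /= => /(cell_low e_cell) pq.
      by apply: dcl; rewrite -e_up (same_l _ up) same_sym pq.
    - by rewrite D_low => /andP[_]; exact: dcl.
    - by rewrite same_sym D_low => /andP[_] h; rewrite same_sym; exact: dcl.
    by move/D_lowlow; exact: dcl.
  by rewrite -same_pblockE; case: a b ab => a [] b.
have mid u : ~~ dead l m u -> connect (glue D d) (inl (inl u)) (inl (inr u)).
  move=> nd; apply: connect1; apply: (@edge_top _ _ _ (inl u) (inr u)).
  by rewrite D_low nd mclass_id.
have C u p : same d (inl u) (inr p) -> connect (glue D d) (inl (inl u)) (inr p).
  move=> up; apply: connect_trans (mid u _) _.
    by apply: dlab; apply/existsP; exists p.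
  exact: connect1 (@edge_bot _ _ _ (inl u) (inr p) up).
case: x y xy => [u|p] [v|q] xy.
- case: (boolP (dead l m u)) => [du|ndu].
    by apply: connect1; apply: edge_top; apply: D_up; exact: dd.
  case: (boolP (dead l m v)) => [dv|ndv].
    rewrite (sym_connect_sym (glue_sym _ _)).
    by apply: connect1; apply: edge_top; apply: D_up; apply: dd => //; rewrite same_sym.
  apply: connect_trans (mid u ndu) _; rewrite (sym_connect_sym (glue_sym _ _)).
  apply: connect_trans (mid v ndv) _; apply: connect1.
  by apply: (@edge_bot _ _ _ (inl v) (inl u)); rewrite same_sym.
- exact: C.
- by rewrite (sym_connect_sym (glue_sym _ _)); apply: C; rewrite same_sym.
exact: connect1 (@edge_bot _ _ _ (inr p) (inr q) xy).
Qed.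

Let D_l : dmul D l = l.
Proof.
apply: D_mul => [u v|u|u v].
- by rewrite inE => /andP[].
- by move=> lu; apply/negP=> /and3P[/negP].
by move=> /and3P[_ _ /forallP/(_ v)/eqP E]; rewrite inE -E => ->.
Qed.

Let D_m : dmul D m = m.
Proof.
apply: D_mul => [u v|u|u v].
- by rewrite inE => /andP[].
- by move=> lu; apply/negP=> /and3P[_ /negP].
by move=> /and3P[_ _ /forallP/(_ v)/eqP E]; rewrite inE E => ->.
Qed.

Lemma min_up_exists : exists e g, [/\ in_cell s e, min_pair s (dmul g l) (dmul g m),
  dmul e (dmul g l) = l & dmul e (dmul g m) = m].
Proof.
(* The factor [std] is idempotent, which gives the isolation conditions of a minimal pair, and [e]
   absorbs it on its right. *)
pose g := dmul std (dswap e).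
have gE d : dmul D d = d -> dmul e (dmul g d) = d.
  by move=> Ed; rewrite dmulA [dmul e _]dmulA (in_cell_std e_cell).
have [El Em] := (gE _ D_l, gE _ D_m).
exists e, g; split=> //; split.
- by rewrite dmulA [dmul std g]dmulA std_std ?psize_le.
- by rewrite dmulA [dmul std g]dmulA std_std ?psize_le.
- move=> p lt; have [u up] := cell_in e_cell lt.
  have : ~~ dead l m u by rewrite -e_lab; apply/existsP; exists p.
  apply: contra => /and3P[nl nm /forallP E]; apply/and3P.
  rewrite -El -Em !(up_labelled _ e_cell up); split=> //.
  apply/forallP=> v; case: (boolP (labelled e v)) => [/existsP[q vq]|nv].
    by rewrite !(up_upper _ e_cell up vq).
  by rewrite ![same _ (inl u) _]same_sym !unlabelled_mul.
move=> p q lp lq; rewrite inE.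
have [u up] := cell_in e_cell lp; have [v vq] := cell_in e_cell lq.
rewrite -!(up_upper _ e_cell up vq) El Em => uv.
have : same e (inl u) (inl v) by rewrite e_up inE.
by move=> uv'; apply: (label_uniq e_cell up); rewrite (same_l _ uv').
Qed.

End Factor.

Section PsizeTheory.
Variable n : nat.
Implicit Types (d e l m : pdiag n).

(** The pair is the image of another one under a diagram of rank [psize l m]. After multiplication
    by [d] the rank of that diagram has not grown, and it bounds the size by [psize_mul]. *)
Lemma psize_mono d l m : psize (dmul d l) (dmul d m) <= psize l m.
Proof.
have [e [g [he _ El Em]]] := min_up_exists l m.
rewrite -{1}El -{1}Em !dmulA; apply: leq_trans (psize_mul _ _ _) _.
apply: leq_trans (rank_dmull _ _) _; apply: leq_trans (rank_dmulr _ _) _.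
by rewrite (in_cell_propagating he) // psize_le.
Qed.

(** Minimality sees only the upper blocks and whether they are labelled, so the labels of the two
    members may be renamed independently. *)
Lemma min_pair_ract s l m (g h : 'S_n) :
  min_pair s l m -> min_pair s (dmul l (perm_diag g)) (dmul m (perm_diag h)).
Proof.
have lab d (t : 'S_n) u : labelled (dmul d (perm_diag t)) u = labelled d u.
  apply/existsP/existsP => -[p]; rewrite ?dmul_permE => up.
    by exists (t^-1%g p).
  by exists (t p); rewrite dmul_permE /= permK.
case=> El Em Ed Es; split.
- by rewrite dmulA El.
- by rewrite dmulA Em.
- move=> p /Ed; rewrite /dead !lab; congr (~~ [&& _, _ & _]).
  by apply: eq_forallb => v; rewrite !dmul_permE.
by move=> p q lp lq; rewrite inE !dmul_permE /= => h'; apply: Es; rewrite ?inE.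
Qed.

End PsizeTheory.

(** * Tableaux and dominance *)

Section Shape.
Variables (i : nat).
Implicit Types (la mu : seq nat) (t : {ffun 'I_i -> 'I_i * 'I_i}).

(** The Young diagram, as opposed to the partition diagrams [pdiag]. *)
Definition diagram la : {set 'I_i * 'I_i} := [set x : 'I_i * 'I_i | x.2 < nth 0 la x.1].

Lemma sum_nth_partition la : is_partition_of la i -> \sum_(r < i) nth 0 la r = i.
Proof.
case/and3P=> _ la0 /eqP sla.
have le : size la <= i.
  rewrite -sla sumnE -sum1_size !big_seq; apply: leq_sum => x.
  by case: x => // xla; rewrite xla in la0.
rewrite -[RHS]sla sumnE (big_nth 0) big_mkord.
rewrite (big_ord_widen_cond i xpredT (nth 0 la) le) [RHS]big_mkcond /=.
by apply: eq_bigr => r _; case: ltnP => // ?; rewrite nth_default.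
Qed.

Lemma partition_nth_le la r : is_partition_of la i -> nth 0 la r <= i.
Proof.
case/and3P=> _ _ /eqP<-; elim: la r => [|x la IH] [|r] //=; first exact: leq_addr.
exact: leq_trans (IH r) (leq_addl _ _).
Qed.

Lemma partition_nth_mono la r r' : is_partition_of la i -> r <= r' -> nth 0 la r' <= nth 0 la r.
Proof.
case/and3P=> so _ _ le; case: (ltnP r' (size la)) => [lt|ge]; last by rewrite (nth_default _ ge).
have := @sorted_leq_nth _ geq _ leqnn 0 la so r r'; rewrite !inE; apply=> //.
  by move=> a b c /= ba ca; exact: leq_trans ca ba.
exact: leq_ltn_trans lt.
Qed.

Lemma card_row la r : is_partition_of la i ->
  #|[set x in diagram la | x.1 == r]| = nth 0 la r.
Proof.
move=> hla; rewrite -[RHS](minn_idPr (partition_nth_le r hla)).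
rewrite -sum1_card -[RHS]card_ord -[RHS]sum1_card.
rewrite (big_ord_widen_cond i xpredT (fun=> 1) (geq_minl _ _)) /=.
rewrite (reindex_onto (fun c : 'I_i => (r, c)) snd) /=; last first.
  by case=> a b; rewrite !inE /= => /andP[_ /eqP->].
by apply: eq_bigl => c; rewrite !inE /= !eqxx !andbT ltn_min ltn_ord.
Qed.

Lemma card_diagram la : is_partition_of la i -> #|diagram la| = i.
Proof.
move=> hla; rewrite -[RHS](sum_nth_partition hla) -sum1_card.
rewrite (partition_big fst xpredT) //=; apply: eq_bigr => r _.
by rewrite -(card_row r hla) -sum1_card; apply: eq_bigl => x; rewrite !inE.
Qed.

Lemma tableauP la t : reflect (injective t /\ forall a, t a \in diagram la) (is_tableau la t).
Proof.
apply: (iffP andP) => [[/injectiveP ti /forallP tl]|[ti tl]].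
  by split=> // a; rewrite inE.
by split; [exact/injectiveP|apply/forallP=> a; have := tl a; rewrite inE].
Qed.

Lemma exists_tableau la : is_partition_of la i -> exists t, is_tableau la t.
Proof.
move=> hla; pose t := [ffun a : 'I_i => enum_val (cast_ord (esym (card_diagram hla)) a)].
exists t; apply/tableauP; split=> [a b|a]; rewrite !ffunE; last exact: enum_valP.
by move/enum_val_inj/cast_ord_inj.
Qed.

Lemma tableau_im la t : is_partition_of la i -> is_tableau la t ->
  t @: [set: 'I_i] = diagram la.
Proof.
move=> hla /tableauP[ti tl]; apply/eqP; rewrite eqEcard card_imset // cardsT card_ord.
rewrite card_diagram // leqnn andbT; apply/subsetP=> _ /imsetP[a _ ->]; exact: tl.
Qed.

Lemma move_is_tableau la t (s : 'S_i) : is_tableau la t -> is_tableau la (move_tableau s t).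
Proof.
case/tableauP=> ti tl; apply/tableauP; split=> [a b|a]; rewrite !ffunE //.
by move/ti/perm_inj.
Qed.

Lemma tableau_move la t t' : is_partition_of la i -> is_tableau la t -> is_tableau la t' ->
  exists s : 'S_i, t' = move_tableau s t.
Proof.
move=> hla tt tt'; have im := tableau_im hla tt.
have [ti' tl'] := tableauP _ _ tt'; have [ti tl] := tableauP _ _ tt.
have H a : exists b, t' a == t b.
  by have := tl' a; rewrite -im => /imsetP[b _ ->]; exists b.
pose f a := xchoose (H a); have fE a : t' a = t (f a) by exact/eqP/(xchooseP (H a)).
have fi : injective f by move=> a b E; apply: ti'; rewrite !fE E.
by exists (perm fi); apply/ffunP=> a; rewrite ffunE permE.
Qed.

Lemma row_map_move (s : 'S_i) t : row_map (move_tableau s t) = precomp s (row_map t).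
Proof. by apply/ffunP=> a; rewrite !ffunE. Qed.

Lemma card_tableau la t (P : pred ('I_i * 'I_i)) : is_partition_of la i ->
  is_tableau la t -> #|[set a | P (t a)]| = #|[set x in diagram la | P x]|.
Proof.
move=> hla tt; have [ti tl] := tableauP _ _ tt; rewrite -(card_imset _ ti).
apply: eq_card => x; rewrite inE -(tableau_im hla tt).
apply/imsetP/andP => [[a]|[/imsetP[a _ ->] Pa]]; last by exists a; rewrite ?inE.
by rewrite inE => Pa ->; rewrite imset_f.
Qed.

Lemma card_rows_lt la t r : is_partition_of la i -> is_tableau la t ->
  #|[set a | (t a).1 < r]| = \sum_(j < i | j < r) nth 0 la j.
Proof.
move=> hla tt; rewrite (card_tableau (fun x => x.1 < r) hla tt) -sum1_card.
rewrite (partition_big fst (fun j : 'I_i => j < r)) /=; last first.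
  by move=> x; rewrite inE => /andP[].
apply: eq_bigr => j lt; rewrite -(card_row j hla) -sum1_card.
by apply: eq_bigl => x; rewrite !inE; case: (x.1 =P j) => [->|_]; rewrite ?lt ?andbT ?andbF.
Qed.

End Shape.

(** * Sorting the columns of a tableau *)

Section Rearrange.
Variables (i : nat) (la : seq nat) (t : {ffun 'I_i -> 'I_i * 'I_i}) (f : {ffun 'I_i -> 'I_i}).
Hypotheses (hla : is_partition_of la i) (tt : is_tableau la t).
Hypothesis f_col : forall a b, (t a).2 = (t b).2 -> f a = f b -> a = b.

(* Pushing the entries of each column of t up, in the order given by f. *)
Let above a := [set b | ((t b).2 == (t a).2) && (f b < f a)].

Let above_le a : #|above a| <= f a.
Proof.
have fi : {in above a &, injective f}.
  move=> b c; rewrite !inE => /andP[/eqP Eb _] /andP[/eqP Ec _]; apply: f_col.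
  by rewrite Eb.
rewrite -(card_in_imset fi).
have /subset_leq_card/leq_trans : f @: above a \subset [set v : 'I_i | v < f a].
  by apply/subsetP=> _ /imsetP[b + ->]; rewrite !inE => /andP[].
apply; rewrite -sum1_card (eq_bigl (fun v : 'I_i => v < f a)) => [|v]; last by rewrite inE.
by rewrite -(big_ord_widen_cond i xpredT (fun=> 1)) ?sum1_card ?card_ord // ltnW.
Qed.

Let above_lt a : #|above a| < i. Proof. exact: leq_ltn_trans (above_le a) (ltn_ord _). Qed.

Let t' := [ffun a => (Ordinal (above_lt a), (t a).2)].

(** Otherwise the column of [a] would stop before row [#|above a|], since row lengths decrease, and
    would have at most that many entries; but it contains [a] and all of [above a]. *)
Let t'_in a : t' a \in diagram i la.
Proof.
rewrite inE ffunE /= ltnNge; apply/negP=> le.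
have [ti tl] := tableauP _ _ tt.
pose col := [set b | (t b).2 == (t a).2].
have rowi : {in col &, injective (fun b => (t b).1)}.
  move=> b c; rewrite !inE => /eqP Eb /eqP Ec E; apply: ti.
  by rewrite [LHS]surjective_pairing [RHS]surjective_pairing E Eb Ec.
have lt : #|above a| < #|col|.
  apply: proper_card; apply/properP; split.
    by apply/subsetP=> b; rewrite !inE => /andP[].
  by exists a; rewrite !inE ?eqxx ?ltnn.
have : #|col| <= #|above a|.
  rewrite -(card_in_imset rowi).
  have /subset_leq_card/leq_trans :
      (fun b => (t b).1) @: col \subset [set v : 'I_i | v < #|above a|].
    apply/subsetP=> _ /imsetP[b + ->]; rewrite !inE => /eqP Eb.
    rewrite ltnNge; apply/negP=> le'; have := tl b; rewrite inE Eb ltnNge.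
    by rewrite (leq_trans (partition_nth_mono hla le') le).
  apply; rewrite -sum1_card (eq_bigl (fun v : 'I_i => v < #|above a|)) => [|v]; last by rewrite inE.
  by rewrite -(big_ord_widen_cond i xpredT (fun=> 1)) ?sum1_card ?card_ord // ltnW.
by rewrite leqNgt lt.
Qed.

Let t'_inj : injective t'.
Proof.
move=> a b; rewrite !ffunE => -[E Ec]; apply: f_col => //.
have key c d : (t c).2 = (t d).2 -> f c < f d -> #|above c| < #|above d|.
  move=> Ecd lt; apply: proper_card; apply/properP; split.
    apply/subsetP=> x; rewrite !inE Ecd => /andP[-> /=] /ltn_trans; exact.
  by exists c; rewrite !inE ?Ecd ?eqxx ?ltnn ?lt ?andbF.
case: (ltngtP (f a) (f b)) => [/(key _ _ Ec)|/(key _ _ (esym Ec))|/val_inj//];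
by rewrite E ltnn.
Qed.

(** Used with [f] the row map of another tableau: the resulting inequality of rows is the source
    both of the dominance order and of the uniqueness in [kap_tabloid]. *)
Lemma column_sort : exists2 t', is_tableau la t' &
  forall a, (t' a).2 = (t a).2 /\ (t' a).1 <= f a.
Proof.
exists t'; first by apply/tableauP.
by move=> a; rewrite ffunE; split=> //=; apply: above_le.
Qed.

End Rearrange.

Lemma pointwise_eq (i : nat) (f g : 'I_i -> nat) :
  (forall a, g a <= f a) -> \sum_a f a <= \sum_a g a -> forall a, g a = f a.
Proof.
move=> le s a; apply/eqP; rewrite eqn_leq le /=.
rewrite (bigD1 a) //= [leqRHS](bigD1 a) //= in s.
rewrite -(leq_add2r (\sum_(j < i | j != a) g j)); apply: leq_trans _ s.
by rewrite leq_add2l; apply: leq_sum.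
Qed.

Local Open Scope ring_scope.

(** * Signed column sums and polytabloids *)

Section Kappa.
Variables (k : fieldType) (i : nat).
Hypothesis char_k : [pchar k] =i pred0.
Implicit Types (la mu : seq nat) (t : {ffun 'I_i -> 'I_i * 'I_i}).

Definition col_stab t : pred 'S_i := fun s => [forall a, (t (s a)).2 == (t a).2].

Definition kap t (v : tabloid_space k i) : tabloid_space k i :=
  \sum_(s | col_stab t s) (-1) ^+ s *: tabloid_act s v.

Lemma pchar0_natr_neq0 m : (0 < m)%N -> m%:R != 0 :> k.
Proof. by move=> m0; rewrite ((pcharf0P k).1 char_k) -lt0n. Qed.

Lemma col_stabM t s r : col_stab t s -> col_stab t r -> col_stab t (s * r)%g.
Proof.
move=> /forallP hs /forallP hr; apply/forallP=> a; rewrite permM.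
by rewrite (eqP (hr _)).
Qed.

Lemma col_stabV t s : col_stab t s -> col_stab t s^-1%g.
Proof. by move=> /forallP hs; apply/forallP=> a; have := hs (s^-1%g a); rewrite permKV eq_sym. Qed.

Lemma col_stab1 t : col_stab t 1%g.
Proof. by apply/forallP=> a; rewrite perm1. Qed.

Lemma col_stabMr t s r : col_stab t s -> col_stab t (r * s)%g = col_stab t r.
Proof.
move=> hs; apply/idP/idP => [h|h]; last exact: col_stabM.
by rewrite -[r](mulgK s); apply: col_stabM h (col_stabV hs).
Qed.

Lemma kap_linear t : linear (kap t).
Proof.
move=> c u v; rewrite /kap scaler_sumr -big_split; apply: eq_bigr => s _.
by rewrite tabloid_act_linear scalerDr !scalerA mulrC.
Qed.

HB.instance Definition _ t := GRing.isLinear.Build k _ _ _ (kap t) (kap_linear t).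

Lemma polytabloidE t : polytabloid k t = kap t (tabloid k (row_map t)).
Proof. by apply: eq_bigr => s _; rewrite tabloid_actE. Qed.

Lemma kap_act t s v : col_stab t s -> kap t (tabloid_act s v) = (-1) ^+ s *: kap t v.
Proof.
move=> hs; rewrite /kap scaler_sumr [RHS](reindex_inj (mulIg s)) /=.
apply: eq_big => [r|r _]; first by rewrite col_stabMr.
rewrite tabloid_actM scalerA odd_permM signr_addb mulrC.
by rewrite -mulrA -expr2 sqrr_sign mulr1.
Qed.

Lemma kap_kap t v : kap t (kap t v) = (#|col_stab t|)%:R *: kap t v.
Proof.
rewrite {2}/kap linear_sum /= (eq_bigr (fun=> kap t v)) => [|s hs].
  by rewrite sumr_const scaler_nat.
by rewrite linearZ /= kap_act // scalerA -expr2 sqrr_sign scale1r.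
Qed.

Lemma card_col_stab_neq0 t : (#|col_stab t|)%:R != 0 :> k.
Proof. by apply: pchar0_natr_neq0; apply/card_gt0P; exists 1%g; exact: col_stab1. Qed.

(** If two entries of a column had the same value, their transposition would fix the tabloid while
    changing the sign of its image, so twice the image would vanish. *)
Lemma kap_tabloid_neq0 t f : kap t (tabloid k f) != 0 ->
  forall a b, (t a).2 = (t b).2 -> f a = f b -> a = b.
Proof.
move=> nz a b Et Ef; apply/eqP; apply: contraR nz => ab.
have hs : col_stab t (tperm a b) by apply/forallP=> c; case: tpermP => [->|->|]; rewrite ?Et.
have := kap_act (tabloid k f) hs; rewrite odd_tperm ab expr1 tabloid_actE.
have -> : precomp (tperm a b) f = f.
  by apply/ffunP=> c; rewrite ffunE; case: tpermP => [->|->|].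
move/eqP; rewrite scaleN1r -addr_eq0 -mulr2n -scaler_nat scaler_eq0.
by rewrite (negPf (pchar0_natr_neq0 _)).
Qed.

(** [column_sort] gives a tableau of shape [la] in which no entry is lower than in [t'], so the
    entries in the first r rows of [t'] stay within the first r rows. *)
Lemma kap_dominance la mu t t' : is_partition_of la i -> is_partition_of mu i ->
  is_tableau la t -> is_tableau mu t' -> kap t (tabloid k (row_map t')) != 0 ->
  forall r, (\sum_(j < i | j < r) nth 0 mu j <= \sum_(j < i | j < r) nth 0 la j)%N.
Proof.
move=> hla hmu tt tt' nz r.
have [u uu uP] := column_sort hla tt (kap_tabloid_neq0 nz).
rewrite -(card_rows_lt r hla uu) -(card_rows_lt r hmu tt').
apply: subset_leq_card; apply/subsetP=> a; rewrite !inE.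
by have := (uP a).2; rewrite ffunE; exact: leq_ltn_trans.
Qed.

Lemma sum_rows la t : is_partition_of la i -> is_tableau la t ->
  (\sum_a (t a).1 = \sum_(x in diagram i la) x.1)%N.
Proof.
move=> hla tt; have [ti tl] := tableauP _ _ tt.
rewrite -(tableau_im hla tt) big_imset /=; last by move=> a b _ _; exact: ti.
by apply: eq_bigl => a; rewrite inE.
Qed.

(** The sorted tableau and [t'] have the same shape, hence the same total of row indices, so the
    inequality of rows is an equality everywhere. The tabloid of [t'] is thus that of [t] moved by a
    column permutation, which the signed sum absorbs up to sign. *)
Lemma kap_tabloid la t t' : is_partition_of la i -> is_tableau la t -> is_tableau la t' ->
  exists c, kap t (tabloid k (row_map t')) = c *: polytabloid k t.
Proof.
move=> hla tt tt'; have [->|nz] := eqVneq (kap t (tabloid k (row_map t'))) 0.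
  by exists 0; rewrite scale0r.
have [u uu uP] := column_sort hla tt (kap_tabloid_neq0 nz).
have Eu : forall a, (u a).1 = row_map t' a :> nat.
  apply: pointwise_eq => [a|]; first exact: (uP a).2.
  rewrite (sum_rows hla uu) -(sum_rows hla tt').
  by apply: eq_leq; apply: eq_bigr => a _; rewrite ffunE.
have [s Es] := tableau_move hla tt uu.
have hs : col_stab t s.
  by apply/forallP=> a; have := (uP a).1; rewrite Es ffunE => ->.
have -> : row_map t' = precomp s (row_map t).
  by rewrite -row_map_move -Es; apply/ffunP=> a; apply: val_inj; apply: (etrans (esym (Eu a))); rewrite [in RHS]ffunE.
by exists ((-1) ^+ s); rewrite -tabloid_actE kap_act // polytabloidE.
Qed.

(** The coefficient at the tabloid of [t] itself is 1: a column permutation that also preserves the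
    rows is the identity. *)
Lemma polytabloid_neq0 la t : is_tableau la t -> polytabloid k t != 0.
Proof.
case/tableauP=> ti _; apply/eqP=> /ffunP/(_ (row_map t)).
rewrite sum_ffunE ffunE (bigD1 1%g) /=; last exact: col_stab1.
rewrite big1 => [|s /andP[/forallP hs s1]].
  rewrite addr0 !ffunE odd_perm1 expr0 (_ : _ == _) /=; last first.
    by apply/eqP/ffunP=> a; rewrite !ffunE perm1.
  by move/eqP; rewrite scale1r oner_eq0.
rewrite !ffunE (_ : _ == _ = false) ?scaler0 //; apply: contraNF s1 => /eqP E.
apply/eqP/permP=> a; rewrite perm1; apply: ti.
move/ffunP/(_ a): E; rewrite !ffunE => E.
by rewrite [LHS]surjective_pairing [RHS]surjective_pairing E (eqP (hs a)).
Qed.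

Lemma specht_ind la (P : tabloid_space k i -> Prop) : P 0 ->
  (forall c u v, P u -> P v -> P (c *: u + v)) ->
  (forall t, is_tableau la t -> P (polytabloid k t)) ->
  forall v, v \in specht_space k i la -> P v.
Proof.
move=> P0 PD Pt v Sv; rewrite (coord_span Sv).
apply: (big_ind P) => // [u w Pu Pw|j _].
  by rewrite -[u]scale1r; apply: PD.
rewrite -[X in P X]addr0; apply: PD => //.
set w := _`_j; have /mapP[t] : w \in [seq polytabloid k t | t <- enum (is_tableau la)].
  by apply: mem_nth; rewrite (leq_trans (ltn_ord j)) ?size_tuple.
by rewrite mem_enum => tt ->; apply: Pt.
Qed.

Lemma polytabloid_sum t' t :
  kap t (polytabloid k t') =
  \sum_(s | col_stab t' s) (-1) ^+ s *: kap t (tabloid k (row_map (move_tableau s t'))).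
Proof.
rewrite [polytabloid k t']/polytabloid linear_sum; apply: eq_bigr => s _.
by rewrite linearZ row_map_move.
Qed.

Lemma kap_specht la t v : is_partition_of la i -> is_tableau la t ->
  v \in specht_space k i la -> exists c, kap t v = c *: polytabloid k t.
Proof.
move=> hla tt; move: v; apply: specht_ind => [|c u v [x Ex] [y Ey]|t' tt'].
- by exists 0; rewrite linear0 scale0r.
- by exists (c * x + y); rewrite kap_linear Ex Ey scalerDl scalerA.
rewrite polytabloid_sum; apply: (big_ind (fun v => exists c, v = c *: polytabloid k t)).
- by exists 0; rewrite scale0r.
- by move=> _ _ [x ->] [y ->]; exists (x + y); rewrite scalerDl.
move=> s _; have [c ->] := kap_tabloid hla tt (move_is_tableau s tt').
by exists ((-1) ^+ s * c); rewrite scalerA.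
Qed.

Lemma kap_specht_dominance la mu t v : is_partition_of la i -> is_partition_of mu i ->
  is_tableau la t -> v \in specht_space k i mu -> kap t v != 0 ->
  forall r, (\sum_(j < i | j < r) nth 0 mu j <= \sum_(j < i | j < r) nth 0 la j)%N.
Proof.
move=> hla hmu tt Sv nz r; rewrite leqNgt; apply/negP=> lt; case/eqP: nz.
move: v Sv; apply: specht_ind => [|c u v u0 v0|t' tt']; rewrite ?linear0 //.
  by rewrite kap_linear u0 v0 scaler0 addr0.
rewrite polytabloid_sum big1 // => s _.
case: (eqVneq (kap t (tabloid k (row_map (move_tableau s t')))) 0) => [->|nz].
  by rewrite scaler0.
have := kap_dominance hla hmu tt (move_is_tableau s tt') nz r.
by rewrite leqNgt lt.
Qed.

End Kappa.

Lemma dominance_anti i la mu : is_partition_of la i -> is_partition_of mu i ->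
  (forall r, \sum_(j < i | j < r) nth 0 mu j = \sum_(j < i | j < r) nth 0 la j)%N -> la = mu.
Proof.
move=> hla hmu E.
have E' r : nth 0%N mu r = nth 0%N la r.
  case: (ltnP r i) => lt.
    have S (la' : seq nat) : (\sum_(j < i | j < r.+1) nth 0 la' j
                  = nth 0 la' r + \sum_(j < i | j < r) nth 0 la' j)%N.
      rewrite (bigD1 (Ordinal lt)) //=; congr addn; apply: eq_bigl => j.
      by rewrite ltnS andbC -(inj_eq val_inj) /= -ltn_neqAle.
    by have := E r.+1; rewrite !S E => /addIn.
  have H la' : is_partition_of la' i -> nth 0%N la' r = 0%N.
    case/and3P=> _ la0 /eqP sla; rewrite nth_default //; apply: leq_trans lt.
    rewrite -sla sumnE -sum1_size !big_seq; apply: leq_sum => x.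
    by case: x => // xla; rewrite xla in la0.
  by rewrite !H.
have H (l1 l2 : seq nat) : 0%N \notin l1 -> nth 0%N l1 =1 nth 0%N l2 -> (size l1 <= size l2)%N.
  move=> n0 En; rewrite leqNgt; apply/negP=> lt; case/negP: n0.
  by rewrite -(nth_default 0%N (leqnn (size l2))) -En mem_nth.
have [/and3P[_ la0 _] /and3P[_ mu0 _]] := (hla, hmu).
apply: (@eq_from_nth _ 0%N) => [|r _]; last by rewrite E'.
by apply/eqP; rewrite eqn_leq !H.
Qed.

(** * Specht modules *)

Record lin_action (k : fieldType) (gT : finGroupType) (W : lmodType k) (act : gT -> W -> W) : Prop :=
  LinAction {
    lact_linear : forall g, linear (act g);
    lactM : forall g h w, act g (act h w) = act (g * h)%g w;
    lact1 : forall w, act 1%g w = w }.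

Section ActionTheory.
Variables (k : fieldType) (gT : finGroupType) (W : lmodType k) (act : gT -> W -> W).
Hypothesis hact : lin_action act.

Definition lact_lin g : {linear W -> W} :=
  HB.pack (act g) (GRing.isLinear.Build k W W _ (act g) (lact_linear hact g)).

Lemma lactD g u v : act g (u + v) = act g u + act g v.
Proof. exact: (linearD (lact_lin g)). Qed.

Lemma lactZ g c v : act g (c *: v) = c *: act g v.
Proof. exact: (linearZ_LR (lact_lin g)). Qed.

Lemma lact0 g : act g 0 = 0.
Proof. exact: (linear0 (lact_lin g)). Qed.

Lemma lact_sum g (I : Type) (r : seq I) (P : pred I) (F : I -> W) :
  act g (\sum_(i <- r | P i) F i) = \sum_(i <- r | P i) act g (F i).
Proof. exact: (linear_sum (lact_lin g)). Qed.

End ActionTheory.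

Section MatrixAction.
Variables (k : fieldType) (gT : finGroupType) (W : vectType k) (act : gT -> W -> W).
Hypothesis hact : lin_action act.

(* Matrices act on row vectors from the right, hence the inverse. *)
Definition action_mx (g : gT) : 'M[k]_(dim W) :=
  lin1_mx (fun u => v2r (act g^-1%g (r2v u)) : 'rV_(dim W)).

Lemma mul_action_mx g u : u *m action_mx g = v2r (act g^-1%g (r2v u)).
Proof.
have lf : linear (fun u : 'rV[k]_(dim W) => v2r (act g^-1%g (r2v u)) : 'rV_(dim W)).
  by move=> c x y; rewrite linearP (lact_linear hact) linearP.
pose f : {linear 'rV[k]_(dim W) -> 'rV[k]_(dim W)} :=
  HB.pack (fun u : 'rV[k]_(dim W) => v2r (act g^-1%g (r2v u)) : 'rV_(dim W)) (GRing.isLinear.Build k _ _ _ _ lf).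
exact: (mul_rV_lin1 f).
Qed.

Lemma action_mx_repr : mx_repr [set: gT] action_mx.
Proof.
split=> [|g h _ _]; apply/row_matrixP=> i; rewrite !rowE ?mulmxA !mul_action_mx.
  by rewrite invg1 (lact1 hact) r2vK mulmx1.
by rewrite v2rK (lactM hact) invMg.
Qed.

Definition action_repr : mx_representation k [set: gT] (dim W) :=
  MxRepresentation action_mx_repr.

Lemma action_reprE g w : v2r w *m action_repr g = v2r (act g^-1%g w).
Proof. by rewrite mul_action_mx v2rK. Qed.

Lemma action_module_act m (U : 'M_(m, _)) w g :
  mxmodule action_repr U -> (v2r w <= U)%MS -> (v2r (act g w) <= U)%MS.
Proof.
move=> /mxmoduleP modU wU; rewrite -(invgK g) -action_reprE.
by apply: submx_trans (modU _ (in_setT _)); apply: submxMr.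
Qed.

End MatrixAction.

Section SpechtIrr.
Variables (k : fieldType) (s : nat).
Hypothesis char_k : [pchar k] =i pred0.

Lemma vsval_inj (V : vectType k) (U : {vspace V}) : injective (@vsval k V U).
Proof. exact: val_inj. Qed.

Lemma vsvalZ (V : vectType k) (U : {vspace V}) c (w : subvs_of U) :
  vsval (c *: w) = c *: vsval w.
Proof. by []. Qed.

Lemma vsvalD (V : vectType k) (U : {vspace V}) (v w : subvs_of U) :
  vsval (v + w) = vsval v + vsval w.
Proof. by []. Qed.

Lemma specht_lin_action la : lin_action (@specht_act k s la).
Proof.
split=> [g c u v|g h w|w]; last 2 first.
- exact: specht_actM.
- apply: val_inj; rewrite /= specht_actE; apply/ffunP=> f; rewrite !ffunE invg1.
  by congr (_ _); apply/ffunP=> a; rewrite ffunE perm1.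
by apply: vsval_inj; rewrite specht_actE !(vsvalD, vsvalZ) tabloid_act_linear !specht_actE.
Qed.

Definition specht_repr la := action_repr (specht_lin_action la).

Definition skap la t (w : specht k s la) : specht k s la :=
  \sum_(g | col_stab t g) (-1) ^+ g *: specht_act g w.

Lemma vsval_skap la t (w : specht k s la) : vsval (skap t w) = kap t (vsval w).
Proof.
rewrite linear_sum; apply: eq_bigr => g _.
by rewrite linearZ /= specht_actE.
Qed.

Definition spoly la t : specht k s la := vsproj _ (polytabloid k t).

Lemma vsval_spoly la t : is_tableau la t -> vsval (spoly la t) = polytabloid k t.
Proof. by move=> tt; rewrite vsprojK // memv_span // map_f // mem_enum. Qed.

Lemma spoly_neq0 la t : is_tableau la t -> spoly la t != 0.
Proof.
move=> tt; apply: contraNneq (polytabloid_neq0 k tt) => E.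
by rewrite -(vsval_spoly tt) E linear0.
Qed.

Lemma skap_spoly la t : is_tableau la t ->
  skap t (spoly la t) = (#|col_stab t|)%:R *: spoly la t.
Proof.
move=> tt; apply: vsval_inj; rewrite vsvalZ vsval_skap vsval_spoly // polytabloidE.
exact: kap_kap.
Qed.

Lemma skap_line la t w : is_partition_of la s -> is_tableau la t ->
  exists c, skap t w = c *: spoly la t.
Proof.
move=> hla tt; have [c E] := kap_specht char_k hla tt (subvsP w).
by exists c; apply: vsval_inj; rewrite vsvalZ vsval_skap vsval_spoly.
Qed.

(** The tableaux of one shape form a single orbit of the symmetric group, so a single polytabloid
    generates the Specht module. *)
Lemma spoly_gen la t (P : specht k s la -> Prop) : is_partition_of la s -> is_tableau la t ->
  P 0 -> (forall c u v, P u -> P v -> P (c *: u + v)) ->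
  (forall g w, P w -> P (specht_act g w)) -> P (spoly la t) -> forall w, P w.
Proof.
move=> hla tt P0 PD PG Pt w; rewrite -(vsvalK w).
apply: (@specht_ind k s la (fun v => P (vsproj _ v))) (subvsP w) => [|c u v Pu Pv|t' tt'].
- by rewrite linear0.
- by rewrite linearP; apply: PD.
have [g ->] := tableau_move hla tt tt'.
suff -> : vsproj (specht_space k s la) (polytabloid k (move_tableau g t)) = specht_act g (spoly la t).
  exact: PG.
by rewrite -tabloid_act_poly -(vsval_spoly tt).
Qed.

Lemma skap_module la t w m (U : 'M_(m, _)) : mxmodule (specht_repr la) U ->
  (v2r w <= U)%MS -> (v2r (skap t w) <= U)%MS.
Proof.
move=> modU wU; rewrite linear_sum; apply: summx_sub => g _.
by rewrite linearZ; apply: scalemx_sub; apply: action_module_act modU wU.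
Qed.

Lemma spoly_module la t m (U : 'M_(m, _)) : is_partition_of la s -> is_tableau la t ->
  mxmodule (specht_repr la) U -> (v2r (spoly la t) <= U)%MS -> row_full U.
Proof.
move=> hla tt modU tU; rewrite -sub1mx; apply/row_subP=> i; rewrite -[row _ _]r2vK.
move: (r2v _); apply: (spoly_gen hla tt) tU => [|c u v uU vU|g w wU].
- by rewrite linear0 sub0mx.
- by rewrite linearP addmx_sub // scalemx_sub.
exact: action_module_act modU wU.
Qed.

Lemma pchar'_group (gT : finGroupType) (G : {group gT}) : ([pchar k]%R^'.-group G)%g.
Proof. by apply/pgroupP=> p _ _; rewrite inE /= char_k. Qed.

(** Split a polytabloid along a submodule and a Maschke complement. The signed column sum sends both
    components into the line of the polytabloid, with coefficients adding up to the order of the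
    column stabilizer. One of them is nonzero, so that summand contains the polytabloid and is
    everything. *)
Lemma specht_irreducible la : is_partition_of la s -> mx_irreducible (specht_repr la).
Proof.
move=> hla; have [t tt] := exists_tableau hla.
apply/mx_irrP; split=> [|U modU U0].
  rewrite lt0n; apply: contraNneq (spoly_neq0 tt) => d0.
  apply/eqP/v2r_inj; rewrite linear0; apply/rowP=> -[j lt]; exfalso.
  by move: lt; rewrite d0.
have [U' modU' dU dxU] := mx_Maschke_pchar (specht_repr la) (pchar'_group _) modU (submx1 _).
have /sub_addsmxP[[u u'] /= Eu] : (v2r (spoly la t) <= U + U')%MS by rewrite dU submx1.
pose w := r2v (u *m U); pose w' := r2v (u' *m U').
have Ew : spoly la t = w + w'.
  by apply: v2r_inj; rewrite Eu linearD; congr (_ + _); exact/esym/r2vK.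
have [c Ec] := skap_line w hla tt; have [c' Ec'] := skap_line w' hla tt.
have lk : linear (@skap la t).
  move=> e x y; apply: vsval_inj; rewrite vsvalD vsvalZ !vsval_skap vsvalD vsvalZ.
  exact: kap_linear.
have Ecc : c + c' = (#|col_stab t|)%:R.
  have /eqP := skap_spoly tt.
  have -> : skap t (spoly la t) = skap t w + skap t w'.
    by rewrite Ew; have := lk 1 w w'; rewrite !scale1r.
  rewrite Ec Ec' -scalerDl -subr_eq0 -scalerBl scaler_eq0 (negPf (spoly_neq0 tt)) orbF.
  by rewrite subr_eq0 => /eqP.
have inU (V : 'M_(dim (specht k s la))) x e : mxmodule (specht_repr la) V ->
    (v2r x <= V)%MS -> skap t x = e *: spoly la t -> e != 0 -> row_full V.
  move=> modV xV Ex e0; apply: (spoly_module hla tt modV).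
  have -> : spoly la t = e^-1 *: skap t x by rewrite Ex scalerA mulVf ?scale1r.
  by rewrite linearZ scalemx_sub // skap_module.
have [c0|/eqP] := eqVneq c 0; last first.
  by move/eqP/(inU _ _ _ modU _ Ec); apply; rewrite r2vK submxMl.
have c'0 : c' != 0 by move: Ecc; rewrite c0 add0r => ->; exact: card_col_stab_neq0.
have := inU _ _ _ modU' _ Ec' c'0; rewrite r2vK submxMl => /(_ isT) fU'.
move/mxdirect_addsP: dxU => dx; case/eqP: U0.
apply/eqP; rewrite -submx0 -dx sub_capmx submx_refl /=; exact: submx_full.
Qed.

(** An isomorphism commutes with the signed column sum, which does not kill the polytabloid of its
    own shape; so it is nonzero on the other Specht module too, and this forces dominance. The
    inverse isomorphism gives the opposite inequality. *)
Lemma specht_rsim la mu : is_partition_of la s -> is_partition_of mu s ->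
  mx_rsim (specht_repr la) (specht_repr mu) -> la = mu.
Proof.
have key l m : is_partition_of l s -> is_partition_of m s ->
    mx_rsim (specht_repr l) (specht_repr m) ->
    forall r, (\sum_(j < s | j < r) nth 0%N m j <= \sum_(j < s | j < r) nth 0%N l j)%N.
  move=> hl hm [B Bd Bf BG]; have [t tt] := exists_tableau hl.
  pose h (x : specht k s l) : specht k s m := r2v (v2r x *m B).
  have hG g x : h (specht_act g x) = specht_act g (h x).
    rewrite /h -[g]invgK -(action_reprE (specht_lin_action l)) -mulmxA BG ?inE //.
    by rewrite mulmxA mul_action_mx ?v2rK //; exact: specht_lin_action.
  have hkap x : h (skap t x) = skap t (h x).
    rewrite /h linear_sum mulmx_suml linear_sum; apply: eq_bigr => g _.
    by rewrite linearZ -scalemxAl linearZ; congr (_ *: _); exact: hG.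
  have h0 : h (spoly l t) != 0.
    apply: contraNneq (spoly_neq0 tt) => E; apply/eqP/v2r_inj; rewrite linear0.
    apply: (row_free_inj Bf); rewrite mul0mx.
    by apply: (can_inj r2vK); rewrite linear0; exact: E.
  apply: (kap_specht_dominance char_k hl hm tt (subvsP (h (spoly l t)))).
  rewrite -vsval_skap -hkap skap_spoly // /h linearZ /= -scalemxAl linearZ vsvalZ.
  by rewrite scaler_eq0 (negPf (card_col_stab_neq0 _ _)) //=.
move=> hla hmu sim; apply: (dominance_anti hla hmu) => r; apply/eqP.
by rewrite eqn_leq key // key //; exact: mx_rsim_sym.
Qed.

End SpechtIrr.

Section SpechtComplete.
Variables (k : closedFieldType) (s : nat).
Hypothesis char_k : [pchar k] =i pred0.

Lemma cycle_type_partition (g : 'S_s) : is_partition_of (cycle_type g) s.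
Proof. by rewrite /is_partition_of cycle_type_sorted cycle_type_neq0 sumn_cycle_type card_ord /=. Qed.

(* There are as many irreducible representations as conjugacy classes, that is,
   as cycle types, and the Specht modules are irreducible and pairwise non
   isomorphic. *)
Lemma irreducible_specht n (rG : mx_representation k [set: 'S_s] n) :
  mx_irreducible rG -> exists2 la, is_partition_of la s & mx_rsim rG (specht_repr k s la).
Proof.
move=> irrG; pose G := [set: 'S_s]%G.
pose sG : irrType k G := DecSocleType (regular_repr k G).
have k'G := pchar'_group char_k G.
pose iota (g : 'S_s) : sG := irr_comp sG (specht_repr k s (cycle_type g)).
have irr g := specht_irreducible char_k (cycle_type_partition g).
have iotaP g h : iota g = iota h -> exists x, (g ^ x)%g = h.
  move=> E; apply/cycle_type_conj.
  apply: (specht_rsim char_k); try exact: cycle_type_partition.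
  apply: mx_rsim_trans (rsim_irr_comp_pchar sG k'G (irr g)) _.
  have := mx_rsim_sym (rsim_irr_comp_pchar sG k'G (irr h)).
  by rewrite -/(iota g) -/(iota h) E.
have clE C : C \in classes G -> C = (repr C ^: G)%g.
  move=> /imsetP[x _ ->]; apply: class_eqP.
  by rewrite class_sym; apply: mem_repr (class_refl G x).
have finj : {in classes G &, injective (fun C => iota (repr C))}.
  move=> C D /clE EC /clE ED /iotaP[x Ex]; rewrite EC ED -Ex.
  by rewrite classGidl // inE.
have im : (fun C => iota (repr C)) @: classes G = [set: sG].
  apply/eqP; rewrite eqEcard subsetT card_in_imset // cardsT.
  by rewrite (card_irr_pchar sG k'G (@group_closure_closed_field k _ _)) leqnn.
have /imsetP[C _ EC] : irr_comp sG rG \in (fun C => iota (repr C)) @: classes G.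
  by rewrite im inE.
exists (cycle_type (repr C)); first exact: cycle_type_partition.
apply: mx_rsim_trans (rsim_irr_comp_pchar sG k'G irrG) _.
rewrite EC; apply: mx_rsim_sym; exact: rsim_irr_comp_pchar.
Qed.

(** An irreducible constituent is found as a submodule, and the projection along a Maschke
    complement turns it into a quotient, the form needed to peel a filtration from the top. *)
Lemma specht_quotient (W : vectType k) (act : 'S_s -> W -> W) (w0 : W) :
  lin_action act -> w0 != 0 ->
  exists la, is_partition_of la s /\ exists p : W -> specht k s la,
    [/\ linear p, forall g w, p (act g w) = specht_act g (p w) & forall y, exists w, p w = y].
Proof.
move=> hact w00; pose rW := action_repr hact.
have dW : (1%:M : 'M[k]_(dim W)) != 0.
  apply: contraNneq w00 => E; apply/eqP/v2r_inj.
  by rewrite -[v2r w0]mulmx1 E mulmx0 linear0.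
have [M simM _] := dec_mxsimple_exists (mxmodule1 rW) dW.
have [modM _ _] := simM.
have [N modN defMN dxMN] := mx_Maschke_pchar rW (pchar'_group char_k _) modM (submx1 _).
have [la hla [B dB fB hB]] := irreducible_specht ((submod_mx_irr modM).2 simM).
exists la; split=> //; pose q := proj_mx M N.
have /mxdirect_addsP dx := dxMN.
have qG x (u : 'rV_(dim W)) : u *m rW x *m q = u *m q *m rW x.
  have /hom_mxP/(_ x (in_setT _)) : (u <= dom_hom_mx rW q)%MS.
    apply: submx_trans (proj_mx_hom dx modM modN).
    by rewrite defMN submx1.
  by move=> <-.
exists (fun w => r2v (in_submod M (v2r w *m q) *m B)); split.
- move=> c u v; rewrite linearP mulmxDl -scalemxAl linearP mulmxDl -scalemxAl.
  by rewrite linearP.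
- move=> g w; apply: v2r_inj; rewrite r2vK -{1}[g]invgK -(action_reprE hact) qG.
  rewrite -[g in RHS]invgK -(action_reprE (specht_lin_action k s la)) r2vK.
  rewrite in_submodJ ?inE ?proj_mx_sub // -mulmxA hB ?inE //.
  by rewrite mulmxA.
move=> y; have [B' BB'] : exists B', B' *m B = 1%:M.
  by apply/row_fullP; rewrite /row_full -[X in _ == X]dB.
exists (r2v (val_submod (v2r y *m B'))); rewrite r2vK proj_mx_id ?val_submodP //.
by rewrite val_submodK -mulmxA BB' mulmx1 v2rK.
Qed.

End SpechtComplete.

(** * Filtrations by standard modules *)

Definition lin_closed (R : nzRingType) (V : lmodType R) (P : V -> Prop) : Prop :=
  P 0 /\ forall c u v, P u -> P v -> P (c *: u + v).

Definition prop_pred (V : Type) (P : V -> Prop) : {pred V} := [pred v | `[< P v >]].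

Lemma prop_pred_closed (R : nzRingType) (V : lmodType R) (P : V -> Prop) :
  lin_closed P -> submod_closed (prop_pred P).
Proof.
case=> P0 PD; split=> [|c u v /asboolP Pu /asboolP Pv]; apply/asboolP => //.
exact: PD.
Qed.

Definition mk_submod (R : nzRingType) (V : lmodType R) (P : V -> Prop) (h : lin_closed P) :
    submodClosed V :=
  HB.pack_for (submodClosed V) (prop_pred P)
    (GRing.isSubmodClosed.Build R V (prop_pred P) (prop_pred_closed h)).

Lemma mk_submodP (R : nzRingType) (V : lmodType R) (P : V -> Prop) (h : lin_closed P) v :
  reflect (P v) (v \in mk_submod h).
Proof. exact: asboolP. Qed.

Lemma linear_facts (k : nzRingType) (U V : lmodType k) (f : U -> V) : linear f ->
  [/\ f 0 = 0, forall u v, f (u + v) = f u + f v, forall c u, f (c *: u) = c *: f u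
    & forall u v, f (u - v) = f u - f v].
Proof.
move=> lf; pose g : {linear U -> V} := HB.pack f (GRing.isLinear.Build k U V _ f lf).
by split=> *; [exact: (linear0 g)|exact: (linearD g)|exact: (linearZ_LR g)|exact: (linearB g)].
Qed.

(* True of every C over a field; only finite-dimensional C occur below, which avoids
   choosing bases of arbitrary spaces. *)
Definition kproj (k : fieldType) (C : lmodType k) : Prop :=
  forall (B : lmodType k) (g : B -> C), linear g -> (forall c, exists b, g b = c) ->
  exists2 s : C -> B, linear s & forall c, g (s c) = c.

(** Lift the images under [p] of a basis of [V], extend linearly, and precompose with [q]. *)
Lemma retract_kproj (k : fieldType) (C : lmodType k) (V : vectType k) (p : V -> C) (q : C -> V) :
  linear p -> linear q -> (forall c, p (q c) = c) -> kproj C.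
Proof.
move=> lp lq pq B g lg surj.
pose b i := (vbasis (fullv : {vspace V}))`_i.
have [t tP] := choice (fun i : 'I_(\dim (fullv : {vspace V})) => surj (p (b i))).
have [g0 gD gZ _] := linear_facts lg; have [p0 pD pZ _] := linear_facts lp.
exists (fun c => \sum_i coord (vbasis fullv) i (q c) *: t i).
  move=> c u v; rewrite lq scaler_sumr -big_split; apply: eq_bigr => i _.
  by rewrite linearP scalerDl scalerA.
move=> c; rewrite (big_morph g gD g0) -[RHS]pq {2}(coord_vbasis (memvf (q c))).
by rewrite (big_morph p pD p0); apply: eq_bigr => i _; rewrite gZ pZ tP.
Qed.

Section Reps.
Variables (k : fieldType) (n : nat) (x : k).
Implicit Types (A B C : diag_rep n x).

Record drhom A B (f : dr_space A -> dr_space B) : Prop := DrHom {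
  hom_lin : linear f;
  hom_act : forall d v, f (dr_act d v) = dr_act d (f v) }.

Record short_exact A B C (f : dr_space A -> dr_space B) (g : dr_space B -> dr_space C) : Prop :=
  ShortExact {
    se_f : drhom f;
    se_g : drhom g;
    se_inj : injective f;
    se_surj : forall c, exists b, g b = c;
    se_ker : forall b, g b = 0 -> exists a, b = f a;
    se_zero : forall a, g (f a) = 0 }.

(** Filtrations as iterated extensions with a standard module on top. Arbitrary short exact
    sequences are allowed instead of chains of submodules, so that closure under isomorphism,
    extension and tensor product goes by induction; [filt_has] and [has_filt] translate. *)
Inductive filt : diag_rep n x -> Prop :=
| filt_nil A : (forall v : dr_space A, v = 0) -> filt A
| filt_cons A B (i : 'I_n.+1) la (f : dr_space A -> dr_space B) (g : dr_space B -> dr_space (standard_rep x i la)) :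
    is_partition_of la i -> short_exact f g -> filt A -> filt B.

Lemma drhom_comp A B C (f : dr_space A -> dr_space B) (g : dr_space B -> dr_space C) :
  drhom f -> drhom g -> drhom (g \o f).
Proof.
move=> [lf af] [lg ag]; split; first exact: comp_linear.
by move=> d v /=; rewrite af ag.
Qed.

Section SubRep.
Variables (A : diag_rep n x) (P : dr_space A -> Prop).
Hypotheses (hP : lin_closed P) (aP : forall d v, P v -> P (dr_act d v)).

Definition sub_space : lmodType k := submodule (mk_submod hP).

Lemma sub_spaceP (v : sub_space) : P (\val v).
Proof. exact/mk_submodP/valP. Qed.

Definition sub_in (v : dr_space A) (Pv : P v) : sub_space :=
  exist _ v (introT (mk_submodP hP v) Pv).

Lemma sub_inE v (Pv : P v) : \val (sub_in Pv) = v.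
Proof. by []. Qed.

Definition sub_act (d : pdiag n) (v : sub_space) : sub_space := sub_in (aP d (sub_spaceP v)).

Lemma sub_valP c (u v : sub_space) : \val (c *: u + v) = c *: \val u + \val v.
Proof. by []. Qed.

Lemma sub_valZ c (u : sub_space) : \val (c *: u) = c *: \val u.
Proof. by []. Qed.

Lemma sub_act_linear d : linear (sub_act d).
Proof. by move=> c u v; apply: val_inj; rewrite sub_valP !sub_inE sub_valP dr_linear. Qed.

Lemma sub_act1 v : sub_act (idd n) v = v.
Proof. by apply: val_inj; rewrite sub_inE dr_act1. Qed.

Lemma sub_actM d e v : sub_act d (sub_act e v) = x ^+ dloops d e *: sub_act (dmul d e) v.
Proof. by apply: val_inj; rewrite sub_valZ !sub_inE dr_actM. Qed.

Definition sub_rep : diag_rep n x := DiagRep sub_act_linear sub_act1 sub_actM.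

Lemma sub_rep_val : @drhom sub_rep A (fun v : sub_space => \val v).
Proof. by split. Qed.

End SubRep.

Lemma filt_iso A B (h : dr_space A -> dr_space B) : drhom h -> injective h ->
  (forall b, exists a, h a = b) -> filt A -> filt B.
Proof.
move=> hh hi hs fA; have [h' hK] := choice hs.
have h'K a : h' (h a) = a by apply: hi; rewrite hK.
have hh' : drhom h'.
  split=> [c u v|d v]; apply: hi; first by rewrite (hom_lin hh) !hK.
  by rewrite (hom_act hh) !hK.
case: fA h hh hi hs h' hK h'K hh' => {A} [A A0|A' A i la f g hla se fA'] h hh hi hs h' hK h'K hh'.
  apply: filt_nil => v; rewrite -(hK v) (A0 (h' v)).
  by have [] := linear_facts (hom_lin hh).
apply: (@filt_cons A' B i la (h \o f) (g \o h')) => //.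
case: se => hf hg fi gs gk gf; split.
- exact: drhom_comp.
- exact: drhom_comp.
- by move=> u v /hi/fi.
- by move=> c; have [b <-] := gs c; exists (h b); rewrite /= h'K.
- by move=> b /= /gk[a E]; exists a; rewrite /= -E hK.
- by move=> a; rewrite /= h'K.
Qed.

(** By induction on the filtration of the quotient: the preimage in [B] of the kernel of the top
    standard quotient of [C] is again an extension by [A], with a shorter quotient. *)
Lemma filt_exact A B C (f : dr_space A -> dr_space B) (g : dr_space B -> dr_space C) :
  short_exact f g -> filt A -> filt C -> filt B.
Proof.
move=> se fA fC; elim: fC B f g se => {C} [C C0|C' C i la f' g' hla se' fC' IH] B f g se.
  apply: (filt_iso (se_f se) (se_inj se)) fA => b.
  by have [a ->] := se_ker se (C0 (g b)); exists a.
have hgg := drhom_comp (se_g se) (se_g se').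
have [gg0 _ _ _] := linear_facts (hom_lin hgg).
pose P b := (g' \o g) b = 0.
have hP : lin_closed P.
  by split=> // c u v Pu Pv; rewrite /P (hom_lin hgg) Pu Pv scaler0 addr0.
have act0 d : dr_act d (0 : dr_space (standard_rep x i la)) = 0.
  by have [] := linear_facts (@dr_linear _ _ _ (standard_rep x i la) d).
have aP d v : P v -> P (dr_act d v).
  by rewrite /P (hom_act hgg) => ->; exact: act0.
pose B0 := sub_rep hP aP.
have Pf a : P (f a).
  by rewrite /P /= (se_zero se); have [] := linear_facts (hom_lin (se_g se')).
have H (b : dr_space B0) : exists a, g (\val b) = f' a.
  by apply: (se_ker se'); exact: (sub_spaceP b).
have [g0 g0P] := choice H.
have fB0 : filt B0.
  apply: (IH B0 (fun a => sub_in hP (Pf a)) g0); split.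
  - split=> [c u v|d v]; apply: val_inj; first exact: (hom_lin (se_f se)).
    exact: (hom_act (se_f se)).
  - split=> [c u v|d v]; apply: (se_inj se').
      rewrite (hom_lin (se_f se')) -!g0P; exact: (hom_lin (se_g se)).
    rewrite (hom_act (se_f se')) -!g0P; exact: (hom_act (se_g se)).
  - by move=> u v /(congr1 val)/(se_inj se).
  - move=> c; have [b Eb] := se_surj se (f' c).
    have Pb : P b by rewrite /P /= Eb; exact: (se_zero se').
    by exists (sub_in hP Pb); apply: (se_inj se'); rewrite -g0P.
  - move=> b g0b; have : g (\val b) = 0.
      by rewrite g0P g0b; have [] := linear_facts (hom_lin (se_f se')).
    by case/(se_ker se) => a Ea; exists a; apply: val_inj; rewrite sub_inE.
  move=> a; apply: (se_inj se'); rewrite -g0P sub_inE (se_zero se).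
  by have [->] := linear_facts (hom_lin (se_f se')).
apply: (@filt_cons B0 B i la (fun b : dr_space B0 => \val b) (g' \o g)) => //; split=> //.
- exact: val_inj.
- move=> c; have [c' <-] := se_surj se' c; have [b <-] := se_surj se c'.
  by exists b.
- by move=> b Pb; exists (sub_in hP Pb).
exact: sub_spaceP.
Qed.

End Reps.

(** * Comparison with filtrations by submodules *)

Section Subquotient.
Variables (R : nzRingType) (V S : lmodType R) (F G : submodClosed V).

(** With [subquotient_to], this trades a map out of a subquotient for a function on the ambient
    module of which only the values on [F] matter, so that no dependent types remain when the chain
    is transported. *)
Lemma subquotient_of (h : V -> S) :
  (forall c u v, u \in F -> v \in F -> h (c *: u + v) = c *: h u + h v) ->
  (forall s, exists2 v, v \in F & h v = s) ->
  (forall v, v \in F -> h v = 0 <-> v \in G) ->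
  exists f : {linear subquotient F G -> S}, bijective f.
Proof.
move=> lh sh kh; pose hF (v : submodule F) := h (\val v).
have lF : linear hF by move=> c u v; apply: lh; exact: valP.
have [hF0 _ _ hFB] := linear_facts lF.
have hFE (u v : submodule F) : to_quot (relative F G) u = to_quot (relative F G) v <-> hF u = hF v.
  split=> [/to_quot_eqP|E].
    by rewrite !inE => /(kh _ (valP _)).2/eqP; rewrite -/(hF (u - v)) hFB subr_eq0 => /eqP.
  by apply/to_quot_eqP; rewrite !inE; apply/(kh _ (valP _)).1; rewrite -/(hF (u - v)) hFB E subrr.
have [r rP] := choice (@to_quot_surj _ _ (relative F G)).
pose f (q : subquotient F G) := hF (r q).
have fE v : f (to_quot (relative F G) v) = hF v by apply/hFE; rewrite -rP.
have lf : linear f.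
  move=> c q q'; rewrite {1}(rP q) {1}(rP q') -linearP fE; exact: lF.
exists (HB.pack f (GRing.isLinear.Build R _ _ _ f lf) : {linear subquotient F G -> S}).
have [t tP] := choice (fun s => let: ex_intro2 v Fv E := sh s in
   ex_intro (fun w : submodule F => hF w = s) (exist _ v Fv) E).
exists (fun s => to_quot (relative F G) (t s)) => [q|s] /=; last by rewrite fE.
by rewrite [RHS]rP; apply/hFE; rewrite tP.
Qed.

Lemma subquotient_to (f : {linear subquotient F G -> S}) : bijective f ->
  exists h : V -> S,
  [/\ forall c u v, u \in F -> v \in F -> h (c *: u + v) = c *: h u + h v,
     forall s, exists2 v, v \in F & h v = s &
     forall v, v \in F -> h v = 0 <-> v \in G].
Proof.
move=> [f' fK f'K]; pose i v : submodule F := insubd 0 v.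
have iE v : v \in F -> \val (i v) = v by move=> Fv; rewrite val_insubd Fv.
exists (fun v => f (to_quot (relative F G) (i v))); split.
- move=> c u v Fu Fv; have Fw : c *: u + v \in F by rewrite rpredD // rpredZ.
  rewrite -!linearP; congr (f (to_quot _ _)); apply: val_inj.
  apply: etrans (iE _ Fw) _; apply/esym; rewrite -[in RHS](iE _ Fu) -[in RHS](iE _ Fv).
  exact: linearP.
- move=> s; have [w Ew] := to_quot_surj (f' s); exists (\val w); first exact: valP.
  by rewrite -[RHS]f'K Ew; congr (f (to_quot _ _)); apply: val_inj; exact: iE (valP w).
move=> v Fv; have -> : (v \in G) = (i v \in relative F G) by rewrite !inE iE.
rewrite -to_quot_eq0; split=> [E|/eqP->]; last by rewrite linear0.
by apply/eqP/(can_inj fK); rewrite linear0.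
Qed.

End Subquotient.

Section Conversion.
Variables (k : fieldType) (n : nat) (x : k).

Lemma drhom_scale (A B : diag_rep n x) (f : dr_space A -> dr_space B) : drhom f ->
  forall (u : partalg n x) (v : rep_mod A), f (u *: v) = u *: (f v : rep_mod B).
Proof.
move=> hf u v; have [f0 fD fZ _] := linear_facts (hom_lin hf).
rewrite [LHS](big_morph f fD f0); apply: eq_bigr => d _.
by rewrite fZ (hom_act hf).
Qed.

Lemma rep_scale_alg (A : diag_rep n x) (c : k) (v : rep_mod A) :
  (c%:A : partalg n x) *: v = c *: (v : dr_space A) :> dr_space A.
Proof.
rewrite [LHS](rep_scaleZ c 1 v); congr (_ *: _); exact: (scale1r (v : rep_mod A)).
Qed.

Lemma filt_has (A : diag_rep n x) : filt A -> has_standard_filtration (rep_mod A).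
Proof.
elim=> {A} [A A0|A B i la f g hla se fA [m [F [F0 Fm Fs]]]].
  have h : lin_closed (fun v : rep_mod A => v = 0).
    by split=> // c u v -> ->; rewrite scaler0 addr0.
  exists 0%N, (fun=> mk_submod h); split=> // v; first by apply/mk_submodP/eqP.
  by rewrite (introT (mk_submodP h v) (A0 v)).
have hf (u : partalg n x) (v : rep_mod A) := drhom_scale (se_f se) u v.
have hg (u : partalg n x) (v : rep_mod B) := drhom_scale (se_g se) u v.
have [f0 fD _ _] := linear_facts (hom_lin (se_f se)).
have [g0 gD _ _] := linear_facts (hom_lin (se_g se)).
(* Up to index [m] the terms are the images of the terms of [A]; the other alternative makes every
   later term the whole of [B]. *)
have hF j : lin_closed (fun b : rep_mod B => (m < j)%N \/ exists2 a : rep_mod A, a \in F j & b = f a).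
  split=> [|c u v [mj|[a Fa ->]] [mj'|[a' Fa' ->]]]; try by left.
    by right; exists 0; rewrite ?rpred0 // f0.
  right; exists (c *: a + a'); first by rewrite rpredD ?rpredZ.
  by rewrite [RHS]fD -hf.
exists m.+1, (fun j => mk_submod (hF j)); split.
- move=> b; apply/mk_submodP/eqP => [[//|[a]]|->].
    by rewrite F0 => /eqP-> ->; exact: f0.
  by right; exists 0; rewrite ?rpred0 // f0.
- by move=> b; rewrite (introT (mk_submodP (hF m.+1) b)) //; left.
move=> j; rewrite ltnS leq_eqVlt => /predU1P[->|lt].
  split=> [b _|]; first by apply/mk_submodP; left.
  exists i, la; split=> //.
  apply: (@subquotient_of _ (rep_mod B) (standard x i la) (mk_submod (hF m.+1)) (mk_submod (hF m)) g).
  - by move=> c u v _ _; rewrite [LHS]gD hg.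
  - by move=> s; have [b <-] := se_surj se s; exists b => //; apply/mk_submodP; left.
  move=> b _; split=> [/(se_ker se)[a ->]|/mk_submodP[|[a _ ->]]].
  - by apply/mk_submodP; right; exists a; rewrite ?Fm.
  - by rewrite ltnn.
  exact: (se_zero se).
have [sF [i' [la' [hla' [p /subquotient_to[h [lh sh kh]]]]]]] := Fs j lt.
split=> [b /mk_submodP[|[a Fa ->]]|].
- by rewrite ltnNge ltnW.
- by apply/mk_submodP; right; exists a; rewrite ?sF.
exists i', la'; split=> //.
(* A left inverse of [f] on all of [B], with value 0 off the image, carries the layer functions of
   [A] over to [B]. *)
have [t tP] : exists t, forall a, t (f a) = a.
  have [b|t tP] := choice (_ : forall b, exists a, forall a', b = f a' -> a = a').
    have [[a ->]|nf] := pselect (exists a, b = f a).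
      by exists a => a' /(se_inj se).
    by exists 0 => a' E; case: nf; exists a'.
  by exists t => a; apply: tP.
have inF j' b : (j' <= m)%N -> b \in mk_submod (hF j') -> exists2 a : rep_mod A, a \in F j' & b = f a.
  by move=> le /mk_submodP[|//]; rewrite ltnNge le.
apply: (@subquotient_of _ (rep_mod B) (standard x i' la') (mk_submod (hF j.+1)) (mk_submod (hF j))
  (fun b => h (t b))).
- move=> c u v /(inF _ _ lt)[a Fa ->] /(inF _ _ lt)[a' Fa' ->].
  by rewrite -hf -[_ + _]fD !tP lh.
- move=> s; have [a Fa <-] := sh s; exists (f a); last by rewrite tP.
  by apply/mk_submodP; right; exists a.
move=> b /(inF _ _ lt)[a Fa ->]; rewrite tP kh //; split=> [Ga|].
  by apply/mk_submodP; right; exists a.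
by case/(inF _ _ (ltnW lt)) => a' Ga' /(se_inj se)->.
Qed.

(** Transparent, since its space has to compute to [kmod X]. *)
Definition mod_rep (X : lmodType (partalg n x)) : diag_rep n x.
Proof.
apply: (@DiagRep k n x (kmod X) (fun d => kmod_act (dbasis x d))).
- by move=> d; exact: kmod_act_linear.
- by move=> v; rewrite dbasis1 kmod_act1.
by move=> d e v; rewrite kmod_actM dbasisM kmod_actZ.
Defined.

Lemma has_filt (X : lmodType (partalg n x)) : has_standard_filtration X -> filt (mod_rep X).
Proof.
case=> m [F [F0 Fm Fs]].
have hP j : lin_closed (fun v : kmod X => (v : X) \in F j).
  split=> [|c u v Fu Fv]; first exact: rpred0.
  by rewrite rpredD // kmod_scaleE rpredZ.
have aP j d (v : dr_space (mod_rep X)) : (v : X) \in F j -> (dr_act d v : X) \in F j.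
  by move=> Fv; exact: rpredZ.
pose FR j := @sub_rep k n x (mod_rep X) _ (hP j) (aP j).
pose mkF j (v : X) (Fv : v \in F j) : dr_space (FR j) := @sub_in k n x (mod_rep X) _ (hP j) v Fv.
have fF j : (j <= m)%N -> filt (FR j).
  elim: j => [_|j IH lt].
    apply: filt_nil => v; apply: val_inj; apply/eqP.
    by have := sub_spaceP v; rewrite F0 inE.
  have [sF [i [la [hla [p /subquotient_to[h [lh sh kh]]]]]]] := Fs j lt.
  pose f (v : dr_space (FR j)) : dr_space (FR j.+1) := @mkF j.+1 _ (sF _ (sub_spaceP v)).
  pose g (v : dr_space (FR j.+1)) : dr_space (standard_rep x i la) := h (\val v).
  apply: (@filt_cons _ _ _ (FR j) (FR j.+1) i la f g hla); last exact/IH/ltnW.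
  have h0 : h 0 = 0 by apply/(kh _ (rpred0 _)).2; exact: rpred0.
  split.
  - by split=> [c u v|d v]; apply: val_inj.
  - split=> [c u v|d v].
      have := lh c%:A (\val u) (\val v) (sub_spaceP u) (sub_spaceP v).
      by rewrite /g => ->; congr (_ + _); exact: (@rep_scale_alg (standard_rep x i la)).
    have := lh (dbasis x d) (\val v) 0 (sub_spaceP v) (rpred0 _).
    rewrite addr0 h0 addr0 => E; apply: (etrans E).
    exact: (@rep_scale_basis _ _ _ (standard_rep x i la)).
  - by move=> u v /(congr1 val) E; apply: val_inj.
  - by move=> s; have [v Fv <-] := sh s; exists (mkF _ _ Fv).
  - move=> b /(kh _ (sub_spaceP b)) Gb; exists (mkF _ _ Gb); exact: val_inj.
  move=> a; apply/(kh _ (sub_spaceP (f a))); exact: (sub_spaceP a).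
apply: (@filt_iso _ _ _ (FR m) (mod_rep X) (fun v => \val v)); last exact: fF.
- exact: sub_rep_val.
- exact: val_inj.
move=> v; have Fv : (v : X) \in F m by rewrite Fm.
by exists (mkF _ _ Fv).
Qed.

End Conversion.

(** * Tensor products over the field *)

Section VTensor.
Variable k : fieldType.
Implicit Types U V W : lmodType k.

Definition scal V : k -> V -> V := fun c v => c *: v.

Definition bilin V W U (f : V -> W -> U) : Prop :=
  (forall w, linear (f^~ w)) /\ (forall v, linear (f v)).

Lemma bilin_balanced V W U (f : V -> W -> U) : bilin f -> balanced (@scal V) (@scal W) f.
Proof.
case=> lf lf'.
have L w := linear_facts (lf w); have L' v := linear_facts (lf' v).
split=> [v v' w|v w w'|c v w|c v w|c v w].
- by case: (L w).
- by case: (L' v).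
- by case: (L w).
- by case: (L' v).
by rewrite /scal; case: (L w) => _ _ -> _; case: (L' v) => _ _ -> _.
Qed.

Lemma scal_tmk_bilin V W : bilin (tmk (@scal V) (@scal W)).
Proof.
have [Dl Dr Zl Zr _] := tmk_balanced (@scal V) (@scal W).
by split=> [w c v v'|v c w w']; rewrite ?Dl ?Dr ?Zl ?Zr.
Qed.

(* Opaque on purpose: it keeps conversion tests from unfolding the quotient. *)
Lemma vtens_subproof V W :
  {T : lmodType k & {tm : V -> W -> T & {lift : forall U, (V -> W -> U) -> T -> U |
    [/\ bilin tm,
       forall U (f : V -> W -> U), bilin f -> linear (lift U f) /\ forall v w, lift U f (tm v w) = f v w
     & forall U (f g : T -> U), linear f -> linear g ->
         (forall v w, f (tm v w) = g (tm v w)) -> f =1 g]}}}.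
Proof.
exists (tens (@scal V) (@scal W) : lmodType k), (tmk (@scal V) (@scal W)).
exists (fun U f => @tens_lift _ _ _ _ (@scal V) (@scal W) U f); split.
- exact: scal_tmk_bilin.
- move=> U f bf; split; first exact: tens_lift_is_linear (bilin_balanced bf).
  by move=> v w; exact: tens_liftE (bilin_balanced bf) v w.
move=> U f g; exact: tens_ext.
Qed.

Definition vtens V W : lmodType k := projT1 (vtens_subproof V W).

Definition tm V W : V -> W -> vtens V W := projT1 (projT2 (vtens_subproof V W)).

Definition vlift V W U (f : V -> W -> U) : vtens V W -> U :=
  proj1_sig (projT2 (projT2 (vtens_subproof V W))) U f.

Lemma tm_bilin V W : bilin (@tm V W).
Proof. by case: (proj2_sig (projT2 (projT2 (vtens_subproof V W)))). Qed.

Lemma vliftE V W U (f : V -> W -> U) : bilin f -> forall v w, vlift f (tm v w) = f v w.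
Proof.
by case: (proj2_sig (projT2 (projT2 (vtens_subproof V W)))) => _ H _ /H[].
Qed.

Lemma vlift_linear V W U (f : V -> W -> U) : bilin f -> linear (vlift f).
Proof.
by case: (proj2_sig (projT2 (projT2 (vtens_subproof V W)))) => _ H _ /H[].
Qed.

Lemma vtens_ext V W U (f g : vtens V W -> U) : linear f -> linear g ->
  (forall v w, f (tm v w) = g (tm v w)) -> f =1 g.
Proof.
by case: (proj2_sig (projT2 (projT2 (vtens_subproof V W)))) => _ _; apply.
Qed.

Lemma bilin_comp V W V' W' U (f : V -> V') (g : W -> W') (h : V' -> W' -> U) :
  linear f -> linear g -> bilin h -> bilin (fun v w => h (f v) (g w)).
Proof.
move=> lf lg [hl hr]; split=> [w c v v'|v c w w'].
  by rewrite lf (hl (g w)).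
by rewrite lg (hr (f v)).
Qed.

Definition tmap V W V' W' (f : V -> V') (g : W -> W') : vtens V W -> vtens V' W' :=
  vlift (fun v w => tm (f v) (g w)).

Section TMap.
Variables (V W V' W' : lmodType k) (f : V -> V') (g : W -> W').
Hypotheses (lf : linear f) (lg : linear g).

Lemma tmapE v w : tmap f g (tm v w) = tm (f v) (g w).
Proof. by rewrite /tmap vliftE //; exact: bilin_comp lf lg (tm_bilin _ _). Qed.

Lemma tmap_linear : linear (tmap f g).
Proof. exact/vlift_linear/bilin_comp/tm_bilin. Qed.

End TMap.

Lemma tmap_comp V W V' W' V'' W'' (f : V -> V') (g : W -> W') (f' : V' -> V'') (g' : W' -> W'') :
  linear f -> linear g -> linear f' -> linear g' ->
  forall t, tmap f' g' (tmap f g t) = tmap (f' \o f) (g' \o g) t.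
Proof.
move=> lf lg lf' lg'; apply: vtens_ext => [||v w].
- exact: comp_linear (tmap_linear lf' lg') (tmap_linear lf lg).
- exact: tmap_linear (comp_linear lf' lf) (comp_linear lg' lg).
by rewrite !tmapE //; exact: comp_linear.
Qed.

Lemma tmap_id V W (f : V -> V) (g : W -> W) : 
  (forall v, f v = v) -> (forall w, g w = w) -> forall t, tmap f g t = t.
Proof.
move=> Ef Eg; have lf : linear f by move=> c u v; rewrite !Ef.
have lg : linear g by move=> c u v; rewrite !Eg.
apply: (vtens_ext (tmap_linear lf lg) (@id_linear _ _)) => v w.
by rewrite tmapE // Ef Eg.
Qed.

End VTensor.

Section RepTensor.
Variables (k : fieldType) (n : nat) (a b : k) (V : diag_rep n a) (W : diag_rep n b).

Definition tens_act (d : pdiag n) : vtens (dr_space V) (dr_space W) -> vtens (dr_space V) (dr_space W) :=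
  tmap (@dr_act _ _ _ V d) (@dr_act _ _ _ W d).

Let lV d := @dr_linear _ _ _ V d.
Let lW d := @dr_linear _ _ _ W d.

Lemma tens_act_linear d : linear (tens_act d).
Proof. exact: tmap_linear (lV d) (lW d). Qed.

Lemma tens_actE d v w : tens_act d (tm v w) = tm (dr_act d v) (dr_act d w).
Proof. exact: (tmapE (lV d) (lW d)). Qed.

Lemma tens_act1 t : tens_act (idd n) t = t.
Proof. by apply: tmap_id => v; rewrite dr_act1. Qed.

Lemma tens_actM d e t : tens_act d (tens_act e t) =
  (a * b) ^+ dloops d e *: tens_act (dmul d e) t.
Proof.
move: t; apply: vtens_ext => [||v w].
- exact: comp_linear (tens_act_linear d) (tens_act_linear e).
- exact: scale_linear (tens_act_linear _).
rewrite !tens_actE !dr_actM; have [bl br] := tm_bilin (dr_space V) (dr_space W).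
have [_ _ -> _] := linear_facts (bl (b ^+ dloops d e *: dr_act (dmul d e) w)).
by have [_ _ -> _] := linear_facts (br (dr_act (dmul d e) v)); rewrite scalerA exprMn.
Qed.

Definition rep_tens : diag_rep n (a * b) := DiagRep tens_act_linear tens_act1 tens_actM.

End RepTensor.

Section TensorExact.
Variables (k : fieldType) (n : nat) (a b : k).

Lemma tmap_drhom (V V' : diag_rep n a) (W W' : diag_rep n b)
    (f : dr_space V -> dr_space V') (g : dr_space W -> dr_space W') :
  drhom f -> drhom g -> @drhom _ _ _ (rep_tens V W) (rep_tens V' W') (tmap f g).
Proof.
move=> [lf af] [lg ag]; split; first exact: tmap_linear.
move=> d; have l1 := comp_linear (tmap_linear lf lg) (@tens_act_linear _ _ _ _ V W d).
have l2 := comp_linear (@tens_act_linear _ _ _ _ V' W' d) (tmap_linear lf lg).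
apply: (vtens_ext l1 l2) => v w.
by rewrite /= tmapE // !tens_actE tmapE // af ag.
Qed.

Lemma id_drhom (x : k) (V : diag_rep n x) : @drhom _ _ _ V V id.
Proof. by split. Qed.

(** The retraction and the section are only k-linear. The decomposition of [v] survives any bilinear
    operation, so exactness after tensoring can be checked with explicit maps. *)
Lemma split_exact (x : k) (A B C : diag_rep n x) (f : dr_space A -> dr_space B)
    (g : dr_space B -> dr_space C) : short_exact f g -> kproj (dr_space C) ->
  exists r s, [/\ linear (r : dr_space B -> dr_space A), linear (s : dr_space C -> dr_space B),
    forall v, r (f v) = v, forall c, g (s c) = c & forall v, v = f (r v) + s (g v)].
Proof.
move=> se pC; have [s ls gs] := pC _ _ (hom_lin (se_g se)) (se_surj se).
have [_ _ _ gB] := linear_facts (hom_lin (se_g se)).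
have H v : exists u, v - s (g v) = f u.
  by apply: (se_ker se); rewrite gB gs subrr.
have [r rP] := choice H; have [f0 fD fZ _] := linear_facts (hom_lin (se_f se)).
have rf v : r (f v) = v.
  apply: (se_inj se); rewrite -rP (se_zero se).
  by have [-> _ _ _] := linear_facts ls; rewrite subr0.
exists r, s; split=> //.
  move=> c u v; apply: (se_inj se); rewrite (hom_lin (se_f se)) -!rP.
  rewrite (hom_lin (se_g se)) ls scalerBr.
  by rewrite opprD addrACA.
by move=> v; rewrite -rP subrK.
Qed.

Lemma tens_exact_l (A B C : diag_rep n a) (W : diag_rep n b) (f : dr_space A -> dr_space B)
    (g : dr_space B -> dr_space C) : short_exact f g -> kproj (dr_space C) ->
  @short_exact _ _ _ (rep_tens A W) (rep_tens B W) (rep_tens C W) (tmap f id) (tmap g id).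
Proof.
move=> se pC; have [r [s [lr ls rf gs dec]]] := split_exact se pC.
have [lf lg] := (hom_lin (se_f se), hom_lin (se_g se)).
have li (V : lmodType k) := @id_linear _ V.
have D (t : vtens (dr_space B) (dr_space W)) : t = tmap f id (tmap r id t) + tmap s id (tmap g id t).
  move: t; apply: vtens_ext => [||v w]; first exact: li.
    move=> c u v; rewrite !tmap_linear // scalerDr.
    by rewrite addrACA.
  rewrite !tmapE // {1}[v]dec.
  by have [bl _] := tm_bilin (dr_space B) (dr_space W); have [_ -> _ _] := linear_facts (bl w).
split.
- exact: tmap_drhom (se_f se) (id_drhom _).
- exact: tmap_drhom (se_g se) (id_drhom _).
- apply: (can_inj (g := tmap r id)) => t; rewrite tmap_comp //.
  by apply: (@tmap_id k (dr_space A) (dr_space W) (r \o f) (id \o id)) => v //=; rewrite rf.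
- move=> t; exists (tmap s id t); rewrite tmap_comp //.
  by apply: (@tmap_id k (dr_space C) (dr_space W) (g \o s) (id \o id)) => v //=; rewrite gs.
- move=> t gt; exists (tmap r id t); rewrite {1}[t]D gt.
  by have [-> _ _ _] := linear_facts (tmap_linear ls (li (dr_space W))); rewrite addr0.
move=> t; rewrite tmap_comp //; move: t; apply: vtens_ext => [||v w].
- exact: tmap_linear (comp_linear lg lf) (li (dr_space W)).
- by move=> c u v; rewrite scaler0 addr0.
rewrite tmapE //; last exact: comp_linear.
rewrite /= (se_zero se).
by have [bl _] := tm_bilin (dr_space C) (dr_space W); have [-> _ _ _] := linear_facts (bl w).
Qed.

Lemma tens_exact_r (A B C : diag_rep n b) (W : diag_rep n a) (f : dr_space A -> dr_space B)
    (g : dr_space B -> dr_space C) : short_exact f g -> kproj (dr_space C) ->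
  @short_exact _ _ _ (rep_tens W A) (rep_tens W B) (rep_tens W C) (tmap id f) (tmap id g).
Proof.
move=> se pC; have [r [s [lr ls rf gs dec]]] := split_exact se pC.
have [lf lg] := (hom_lin (se_f se), hom_lin (se_g se)).
have li (V : lmodType k) := @id_linear _ V.
have D (t : vtens (dr_space W) (dr_space B)) : t = tmap id f (tmap id r t) + tmap id s (tmap id g t).
  move: t; apply: vtens_ext => [||w v]; first exact: li.
    move=> c u v; rewrite !tmap_linear // scalerDr.
    by rewrite addrACA.
  rewrite !tmapE // {1}[v]dec.
  by have [_ br] := tm_bilin (dr_space W) (dr_space B); have [_ -> _ _] := linear_facts (br w).
split.
- exact: tmap_drhom (id_drhom _) (se_f se).
- exact: tmap_drhom (id_drhom _) (se_g se).
- apply: (can_inj (g := tmap id r)) => t; rewrite tmap_comp //.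
  by apply: (@tmap_id k (dr_space W) (dr_space A) (id \o id) (r \o f)) => v //=; rewrite rf.
- move=> t; exists (tmap id s t); rewrite tmap_comp //.
  by apply: (@tmap_id k (dr_space W) (dr_space C) (id \o id) (g \o s)) => v //=; rewrite gs.
- move=> t gt; exists (tmap id r t); rewrite {1}[t]D gt.
  by have [-> _ _ _] := linear_facts (tmap_linear (li (dr_space W)) ls); rewrite addr0.
move=> t; rewrite tmap_comp //; move: t; apply: vtens_ext => [||w v].
- exact: tmap_linear (li (dr_space W)) (comp_linear lg lf).
- by move=> c u v; rewrite scaler0 addr0.
rewrite tmapE //; last exact: comp_linear.
rewrite /= (se_zero se).
by have [_ br] := tm_bilin (dr_space W) (dr_space C); have [-> _ _ _] := linear_facts (br w).
Qed.

(** Induction on the left filtration leaves a standard module on the left, and induction on the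
    right one then leaves a product of two standard modules. Each step is an extension by
    [filt_exact]. *)
Lemma filt_tens :
  (forall (x : k) (i : 'I_n.+1) la, kproj (dr_space (standard_rep x i la))) ->
  (forall (i j : 'I_n.+1) la mu, is_partition_of la i -> is_partition_of mu j ->
     filt (rep_tens (standard_rep a i la) (standard_rep b j mu))) ->
  forall (V : diag_rep n a) (W : diag_rep n b), filt V -> filt W -> filt (rep_tens V W).
Proof.
move=> pS H V W fV fW; elim: fV => {V} [V V0|A B i la f g hla se _ IH].
  apply: filt_nil; apply: vtens_ext => [||v w]; first exact: id_linear.
    by move=> c u v; rewrite scaler0 addr0.
  rewrite (V0 v); have [bl _] := tm_bilin (dr_space V) (dr_space W).
  by have [-> _ _ _] := linear_facts (bl w).
apply: (filt_exact (tens_exact_l W se (pS _ _ _)) IH).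
elim: fW => {W IH} [W W0|A' B' j mu f' g' hmu se' _ IH].
  apply: filt_nil; apply: vtens_ext => [||v w]; first exact: id_linear.
    by move=> c u v; rewrite scaler0 addr0.
  rewrite (W0 w); have [_ br] := tm_bilin (dr_space (standard_rep a i la)) (dr_space W).
  by have [-> _ _ _] := linear_facts (br v).
apply: (filt_exact (tens_exact_r _ se' (pS _ _ _)) IH); exact: H.
Qed.

(** The opaque tensor product [vtens] and the one of the statement have the same universal property,
    which gives mutually inverse maps. *)
Lemma filt_tensor_rep (X : lmodType (partalg n a)) (Y : lmodType (partalg n b)) :
  filt (rep_tens (mod_rep X) (mod_rep Y)) -> filt (tensor_rep X Y).
Proof.
pose K := ktens X Y; pose V := dr_space (mod_rep X); pose W := dr_space (mod_rep Y).
pose tk : V -> W -> K := tmk (fun (c : k) (x : kmod X) => c *: x) (fun (c : k) (y : kmod Y) => c *: y).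
have btk : bilin tk := scal_tmk_bilin V W.
pose f : vtens V W -> K := vlift tk.
pose g : K -> vtens V W := @tens_lift _ _ _ _ (@scal _ V) (@scal _ W) _ (@tm _ V W).
have lf : linear f := vlift_linear btk.
have lg : linear g := tens_lift_is_linear (bilin_balanced (tm_bilin V W)).
have fE v w : f (tm v w) = tk v w := vliftE btk v w.
have gE v w : g (tk v w) = tm v w := tens_liftE (bilin_balanced (tm_bilin V W)) v w.
have fK t : g (f t) = t.
  move: t; apply: (vtens_ext (comp_linear lg lf) (@id_linear _ _)) => v w /=.
  by rewrite fE gE.
have gK t : f (g t) = t.
  move: t; apply: (tens_ext (comp_linear lf lg) (@id_linear _ _)) => v w /=.
  by rewrite [g _]gE fE.
apply: (@filt_iso _ _ _ (rep_tens (mod_rep X) (mod_rep Y)) (tensor_rep X Y) f).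
- split=> // d; have l1 := comp_linear lf (@tens_act_linear _ _ _ _ (mod_rep X) (mod_rep Y) d).
  have l2 := comp_linear (@ktens_act_linear k n a b X Y d) lf.
  have H : f \o tens_act (V := mod_rep X) (W := mod_rep Y) d =1 @ktens_act k n a b X Y d \o f.
    apply: (vtens_ext l1 l2) => v w.
    rewrite /= tens_actE !fE; exact/esym/ktens_actE.
  exact: H.
- exact: can_inj fK.
by move=> t; exists (g t).
Qed.

End TensorExact.

(** * Induction from symmetric groups *)

Section CellAction.
Variables (n : nat) (i : 'I_n.+1).
Implicit Types (l m : cell i) (t r : 'S_i).

Local Notation Pm t := (perm_diag (ext_perm (leq_ord i) t)).

Lemma cact_proof t l : dmul (val l) (Pm t) \in left_cell (std_diag n i).
Proof. by rewrite left_cell_perm; exact: valP. Qed.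

Definition cact t l : cell i := Sub (dmul (val l) (Pm t)) (cact_proof t l).

Lemma cactE t l : val (cact t l) = dmul (val l) (Pm t).
Proof. by []. Qed.

Lemma cactM t r l : cact r (cact t l) = cact (t * r)%g l.
Proof. by apply: val_inj; rewrite !cactE -dmulA -perm_diagM ext_permM. Qed.

Lemma cact1 l : cact 1%g l = l.
Proof. by apply: val_inj; rewrite cactE ext_perm1 perm_diag1 dmul_idr. Qed.

Lemma cactK t : cancel (cact t) (cact t^-1%g).
Proof. by move=> l; rewrite cactM mulgV cact1. Qed.

Lemma cactKV t : cancel (cact t^-1%g) (cact t).
Proof. by move=> l; rewrite cactM mulVg cact1. Qed.

Lemma cact_inj t : injective (cact t).
Proof. exact: can_inj (cactK t). Qed.

Lemma cell_in_cell l : in_cell i (val l).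
Proof. by apply/(in_cellP _ (leq_ord i)); exact: valP. Qed.

Lemma dmul_cact e t l m : (dmul e (val (cact t l)) == val (cact t m)) = (dmul e (val l) == val m).
Proof.
rewrite !cactE dmulA; apply/eqP/eqP => [/(congr1 (fun d => dmul d (perm_diag (ext_perm (leq_ord i) t)^-1)))|->//].
by rewrite !dmul_permK.
Qed.

Lemma dloops_cact e t l : dloops e (val (cact t l)) = dloops e (val l).
Proof.
by have := dloopsA e (val l) (Pm t); rewrite !dloops_perm addn0 add0n cactE => <-.
Qed.

End CellAction.

Section FunRep.
Variables (k : fieldType) (n : nat) (x : k) (i : 'I_n.+1) (W : lmodType k).

Definition fun_space : lmodType k := {ffun cell i -> W}.

Definition fun_act (e : pdiag n) (f : fun_space) : fun_space :=
  [ffun m : cell i => \sum_(l : cell i | dmul e (val l) == val m) x ^+ dloops e (val l) *: f l].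

Lemma fun_actE e f m : fun_act e f m =
  \sum_(l : cell i | dmul e (val l) == val m) x ^+ dloops e (val l) *: f l.
Proof. exact: ffunE. Qed.

Lemma fun_act_linear e : linear (fun_act e).
Proof.
move=> c v w; apply/ffunP=> m; rewrite !ffunE scaler_sumr -big_split.
by apply: eq_bigr => l _; rewrite !ffunE scalerDr !scalerA mulrC.
Qed.

Lemma fun_act1 v : fun_act (idd n) v = v.
Proof.
apply/ffunP=> m; rewrite ffunE (big_pred1 m) => [|l /=].
  by rewrite dloops_idl scale1r.
by rewrite dmul_idl.
Qed.

Lemma fun_actM d e v : fun_act d (fun_act e v) = x ^+ dloops d e *: fun_act (dmul d e) v.
Proof.
apply/ffunP=> m; rewrite !ffunE scaler_sumr.
rewrite [RHS](eq_bigr (fun l : cell i =>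
   (x ^+ dloops d (dmul e (val l)) * x ^+ dloops e (val l)) *: v l)); last first.
  by move=> l _; rewrite scalerA -!exprD dloopsA addnC.
rewrite (eq_bigr (fun l' : cell i => \sum_(l : cell i | dmul e (val l) == val l')
   (x ^+ dloops d (dmul e (val l)) * x ^+ dloops e (val l)) *: v l)); last first.
  move=> l' _; rewrite ffunE scaler_sumr; apply: eq_bigr => l /eqP->.
  by rewrite scalerA.
rewrite (exchange_big_dep predT) //= [RHS]big_mkcond; apply: eq_bigr => l _.
case: ifPn => [/eqP E|nE].
  have Cl : dmul e (val l) \in left_cell (std_diag n i).
    by apply: (@left_cell_mulr _ _ d e) (valP l) _; rewrite dmulA E (valP m).
  rewrite (big_pred1 (Sub (dmul e (val l)) Cl : cell i)) // => l' /=.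
  rewrite cell_eqE andbC; case: eqP => [<-|//].
  by rewrite dmulA E eqxx.
rewrite big_pred0 // => l'; apply/negbTE/negP=> /andP[/eqP E1 /eqP E2].
by case/eqP: nE; rewrite -dmulA E2.
Qed.

Definition fun_rep : diag_rep n x := DiagRep fun_act_linear fun_act1 fun_actM.

Lemma fun_act_cact e t (f : fun_space) m :
  fun_act e f (cact t m) = \sum_(l : cell i | dmul e (val l) == val m) x ^+ dloops e (val l) *: f (cact t l).
Proof.
rewrite ffunE (reindex_inj (@cact_inj _ _ t)) /=; apply: eq_big => l; first exact: dmul_cact.
by rewrite dloops_cact.
Qed.

Variable (rho : 'S_i -> W -> W).
Hypothesis hrho : lin_action rho.

(** These are the invariants of the symmetric group acting at once on the values and, from the
    right, on the cell. *)
Definition equivariant (f : fun_space) : Prop := forall t l, rho t (f (cact t l)) = f l.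

Lemma equivariant_closed : lin_closed equivariant.
Proof.
split=> [t l|c u v hu hv t l]; first by rewrite !ffunE (lact0 hrho).
by rewrite !ffunE (lact_linear hrho) hu hv.
Qed.

Lemma equivariant_act e f : equivariant f -> equivariant (fun_act e f).
Proof.
move=> hf t l; rewrite fun_act_cact (lact_sum hrho) ffunE; apply: eq_bigr => m _.
by rewrite (lactZ hrho) hf.
Qed.

Definition ind_rep : diag_rep n x := @sub_rep k n x fun_rep _ equivariant_closed equivariant_act.

Definition ind_in (f : fun_space) (hf : equivariant f) : dr_space ind_rep :=
  @sub_in k n x fun_rep _ equivariant_closed f hf.

Definition ind_val (f : dr_space ind_rep) : fun_space := \val f.

Lemma ind_eqv (f : dr_space ind_rep) : equivariant (ind_val f).
Proof. exact: (@sub_spaceP k n x fun_rep _ equivariant_closed). Qed.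

Lemma ind_val_inj : injective ind_val.
Proof. exact: val_inj. Qed.

Lemma ind_inK f (hf : equivariant f) : ind_val (ind_in hf) = f.
Proof. by []. Qed.

Lemma ind_val_linear : linear ind_val.
Proof. by []. Qed.

Lemma ind_val_act e f : ind_val (dr_act e f) = fun_act e (ind_val f).
Proof. by []. Qed.

(* The tensor product over the group algebra, that is, the coinvariants, is
   identified with the invariants by symmetrization. *)
Definition sym_fun (v : cell_space k i) (u : W) : fun_space :=
  [ffun l => \sum_(t : 'S_i) v (cact t l) *: rho t u].

Lemma cell_ractE t (v : cell_space k i) l : cell_ract t v (cact t l) = v l.
Proof.
rewrite ffunE (big_pred1 l) // => m.
exact: (inj_eq (inj_comp val_inj (@cact_inj _ _ t)) m l).
Qed.

Lemma sym_fun_balanced : balanced (@cell_ract k n i) rho sym_fun.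
Proof.
split=> [v v' u|v u u'|c v u|c v u|r v u]; apply/ffunP=> l; rewrite !ffunE.
- by rewrite -big_split; apply: eq_bigr => t _; rewrite ffunE scalerDl.
- by rewrite -big_split; apply: eq_bigr => t _; rewrite (lactD hrho) scalerDr.
- by rewrite scaler_sumr; apply: eq_bigr => t _; rewrite ffunE scalerA.
- by rewrite scaler_sumr; apply: eq_bigr => t _; rewrite (lactZ hrho) !scalerA mulrC.
rewrite (reindex_inj (mulIg r)); apply: eq_bigr => t _.
by rewrite -cactM cell_ractE (lactM hrho).
Qed.

Definition tens_fun : tens (@cell_ract k n i) rho -> fun_space :=
  @tens_lift _ _ _ _ (@cell_ract k n i) rho _ sym_fun.

Lemma tens_funE v u : tens_fun (tmk _ _ v u) = sym_fun v u.
Proof. exact: tens_liftE sym_fun_balanced v u. Qed.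

Lemma tens_fun_linear : linear tens_fun.
Proof. exact: tens_lift_is_linear sym_fun_balanced. Qed.

Lemma tens_fun_equivariant w : equivariant (tens_fun w).
Proof.
move=> t l; pose f (w : tens (@cell_ract k n i) rho) := rho t (tens_fun w (cact t l)).
pose g (w : tens (@cell_ract k n i) rho) := tens_fun w l.
have lf : linear f by move=> c u v; rewrite /f tens_fun_linear !ffunE (lact_linear hrho).
have lg : linear g by move=> c u v; rewrite /g tens_fun_linear !ffunE.
apply: (tens_ext lf lg _ w) => v u; rewrite /f /g !tens_funE !ffunE (lact_sum hrho).
rewrite [RHS](reindex_inj (mulgI t)); apply: eq_bigr => r _.
by rewrite (lactZ hrho) cactM (lactM hrho).
Qed.

Definition cell_delta (l : cell i) : cell_space k i := [ffun m => (m == l)%:R].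

Lemma cell_deltaE l m : cell_delta l m = (m == l)%:R.
Proof. by rewrite ffunE. Qed.

(** Symmetrizing the sum produces the value of an equivariant function once for each permutation,
    hence the division by the factorial. *)
Definition fun_tens (f : fun_space) : tens (@cell_ract k n i) rho :=
  (i`!)%:R^-1 *: \sum_l tmk _ _ (cell_delta l) (f l).

Lemma tmk_linear_r v : linear (tmk (@cell_ract k n i) rho v).
Proof.
have [Dl Dr Zl Zr _] := tmk_balanced (@cell_ract k n i) rho.
by move=> c u u'; rewrite Dr Zr.
Qed.

Lemma tmk_linear_l u : linear ((tmk (@cell_ract k n i) rho)^~ u).
Proof.
have [Dl Dr Zl Zr _] := tmk_balanced (@cell_ract k n i) rho.
by move=> c v v'; rewrite Dl Zl.
Qed.

Lemma fun_tens_linear : linear fun_tens.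
Proof.
move=> c f g; rewrite /fun_tens scalerA mulrC -scalerA -scalerDr; congr (_ *: _).
rewrite scaler_sumr -big_split; apply: eq_bigr => l _.
by rewrite !ffunE tmk_linear_r.
Qed.

Hypothesis char_k : [pchar k] =i pred0.

Let fact_neq0 : (i`!)%:R != 0 :> k.
Proof. exact: (@pchar0_natr_neq0 k char_k _ (fact_gt0 i)). Qed.

Lemma card_sym : #|{: 'S_i}| = i`!%N.
Proof. by rewrite -card_Sn; apply: eq_card => s; rewrite !inE. Qed.

Lemma cell_ract_delta t l : cell_ract t (cell_delta l) = cell_delta (cact t l).
Proof.
apply/ffunP=> m; rewrite -(cactKV t m); move: (cact t^-1%g m) => {}m.
rewrite cell_ractE; apply: (etrans (cell_deltaE l m)).
apply: (etrans _ (esym (cell_deltaE (cact t l) (cact t m)))).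
by congr (nat_of_bool _)%:R; apply/esym/inj_eq/cact_inj.
Qed.

Lemma cell_delta_sum (v : cell_space k i) : v = \sum_l v l *: cell_delta l.
Proof.
apply/ffunP=> m; rewrite sum_ffunE (bigD1 m) //= big1 => [|l lm].
  by rewrite addr0 ffunE cell_deltaE eqxx regularZ mulr1.
by rewrite ffunE cell_deltaE eq_sym (negPf lm) regularZ mulr0.
Qed.

Lemma tens_funK w : fun_tens (tens_fun w) = w.
Proof.
move: w; apply: tens_ext (comp_linear fun_tens_linear tens_fun_linear) (@id_linear _ _) _ => v u.
rewrite /= tens_funE /fun_tens; have [Dl Dr Zl Zr B] := tmk_balanced (@cell_ract k n i) rho.
have S (v' : cell_space k i) (I : finType) (F : I -> W) :
    tmk (@cell_ract k n i) rho v' (\sum_j F j) = \sum_j tmk (@cell_ract k n i) rho v' (F j).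
  have [z D _ _] := linear_facts (tmk_linear_r v').
  exact: (big_morph _ D z).
have S' u' (I : finType) (F : I -> cell_space k i) :
    tmk (@cell_ract k n i) rho (\sum_j F j) u' = \sum_j tmk (@cell_ract k n i) rho (F j) u'.
  have [z D _ _] := linear_facts (tmk_linear_l u').
  exact: (big_morph ((tmk (@cell_ract k n i) rho)^~ u') D z).
under eq_bigr => l _ do rewrite ffunE S.
rewrite exchange_big /= (eq_bigr (fun=> tmk _ _ v u)) => [|t _].
  by rewrite sumr_const card_sym -scaler_nat scalerA mulVf ?scale1r.
rewrite [in RHS](cell_delta_sum v) S' [RHS](reindex_inj (@cact_inj _ _ t)).
by apply: eq_bigr => l _; rewrite Zr -B cell_ract_delta Zl.
Qed.

Lemma fun_tensK f : equivariant f -> tens_fun (fun_tens f) = f.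
Proof.
move=> hf; have [z D Z _] := linear_facts tens_fun_linear.
rewrite /fun_tens Z (big_morph _ D z).
apply/ffunP=> l; rewrite !ffunE sum_ffunE.
under eq_bigr => m _ do rewrite tens_funE ffunE.
rewrite exchange_big /= (eq_bigr (fun=> f l)) => [|t _].
  by rewrite sumr_const card_sym -scaler_nat scalerA mulVf ?scale1r.
rewrite (bigD1 (cact t l)) //= big1 => [|m ml]; rewrite cell_deltaE.
  by rewrite eqxx scale1r addr0.
by rewrite eq_sym (negPf ml) scale0r.
Qed.

Lemma tens_fun_act e w : tens_fun (tens_map (cell_act x e) id w) = fun_act e (tens_fun w).
Proof.
have bal : balanced (@cell_ract k n i) rho
    (fun v u => tmk (@cell_ract k n i) rho (cell_act x e v) u).
  apply: (@tens_map_balanced _ _ _ _ (@cell_ract k n i) rho (cell_act x e) id) => // [|t v].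
    exact: cell_act_linear.
  exact: cell_actC.
have lm : linear (tens_map (ra := @cell_ract k n i) (la := rho) (cell_act x e) id).
  exact: tens_lift_is_linear bal.
apply: (tens_ext (comp_linear tens_fun_linear lm) (comp_linear (fun_act_linear e) tens_fun_linear)) => v u.
rewrite /= /tens_map (tens_liftE bal) !tens_funE; apply/ffunP=> m; rewrite !ffunE.
rewrite (eq_bigr (fun t => \sum_(l | dmul e (val l) == val m)
    x ^+ dloops e (val l) *: (v (cact t l) *: rho t u))) => [|t _].
  rewrite exchange_big /=; apply: eq_bigr => l _.
  by rewrite ffunE scaler_sumr.
rewrite ffunE (reindex_inj (@cact_inj _ _ t)) /= scaler_suml.
apply: eq_big => l; first exact: dmul_cact.
by rewrite dloops_cact scalerA.
Qed.

End FunRep.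

(** By [tens_funK] the standard module is a retract of the finite-dimensional space of all functions
    from the cell to the Specht module. *)
Lemma kproj_standard (k : fieldType) (n : nat) (char_k : [pchar k] =i pred0) (x : k)
  (i : 'I_n.+1) la : kproj (dr_space (standard_rep x i la)).
Proof.
have hs := specht_lin_action k i la.
pose V : vectType k := {ffun cell i -> specht k i la}.
apply: (@retract_kproj k (dr_space (standard_rep x i la)) V (@fun_tens k n i _ (@specht_act k i la))
   (@tens_fun k n i _ (@specht_act k i la))).
- exact: fun_tens_linear.
- exact: tens_fun_linear.
- exact: tens_funK.
Qed.

(** * Standard filtrations of induced modules *)

Section FiltInd.
Variables (k : closedFieldType) (n : nat) (x : k) (i : 'I_n.+1).
Hypothesis char_k : [pchar k] =i pred0.

Section Step.
Variables (W : vectType k) (rho : 'S_i -> W -> W) (hrho : lin_action rho).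
Variables (la : seq nat) (p : W -> specht k i la).
Hypotheses (lp : linear p) (pG : forall g w, p (rho g w) = specht_act g (p w)).
Hypothesis (p_surj : forall y, exists w, p w = y).

Let pl : {linear W -> specht k i la} := HB.pack p (GRing.isLinear.Build k _ _ _ p lp).

Definition ker_space : {vspace W} := lker (linfun pl).

Lemma ker_spaceP w : (w \in ker_space) = (p w == 0).
Proof. by rewrite memv_ker lfunE. Qed.

Definition ker_act (g : 'S_i) (w : subvs_of ker_space) : subvs_of ker_space :=
  vsproj ker_space (rho g (vsval w)).

Lemma ker_actE g w : vsval (ker_act g w) = rho g (vsval w).
Proof.
rewrite vsprojK // ker_spaceP pG.
have /eqP-> : p (vsval w) == 0 by rewrite -ker_spaceP subvsP.
by rewrite (lact0 (specht_lin_action k i la)).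
Qed.

Lemma ker_lin_action : lin_action ker_act.
Proof.
split=> [g c u v|g h w|w]; apply: vsval_inj.
- by rewrite ker_actE !(vsvalD, vsvalZ) (lact_linear hrho) !ker_actE.
- by rewrite !ker_actE (lactM hrho).
by rewrite ker_actE (lact1 hrho).
Qed.

(** Equivariant functions with values in the kernel of [p] are exactly the equivariant functions
    killed by [p]; surjectivity is where an average is needed. *)
Lemma ind_exact : exists f g, @short_exact k n x (ind_rep x ker_lin_action) (ind_rep x hrho)
  (standard_rep x i la) f g.
Proof.
have hs := specht_lin_action k i la.
have eqvf (f : dr_space (ind_rep x ker_lin_action)) :
    equivariant rho [ffun l => vsval (ind_val f l)].
  by move=> t l; rewrite !ffunE -ker_actE (ind_eqv f).
have eqvg (f : dr_space (ind_rep x hrho)) :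
    equivariant (@specht_act k i la) [ffun l => p (ind_val f l)].
  by move=> t l; rewrite !ffunE -pG (ind_eqv f).
pose F f : dr_space (ind_rep x hrho) := ind_in x hrho (eqvf f).
pose G (f : dr_space (ind_rep x hrho)) : dr_space (standard_rep x i la) :=
  fun_tens (@specht_act k i la) [ffun l => p (ind_val f l)].
have [p0 pD pZ _] := linear_facts lp.
have EG f : tens_fun (G f) = [ffun l => p (ind_val f l)] := fun_tensK hs char_k (eqvg f).
have Ginj (f : dr_space (ind_rep x hrho)) : G f = 0 -> forall l, p (ind_val f l) = 0.
  move=> /(congr1 (tens_fun (rho := @specht_act k i la))); rewrite EG => E l.
  move/ffunP/(_ l): E; rewrite ffunE => ->.
  have [-> _ _ _] := linear_facts (tens_fun_linear hs (n := n)).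
  by rewrite ffunE.
exists F, G; split.
- split=> [c u v|e v]; apply: ind_val_inj; apply/ffunP=> l.
    rewrite (ind_val_linear c (F u) (F v)) /F !ind_inK !ffunE.
    by rewrite vsvalD vsvalZ.
  rewrite (ind_val_act e (F v)) /F !ind_inK !ffunE.
  have S (I : finType) (P : pred I) (h : I -> subvs_of ker_space) :
      vsval (\sum_(j | P j) h j) = \sum_(j | P j) vsval (h j).
    by apply: (big_morph vsval) => // *; rewrite vsvalD.
  by rewrite S; apply: eq_bigr => m _; rewrite vsvalZ !ffunE.
- split=> [c u v|e v].
    rewrite /G -fun_tens_linear; congr fun_tens; apply/ffunP=> l.
    by rewrite !ffunE lp.
  apply: (can_inj (tens_funK hs char_k)).
  apply: (etrans (EG _)); apply: (etrans _ (esym (tens_fun_act x hs e (G v)))).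
  rewrite (EG v); apply/ffunP=> l; rewrite !ffunE (big_morph p pD p0).
  by apply: eq_bigr => m _; rewrite pZ !ffunE.
- move=> u v /(congr1 (@ind_val _ _ _ _ _ _ _))/ffunP E; apply: ind_val_inj; apply/ffunP=> l.
  by apply: vsval_inj; have := E l; rewrite !ind_inK !ffunE.
- move=> w; have eqw := tens_fun_equivariant hs w; set f := tens_fun w in eqw.
  have [s sP] := choice p_surj.
  have fact0 := @pchar0_natr_neq0 k char_k _ (fact_gt0 i).
  (* A pointwise lift of [f] through [p] need not be equivariant, but its average over the group is,
     and still lifts [f] because [f] is equivariant. *)
  pose f' : fun_space i W :=
    [ffun l => (i`!)%:R^-1 *: \sum_(t : 'S_i) rho t (s (f (cact t l)))].
  have eqf' : equivariant rho f'.
    move=> r l; rewrite !ffunE (lactZ hrho); congr (_ *: _).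
    rewrite (lact_sum hrho) [RHS](reindex_inj (mulgI r)); apply: eq_bigr => t _.
    by rewrite (lactM hrho) cactM.
  exists (ind_in x hrho eqf'); apply: (can_inj (tens_funK hs char_k)).
  rewrite EG; apply/ffunP=> l; rewrite !ffunE pZ (big_morph p pD p0).
  rewrite (eq_bigr (fun=> f l)) => [|t _]; last by rewrite pG sP eqw.
  by rewrite sumr_const card_sym -scaler_nat scalerA mulVf ?scale1r.
- move=> f /Ginj f0.
  pose f1 : fun_space i (subvs_of ker_space) :=
    [ffun l => vsproj ker_space (ind_val f l)].
  have f1E l : vsval (f1 l) = ind_val f l.
    by rewrite ffunE vsprojK // ker_spaceP f0.
  have eqf1 : equivariant ker_act f1.
    by move=> t l; apply: vsval_inj; rewrite ker_actE !f1E (ind_eqv f).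
  exists (ind_in x ker_lin_action eqf1); apply: ind_val_inj; apply/ffunP=> l.
  by rewrite ind_inK ffunE ind_inK f1E.
move=> f; apply: (can_inj (tens_funK hs char_k)).
rewrite EG.
have [-> _ _ _] := linear_facts (tens_fun_linear hs (n := n)).
apply/ffunP=> l; rewrite !ffunE; apply/eqP; rewrite -ker_spaceP; exact: subvsP.
Qed.

Lemma dim_ker_space (w : W) : p w != 0 -> (dim (subvs_of ker_space) < dim W)%N.
Proof.
move=> pw; rewrite -[dim W]dimvf.
have -> : dim (subvs_of ker_space) = \dim ker_space by [].
rewrite (ltn_leqif (dimv_leqif_sup (subvf _))); apply: contra pw.
by move/subvP/(_ w (memvf w)); rewrite ker_spaceP.
Qed.

End Step.

(** Induction on the dimension of [W]: a Specht quotient of [W] induces to a standard quotient, and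
    the kernel is strictly smaller. *)
Lemma filt_ind_rep (W : vectType k) (rho : 'S_i -> W -> W) (hrho : lin_action rho) :
  filt (ind_rep x hrho).
Proof.
have [m] := ubnP (dim W); elim: m W rho hrho => // m IH W rho hrho le.
have [W0|/existsNP[w0 /eqP nw]] := pselect (forall w : W, w = 0).
  apply: filt_nil => f; apply: ind_val_inj; apply/ffunP=> l.
  by rewrite [LHS]W0 [RHS]W0.
have [la [hla [p [lp pG ps]]]] := specht_quotient char_k hrho nw.
have [f [g se]] := ind_exact hrho lp pG ps.
apply: (filt_cons hla se); apply: IH.
have [t tt] := exists_tableau hla; have [w Ew] := ps (spoly k la t).
apply: leq_trans (dim_ker_space lp (w := w) _) _; last by rewrite -ltnS.
by rewrite Ew spoly_neq0.
Qed.

End FiltInd.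

(** * Tensor products of induced modules *)

Lemma linear_sum_fact (k : nzRingType) (U V : lmodType k) (f : U -> V) (I : Type) (r : seq I)
    (P : pred I) (F : I -> U) : linear f ->
  f (\sum_(x <- r | P x) F x) = \sum_(x <- r | P x) f (F x).
Proof. by case/linear_facts=> f0 fD _ _; exact: (big_morph f fD f0). Qed.

Lemma linearZ_fact (k : nzRingType) (U V : lmodType k) (f : U -> V) c u :
  linear f -> f (c *: u) = c *: f u.
Proof. by case/linear_facts. Qed.

Lemma ffun_lin (k : nzRingType) (I : finType) (V : lmodType k) c (f g : {ffun I -> V}) z :
  (c *: f + g) z = c *: f z + g z.
Proof. by rewrite !ffunE. Qed.

Section VTensFinDim.
Variables (k : fieldType) (V W : vectType k).

Let vmx (v : V) (w : W) : 'M[k]_(dim V, dim W) := (v2r v)^T *m v2r w.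

Let vmx_bilin : bilin vmx.
Proof.
split=> [w c v v'|v c w w']; rewrite /vmx linearP.
  by rewrite linearP mulmxDl scalemxAl.
by rewrite mulmxDr scalemxAr.
Qed.

(** Matrix coordinates make the tensor product of two value spaces a [vectType], as the induction on
    dimension in [filt_ind_rep] requires. *)
Definition vtens_mx : vtens V W -> 'M[k]_(dim V, dim W) := vlift vmx.

Definition mx_vtens (A : 'M[k]_(dim V, dim W)) : vtens V W :=
  \sum_p \sum_q A p q *: tm (r2v (delta_mx 0 p)) (r2v (delta_mx 0 q)).

Lemma vtens_mx_linear : linear vtens_mx.
Proof. exact: vlift_linear. Qed.

Lemma mx_vtens_linear : linear mx_vtens.
Proof.
move=> c A B; rewrite /mx_vtens scaler_sumr -big_split; apply: eq_bigr => p _.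
rewrite scaler_sumr -big_split; apply: eq_bigr => q _.
by rewrite !mxE scalerDl scalerA.
Qed.

Lemma vtens_mxK : cancel vtens_mx mx_vtens.
Proof.
move=> t; move: t; apply: vtens_ext (comp_linear mx_vtens_linear vtens_mx_linear) (@id_linear _ _) _ => v w.
have [bl br] := tm_bilin V W.
have E (X : vectType k) (u : X) : u = \sum_p v2r u 0 p *: r2v (delta_mx 0 p).
  by rewrite -[LHS]v2rK {1}[v2r u]row_sum_delta linear_sum; apply: eq_bigr => p _; rewrite linearZ.
rewrite /= /vtens_mx vliftE // /mx_vtens [in RHS](E _ v) [in RHS](E _ w).
rewrite (linear_sum_fact _ _ _ (bl _)); apply: eq_bigr => p _.
rewrite (linear_sum_fact _ _ _ (br _)); apply: eq_bigr => q _.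
rewrite (linearZ_fact _ _ (bl _)) (linearZ_fact _ _ (br _)) scalerA.
by rewrite /vmx mxE big_ord1 mxE.
Qed.

Lemma mx_vtensK : cancel mx_vtens vtens_mx.
Proof.
move=> A; rewrite /mx_vtens (linear_sum_fact _ _ _ vtens_mx_linear).
rewrite [RHS]matrix_sum_delta; apply: eq_bigr => p _.
rewrite (linear_sum_fact _ _ _ vtens_mx_linear); apply: eq_bigr => q _.
rewrite (linearZ_fact _ _ vtens_mx_linear); congr (_ *: _).
by rewrite /vtens_mx vliftE // /vmx !r2vK trmx_delta mul_delta_mx.
Qed.

Lemma vtens_vect_axiom : Vector.axiom (dim V * dim W) (vtens V W).
Proof.
exists (fun t => mxvec (vtens_mx t)).
  by move=> c t u; rewrite vtens_mx_linear linearP.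
exists (fun r => mx_vtens (vec_mx r)) => [t|r]; first by rewrite mxvecK vtens_mxK.
by rewrite mx_vtensK vec_mxK.
Qed.

Definition vtens_vect : vectType k :=
  HB.pack_for (vectType k) (GRing.Lmodule.sort (vtens V W)) (Lmodule_hasFinDim.Build k (vtens V W) vtens_vect_axiom).

End VTensFinDim.

Section DeltaFun.
Variables (k : fieldType) (n : nat) (i : 'I_n.+1) (W : lmodType k) (rho : 'S_i -> W -> W).
Hypothesis hrho : lin_action rho.

(* The symmetrization of the function supported at l with value u. *)
Definition orbit_fun (l : cell i) (u : W) : fun_space i W :=
  [ffun l' => \sum_(t : 'S_i | cact t l' == l) rho t u].

Lemma orbit_funE l u l' : orbit_fun l u l' = \sum_(t : 'S_i | cact t l' == l) rho t u.
Proof. exact: ffunE. Qed.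

Lemma orbit_fun_linear l : linear (orbit_fun l).
Proof.
move=> c u v; apply/ffunP=> l'; rewrite ffun_lin !orbit_funE scaler_sumr -big_split.
by apply: eq_bigr => t _; rewrite (lact_linear hrho).
Qed.

Lemma orbit_fun_equivariant l u : equivariant rho (orbit_fun l u).
Proof.
move=> r l'; rewrite !orbit_funE (lact_sum hrho) [RHS](reindex_inj (mulgI r)) /=.
by apply: eq_big => t; rewrite ?cactM // (lactM hrho).
Qed.

Lemma orbit_fun_sum (f : fun_space i W) : equivariant rho f ->
  \sum_l orbit_fun l (f l) = (i`!)%:R *: f.
Proof.
move=> hf; apply/ffunP=> l'; rewrite sum_ffunE [RHS]ffunE.
under eq_bigr => l _ do rewrite orbit_funE.
rewrite (exchange_big_dep predT) //= (eq_bigr (fun=> f l')) => [|t _].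
  by rewrite sumr_const card_sym scaler_nat.
by rewrite (big_pred1 (cact t l')) ?hf // => l; rewrite eq_sym.
Qed.

End DeltaFun.

(* V is the space of equivariant functions, P being the isomorphism and Q its inverse. *)
Record fun_model (k : fieldType) (n : nat) (x : k) (i : 'I_n.+1) (V : diag_rep n x)
    (W : lmodType k) (rho : 'S_i -> W -> W) (P : dr_space V -> fun_space i W)
    (Q : fun_space i W -> dr_space V) : Prop := FunModel {
  fm_linear : linear P;
  fm_inv_linear : linear Q;
  fm_act : forall d v, P (dr_act d v) = fun_act x d (P v);
  fm_equivariant : forall v, equivariant rho (P v);
  fm_K : forall v, Q (P v) = v;
  fm_invK : forall f, equivariant rho f -> P (Q f) = f }.

Lemma standard_fun_model (k : fieldType) (n : nat) (x : k) (i : 'I_n.+1) la :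
  [pchar k] =i pred0 ->
  fun_model (V := standard_rep x i la) (@specht_act k i la)
    (@tens_fun k n i _ (@specht_act k i la)) (@fun_tens k n i _ (@specht_act k i la)).
Proof.
move=> char_k; have hs := specht_lin_action k i la; split.
- exact: tens_fun_linear.
- exact: fun_tens_linear.
- move=> d v; exact: (tens_fun_act x hs d v).
- move=> v; exact: tens_fun_equivariant.
- move=> v; exact: (tens_funK hs char_k v).
move=> f hf; exact: (fun_tensK hs char_k hf).
Qed.

Section Theta.
Variables (k : fieldType) (n : nat) (a b : k) (i j : 'I_n.+1).
Variables (V1 : diag_rep n a) (V2 : diag_rep n b) (S1 S2 : lmodType k).
Variables (rho1 : 'S_i -> S1 -> S1) (rho2 : 'S_j -> S2 -> S2).
Variables (P1 : dr_space V1 -> fun_space i S1) (Q1 : fun_space i S1 -> dr_space V1).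
Variables (P2 : dr_space V2 -> fun_space j S2) (Q2 : fun_space j S2 -> dr_space V2).
Hypothesis char_k : [pchar k] =i pred0.
Hypotheses (h1 : lin_action rho1) (h2 : lin_action rho2).
Hypotheses (m1 : fun_model rho1 P1 Q1) (m2 : fun_model rho2 P2 Q2).

Local Notation C1 := (dr_space V1).
Local Notation C2 := (dr_space V2).
Local Notation Z := (cell i * cell j)%type.
Local Notation G := ('S_i * 'S_j)%type.

Definition zact (g : G) (z : Z) : Z := (cact g.1 z.1, cact g.2 z.2).

Lemma zact_eqE g z z' : (zact g z == z') = (cact g.1 z.1 == z'.1) && (cact g.2 z.2 == z'.2).
Proof. by case: z' => x y; rewrite -xpair_eqE. Qed.

Definition uact (g : G) : vtens S1 S2 -> vtens S1 S2 := tmap (rho1 g.1) (rho2 g.2).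

Let app1_linear l : linear (fun t => P1 t l).
Proof. by move=> c u v; rewrite (fm_linear m1); exact: ffun_lin. Qed.

Let app2_linear l : linear (fun t => P2 t l).
Proof. by move=> c u v; rewrite (fm_linear m2); exact: ffun_lin. Qed.

(** Evaluation in both factors identifies the tensor product with the functions on pairs that are
    equivariant under the product of the two symmetric groups ([theta_equivariant], [thetaK],
    [theta_invK]). *)
Definition theta (t : vtens C1 C2) (z : Z) : vtens S1 S2 :=
  tmap (fun t => P1 t z.1) (fun t => P2 t z.2) t.

Lemma thetaE t t' z : theta (tm t t') z = tm (P1 t z.1) (P2 t' z.2).
Proof. exact: (tmapE (app1_linear z.1) (app2_linear z.2)). Qed.

Lemma theta_app_linear z : linear (fun t => theta t z).
Proof. exact: tmap_linear. Qed.

Lemma uact_linear g : linear (uact g).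
Proof. exact: tmap_linear (lact_linear h1 _) (lact_linear h2 _). Qed.

Lemma uactE g u v : uact g (tm u v) = tm (rho1 g.1 u) (rho2 g.2 v).
Proof. exact: tmapE (lact_linear h1 _) (lact_linear h2 _) u v. Qed.

Lemma theta_equivariant g t z : uact g (theta t (zact g z)) = theta t z.
Proof.
move: t; apply: vtens_ext (theta_app_linear z) _ => [|t t'].
  exact: comp_linear (uact_linear g) (theta_app_linear _).
rewrite !thetaE uactE; congr tm.
  exact: (fm_equivariant m1).
exact: (fm_equivariant m2).
Qed.

Definition diag_maps (d : pdiag n) (z z' : Z) : bool :=
  (dmul d (val z.1) == val z'.1) && (dmul d (val z.2) == val z'.2).

Definition diag_coef (d : pdiag n) (z : Z) : k :=
  a ^+ dloops d (val z.1) * b ^+ dloops d (val z.2).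

Lemma theta_act d (t : dr_space (rep_tens V1 V2)) z' :
  theta (dr_act d t) z' = \sum_(z | diag_maps d z z') diag_coef d z *: theta t z.
Proof.
have [bl br] := tm_bilin S1 S2.
have l1 := comp_linear (theta_app_linear z') (@tens_act_linear _ _ _ _ V1 V2 d).
have l2 : linear (fun t => \sum_(z | diag_maps d z z') diag_coef d z *: theta t z).
  move=> c u v; rewrite scaler_sumr -big_split; apply: eq_bigr => z _.
  by rewrite theta_app_linear scalerDr !scalerA mulrC.
move: t; apply: (vtens_ext l1 l2) => t t'.
have E1 := congr1 (fun f : fun_space i S1 => f z'.1) (fm_act m1 d t).
have E2 := congr1 (fun f : fun_space j S2 => f z'.2) (fm_act m2 d t').
have {}E1 := etrans E1 (fun_actE a d (P1 t) z'.1).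
have {}E2 := etrans E2 (fun_actE b d (P2 t') z'.2).
apply: (etrans (congr1 (theta^~ z') (tens_actE d t t'))).
apply: (etrans (thetaE _ _ z')); apply: (etrans (congr2 (@tm _ _ _) E1 E2)).
rewrite (linear_sum_fact _ _ _ (bl _)).
rewrite (eq_bigr (fun l : cell i => \sum_(m : cell j | dmul d (val m) == val z'.2)
   (a ^+ dloops d (val l) * b ^+ dloops d (val m)) *: tm (P1 t l) (P2 t' m))) => [|l _].
  rewrite pair_big_dep /=; apply: eq_big => z //= _.
  by rewrite thetaE.
rewrite (linear_sum_fact _ _ _ (br _)); apply: eq_bigr => m _.
by rewrite (linearZ_fact _ _ (bl _)) (linearZ_fact _ _ (br _)) scalerA.
Qed.

Let iota1 (l : cell i) (u : S1) : C1 := Q1 (orbit_fun rho1 l u).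
Let iota2 (l : cell j) (u : S2) : C2 := Q2 (orbit_fun rho2 l u).

Let iota1_linear l : linear (iota1 l).
Proof. exact: comp_linear (fm_inv_linear m1) (orbit_fun_linear h1 l). Qed.
Let iota2_linear l : linear (iota2 l).
Proof. exact: comp_linear (fm_inv_linear m2) (orbit_fun_linear h2 l). Qed.

Let fact_neq0 m : (m`!)%:R != 0 :> k.
Proof. exact: (@pchar0_natr_neq0 k char_k _ (fact_gt0 m)). Qed.

Let iota1_sum t : \sum_l iota1 l (P1 t l) = (i`!)%:R *: t.
Proof.
rewrite -(linear_sum_fact _ _ _ (fm_inv_linear m1)) (orbit_fun_sum (fm_equivariant m1 t)).
by rewrite (linearZ_fact _ _ (fm_inv_linear m1)) (fm_K m1).
Qed.

Let iota2_sum t : \sum_l iota2 l (P2 t l) = (j`!)%:R *: t.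
Proof.
rewrite -(linear_sum_fact _ _ _ (fm_inv_linear m2)) (orbit_fun_sum (fm_equivariant m2 t)).
by rewrite (linearZ_fact _ _ (fm_inv_linear m2)) (fm_K m2).
Qed.

(** Summing the orbit functions of its values reproduces an element of the first factor i! times and
    one of the second j! times, hence the constant. *)
Definition theta_inv (F : Z -> vtens S1 S2) : vtens C1 C2 :=
  ((i`!)%:R^-1 * (j`!)%:R^-1) *: \sum_z tmap (iota1 z.1) (iota2 z.2) (F z).

Lemma thetaK t : theta_inv (theta t) = t.
Proof.
have [bl br] := tm_bilin C1 C2.
have lc : linear (fun t => theta_inv (theta t)).
  move=> c u v; rewrite /theta_inv; set e := _ * _.
  rewrite (scalerA c e) (mulrC c e) -(scalerA e c) -(scalerDr e); congr (_ *: _).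
  rewrite scaler_sumr -big_split; apply: eq_bigr => z _.
  rewrite theta_app_linear; exact: tmap_linear (iota1_linear _) (iota2_linear _) _ _ _.
move: t; apply: (vtens_ext lc (@id_linear _ _)) => t t'.
rewrite /theta_inv.
rewrite (eq_bigr (fun z : Z => tm (iota1 z.1 (P1 t z.1)) (iota2 z.2 (P2 t' z.2)))) => [|z _].
  rewrite -(pair_big predT predT (fun l m => tm (iota1 l (P1 t l)) (iota2 m (P2 t' m)))) /=.
  under eq_bigr => l _ do rewrite -(linear_sum_fact _ _ _ (br _)) iota2_sum.
  rewrite -(linear_sum_fact _ _ _ (bl _)) iota1_sum.
  rewrite (linearZ_fact _ _ (bl _)) (linearZ_fact _ _ (br _)) !scalerA.
  by rewrite mulrACA !mulVf ?mulr1 ?scale1r.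
by rewrite thetaE tmapE.
Qed.

Lemma theta_iota z' (w : vtens S1 S2) z :
  theta (tmap (iota1 z'.1) (iota2 z'.2) w) z = \sum_(g : G | zact g z == z') uact g w.
Proof.
have [bl br] := tm_bilin S1 S2.
have lt := tmap_linear (iota1_linear z'.1) (iota2_linear z'.2).
have l2 : linear (fun w => \sum_(g : G | zact g z == z') uact g w).
  move=> c u v; rewrite scaler_sumr -big_split; apply: eq_bigr => g _.
  exact: uact_linear.
move: w; apply: (vtens_ext (comp_linear (theta_app_linear z) lt) l2) => u v.
have E1 := congr1 (fun f : fun_space i S1 => f z.1) (fm_invK m1 (orbit_fun_equivariant h1 z'.1 u)).
have E2 := congr1 (fun f : fun_space j S2 => f z.2) (fm_invK m2 (orbit_fun_equivariant h2 z'.2 v)).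
have {}E1 := etrans E1 (orbit_funE rho1 z'.1 u z.1).
have {}E2 := etrans E2 (orbit_funE rho2 z'.2 v z.2).
apply: (etrans (congr1 (theta^~ z) (tmapE (iota1_linear z'.1) (iota2_linear z'.2) u v))).
apply: (etrans (thetaE _ _ z)); apply: (etrans (congr2 (@tm _ _ _) E1 E2)).
rewrite (linear_sum_fact _ _ _ (bl _)).
under eq_bigr => g _ do rewrite (linear_sum_fact _ _ _ (br _)).
rewrite pair_big; apply: eq_big => [g|g _]; first exact/esym/zact_eqE.
exact/esym/uactE.
Qed.

Lemma theta_invK F : (forall g z, uact g (F (zact g z)) = F z) -> theta (theta_inv F) =1 F.
Proof.
move=> hF z; rewrite /theta_inv (linearZ_fact _ _ (theta_app_linear z)).
rewrite (linear_sum_fact _ _ _ (theta_app_linear z)).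
under eq_bigr => z' _ do rewrite theta_iota.
rewrite (exchange_big_dep predT) //= (eq_bigr (fun=> F z)) => [|g _]; last first.
  by rewrite (big_pred1 (zact g z)) ?hF.
rewrite sumr_const card_prod !card_sym -scaler_nat scalerA natrM.
by rewrite mulrACA !mulVf ?mulr1 ?scale1r.
Qed.

End Theta.

(** * The filtration by the size of a pair *)

Section EqvSpace.
Variables (k : fieldType) (T G : finType) (U : vectType k).
Variables (al : G -> U -> U) (be : G -> T -> T).
Hypothesis al_linear : forall g, linear (al g).

(** Equivariance is cast as the kernel of a linear map so that it defines a subspace of a
    [vectType]. *)
Let defect (w : {ffun T -> U}) : {ffun G * T -> U} :=
  [ffun x => al x.1 (w (be x.1 x.2)) - w x.2].

Let defect_linear : linear defect.
Proof.
move=> c u v; apply/ffunP=> x; rewrite !ffunE al_linear scalerBr opprD addrACA.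
by [].
Qed.

Definition eqv_space : {vspace {ffun T -> U}} :=
  lker (linfun (HB.pack_for {linear {ffun T -> U} -> {ffun G * T -> U}} defect
    (GRing.isLinear.Build k _ _ _ defect defect_linear))).

Lemma eqv_spaceP (w : {ffun T -> U}) :
  w \in eqv_space <-> forall g z, al g (w (be g z)) = w z.
Proof.
rewrite memv_ker lfunE /=; split=> [/eqP/ffunP E g z|E].
  by have := E (g, z); rewrite !ffunE /= => /subr0_eq.
by apply/eqP/ffunP=> x; rewrite !ffunE E subrr.
Qed.

Variables (gT : finGroupType) (tau : gT -> T -> T).
Hypothesis tauM : forall t r z, tau (t * r)%g z = tau t (tau r z).
Hypothesis tau1 : forall z, tau 1%g z = z.
Hypothesis tau_be : forall t g z, be g (tau t z) = tau t (be g z).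

(** The projection is only a cast: [tau] commutes with [be], so the translate is still
    equivariant. *)
Definition eqv_act (t : gT) (w : subvs_of eqv_space) : subvs_of eqv_space :=
  vsproj eqv_space [ffun z => vsval w (tau t^-1%g z)].

Lemma eqv_actE t w z : vsval (eqv_act t w) z = vsval w (tau t^-1%g z).
Proof.
rewrite vsprojK ?ffunE //; apply/eqv_spaceP=> g y; rewrite !ffunE -tau_be.
by have /eqv_spaceP := subvsP w; apply.
Qed.

Lemma eqv_lin_action : lin_action eqv_act.
Proof.
split=> [t c u v|t r w|w]; apply: vsval_inj; apply/ffunP=> z.
- by rewrite eqv_actE !(vsvalD, vsvalZ) ![(_ + _ : {ffun T -> U}) _]ffunE
    ![(_ *: _ : {ffun T -> U}) _]ffunE !eqv_actE.
- by rewrite !eqv_actE -tauM invMg.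
by rewrite eqv_actE invg1 tau1.
Qed.

End EqvSpace.

Section StandardTensor.
Variables (k : closedFieldType) (n : nat) (a b : k) (i j : 'I_n.+1).
Variables (V1 : diag_rep n a) (V2 : diag_rep n b) (S1 S2 : vectType k).
Variables (rho1 : 'S_i -> S1 -> S1) (rho2 : 'S_j -> S2 -> S2).
Variables (P1 : dr_space V1 -> fun_space i S1) (Q1 : fun_space i S1 -> dr_space V1).
Variables (P2 : dr_space V2 -> fun_space j S2) (Q2 : fun_space j S2 -> dr_space V2).
Hypothesis char_k : [pchar k] =i pred0.
Hypotheses (h1 : lin_action rho1) (h2 : lin_action rho2).
Hypotheses (m1 : fun_model rho1 P1 Q1) (m2 : fun_model rho2 P2 Q2).

Local Notation Z := (cell i * cell j)%type.
Local Notation G := ('S_i * 'S_j)%type.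
Local Notation U := (vtens S1 S2).
Local Notation M := (rep_tens V1 V2).
Local Notation Theta := (theta P1 P2).

Definition zsize (z : Z) : nat := psize (val z.1) (val z.2).

Definition supp_lt (m : nat) (t : dr_space M) : Prop := forall z, (m <= zsize z)%N -> Theta t z = 0.

Lemma supp_lt_closed m : lin_closed (supp_lt m).
Proof.
have l z := theta_app_linear m1 m2 z.
split=> [z _|c u v hu hv z le]; first by have [] := linear_facts (l z).
apply: (etrans (l z c u v)); by rewrite hu // hv // scaler0 addr0.
Qed.

Lemma diag_maps_zsize d z z' : diag_maps d z z' -> (zsize z' <= zsize z)%N.
Proof.
move=> /andP[/eqP E1 /eqP E2]; apply: leq_trans (eq_leq _) (psize_mono d (val z.1) (val z.2)).
exact: (congr2 (@psize n) (esym E1) (esym E2)).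
Qed.

Lemma supp_lt_act m d t : supp_lt m t -> supp_lt m (dr_act d t).
Proof.
move=> ht z le; apply: (etrans (theta_act m1 m2 d t z)); apply: big1 => z' dz.
by rewrite ht ?scaler0 //; apply: leq_trans le (diag_maps_zsize dz).
Qed.

Definition supp_lt_rep m : diag_rep n (a * b) := @sub_rep k n (a * b) M _ (supp_lt_closed m) (@supp_lt_act m).

(** * The layer of the pairs of size s *)

Section Step.
Variable s : 'I_n.+1.
Let le_s : (s <= n)%N := leq_ord s.
Local Notation Pm t := (perm_diag (ext_perm le_s t)).
Local Notation std := (std_diag n s).

Definition minT : finType := {z : Z | `[< min_pair s (val z.1) (val z.2) >]}.

Lemma minTP (z : minT) : min_pair s (val (val z).1) (val (val z).2).
Proof. exact/asboolP/(valP z). Qed.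

(** The flip of [e] takes the product back to [l], so the product cannot have dropped rank. *)
Lemma up_in_cell (c : 'I_n.+1) (e : cell s) (l : cell c) :
  dmul std (val l) = val l -> dmul (val e) (val l) \in left_cell (std_diag n c).
Proof.
move=> El; apply: (@left_cell_mulr n (std_diag n c) (dswap (val e)) (val e) _ (valP l)).
by rewrite dmulA (dswap_mul (cell_in_cell e)) El; exact: valP.
Qed.

Definition up (e : cell s) (z : minT) : Z :=
  (Sub (dmul (val e) (val (val z).1)) (up_in_cell e (min_l (minTP z))),
   Sub (dmul (val e) (val (val z).2)) (up_in_cell e (min_m (minTP z)))).

Lemma Z_eq (z z' : Z) : val z.1 = val z'.1 -> val z.2 = val z'.2 -> z = z'.
Proof. by case: z z' => x y [x' y'] E1 E2; congr pair; exact: val_inj. Qed.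

Lemma tact_in_cell (c : 'I_n.+1) (t : 'S_s) (l : cell c) :
  dmul (Pm t) (val l) \in left_cell (std_diag n c).
Proof.
apply: (@left_cell_mulr n (std_diag n c) (perm_diag (ext_perm le_s t)^-1) (Pm t) _ (valP l)).
rewrite dmulA -perm_diagM mulVg perm_diag1 dmul_idl; exact: valP.
Qed.

Definition tactz (t : 'S_s) (z : Z) : Z :=
  (Sub (dmul (Pm t) (val z.1)) (tact_in_cell t z.1), Sub (dmul (Pm t) (val z.2)) (tact_in_cell t z.2)).

Lemma tact_min t (z : minT) : `[< min_pair s (val (tactz t (val z)).1) (val (tactz t (val z)).2) >].
Proof. by apply/asboolP; exact: (min_pair_perm le_s t (minTP z)). Qed.

Definition tact (t : 'S_s) (z : minT) : minT := exist _ (tactz t (val z)) (tact_min t z).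

Lemma mact_min g (z : minT) : `[< min_pair s (val (zact g (val z)).1) (val (zact g (val z)).2) >].
Proof. by apply/asboolP; exact: (min_pair_ract _ _ (minTP z)). Qed.

Definition mact (g : G) (z : minT) : minT := exist _ (zact g (val z)) (mact_min g z).

Lemma tactM t r z : tact (t * r)%g z = tact t (tact r z).
Proof. by apply: val_inj; apply: Z_eq => /=; rewrite ext_permM perm_diagM dmulA. Qed.

Lemma tact1 z : tact 1%g z = z.
Proof. by apply: val_inj; apply: Z_eq => /=; rewrite ext_perm1 perm_diag1 dmul_idl. Qed.

Lemma tact_mact t g z : mact g (tact t z) = tact t (mact g z).
Proof. by apply: val_inj; apply: Z_eq => /=; rewrite dmulA. Qed.

Lemma up_cact t e z : up (cact t e) z = up e (tact t z).
Proof. by apply: Z_eq; rewrite /= dmulA. Qed.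

Lemma up_mact g e z : up e (mact g z) = zact g (up e z).
Proof. by apply: Z_eq; rewrite /= dmulA. Qed.

Lemma zsize_up e z : zsize (up e z) = s.
Proof. exact: (min_up_psize le_s (cell_in_cell e) (minTP z)). Qed.

Lemma up_exists z : zsize z = s -> exists e z0, up e z0 = z.
Proof.
move=> Es; have [e [g [he hm El Em]]] := min_up_exists (val z.1) (val z.2).
rewrite -/(zsize z) Es in he hm.
have c1 : dmul g (val z.1) \in left_cell (std_diag n i).
  by apply: (@left_cell_mulr n _ e g _ (valP z.1)); rewrite El; exact: valP.
have c2 : dmul g (val z.2) \in left_cell (std_diag n j).
  by apply: (@left_cell_mulr n _ e g _ (valP z.2)); rewrite Em; exact: valP.
pose e' : cell s := Sub e (introT (in_cellP e le_s) he).
pose z0 : Z := (Sub (dmul g (val z.1)) c1 : cell i, Sub (dmul g (val z.2)) c2 : cell j).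
have hz0 : `[< min_pair s (val z0.1) (val z0.2) >] by apply/asboolP; exact: hm.
exists e', (exist _ z0 hz0 : minT); apply: Z_eq; [exact: El|exact: Em].
Qed.

Lemma up_eq e e' z z' : up e z = up e' z' -> exists t, e' = cact t e /\ z = tact t z'.
Proof.
move=> E; have E1 := congr1 (fun z => val z.1) E; have E2 := congr1 (fun z => val z.2) E.
have [t [Ee El Em]] := min_up_eq le_s (cell_in_cell e) (cell_in_cell e') (minTP z) (minTP z') E1 E2.
exists t; split; apply: val_inj; first exact: Ee.
by apply: Z_eq; [exact: El|exact: Em].
Qed.

Lemma cact_free t (e : cell s) : cact t e = e -> t = 1%g.
Proof. by move/(congr1 val)/(up_free (cell_in_cell e)). Qed.

Lemma diag_maps_up d (e e' : cell s) (z : minT) : dmul d (val e) = val e' -> diag_maps d (up e z) (up e' z).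
Proof.
move=> E; apply/andP; split; apply/eqP.
  exact: (etrans (dmulA d (val e) (val (val z).1)) (congr1 (fun x => dmul x (val (val z).1)) E)).
exact: (etrans (dmulA d (val e) (val (val z).2)) (congr1 (fun x => dmul x (val (val z).2)) E)).
Qed.

Lemma diag_coef_up d (e e' : cell s) (z : minT) : dmul d (val e) = val e' -> diag_coef a b d (up e z) = (a * b) ^+ dloops d (val e).
Proof.
move=> E; have he' : in_cell s (dmul d (val e)) by rewrite E; exact: cell_in_cell.
have L1 := min_dloops (cell_in_cell e) he' (min_l (minTP z)).
have L2 := min_dloops (cell_in_cell e) he' (min_m (minTP z)).
rewrite exprMn; exact: (congr2 (fun p q => a ^+ p * b ^+ q) L1 L2).
Qed.

(** Among pairs of size at most s, those that [d] sends to [up e' z0] lie over the same minimal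
    pair. On the layer, then, [d] moves only the upward diagram, exactly as in [fun_act]. *)
Lemma diag_maps_up_exists d (z : Z) (e' : cell s) (z0 : minT) : (zsize z <= s)%N -> diag_maps d z (up e' z0) ->
  exists2 e : cell s, dmul d (val e) = val e' & z = up e z0.
Proof.
move=> le dz; have Es : zsize z = s.
  by apply/eqP; rewrite eqn_leq le -(zsize_up e' z0) (diag_maps_zsize dz).
have [e [z1 Ez]] := up_exists Es.
rewrite -{}Ez in dz *; have [/eqP E1 /eqP E2] := andP dz.
have {}E1 := etrans (esym (dmulA d (val e) (val (val z1).1))) E1.
have {}E2 := etrans (esym (dmulA d (val e) (val (val z1).2))) E2.
(* The rank is squeezed between the rank of [e] and the size of the image pair, both equal to s. *)
have rk : rank (dmul d (val e)) = s.
  apply/eqP; rewrite eqn_leq; apply/andP; split.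
    apply: leq_trans (rank_dmulr _ _) _.
    by rewrite (in_cell_propagating (cell_in_cell e) le_s).
  apply: leq_trans (eq_leq _) (psize_mul (dmul d (val e)) (val (val z1).1) (val (val z1).2)).
  by rewrite -[LHS](zsize_up e' z0); exact: (congr2 (@psize n) (esym E1) (esym E2)).
have Cde : dmul d (val e) \in left_cell std.
  by apply: left_cell_mul (valP e) _; rewrite rk rank_std.
pose e1 : cell s := Sub (dmul d (val e)) Cde.
(* The two descriptions of the image differ by a relabelling [t]; moving [t] from the minimal pair
   to [e] gives the representative over [z0]. *)
have [t [Ee' Ez1]] : exists t, e' = cact t e1 /\ z1 = tact t z0.
  by apply: up_eq; apply: Z_eq; [exact: E1|exact: E2].
exists (cact t e); first by rewrite Ee' !cactE dmulA.
by rewrite up_cact -Ez1.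
Qed.

(** Equal pairs differ by a relabelling, which would have to fix [e'], and the action on the cell is
    free. This makes the reindexing of the action of [d] one-to-one. *)
Lemma up_inj d (e1 e2 e' : cell s) (z : minT) : dmul d (val e1) = val e' -> dmul d (val e2) = val e' ->
  up e1 z = up e2 z -> e1 = e2.
Proof.
move=> E1 E2 /up_eq[t [Et _]]; have t1 : t = 1%g.
  apply: (@cact_free t e'); apply: val_inj.
  have Ed : dmul d (val (cact t e1)) = val e' := etrans (congr1 (fun e : cell s => dmul d (val e)) (esym Et)) E2.
  by rewrite cactE -{1}E1 -dmulA.
by rewrite Et t1 cact1.
Qed.

Let ual (g : G) : vtens_vect S1 S2 -> vtens_vect S1 S2 := uact rho1 rho2 g.
Let ual_linear g : linear (ual g). Proof. exact: (uact_linear h1 h2 g). Qed.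

(** The representation from which the layer is induced. Compatibility with renaming the labels of
    the two members is part of the space; the symmetric group on s letters acts through [tact]. *)
Definition minW : {vspace {ffun minT -> vtens_vect S1 S2}} := eqv_space mact ual_linear.

Definition min_act : 'S_s -> subvs_of minW -> subvs_of minW := eqv_act tact.

Lemma min_actE t (w : subvs_of minW) z : vsval (min_act t w) z = vsval w (tact t^-1%g z).
Proof. exact: (eqv_actE tact_mact). Qed.

Lemma min_lin_action : lin_action min_act.
Proof. exact: (eqv_lin_action _ tactM tact1 tact_mact). Qed.

Let slice (t : vtens (dr_space V1) (dr_space V2)) (e : cell s) : subvs_of minW :=
  vsproj minW [ffun z => Theta t (up e z) : vtens_vect S1 S2].

Let sliceE t e z : vsval (slice t e) z = Theta t (up e z).
Proof.
rewrite vsprojK; first exact: ffunE.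
apply/eqv_spaceP => g y.
apply: (etrans (congr1 (ual g) (ffunE _ _))); apply: etrans (esym (ffunE _ _)).
rewrite up_mact; exact: (theta_equivariant h1 h2 m1 m2 g t (up e y)).
Qed.

Local Notation I := (dr_space (ind_rep (a * b) min_lin_action)).

(** Elements of the induced module as functions of an upward diagram and a minimal pair; [ev_cact]
    and [ev_mact] are their two equivariance properties. *)
Let ev (phi : I) (e : cell s) (z : minT) : U := vsval (ind_val phi e) z.

Let ev_linear e z : linear (fun phi => ev phi e z).
Proof.
move=> c phi psi.
have E1 := congr1 (fun f : fun_space s _ => f e) (ind_val_linear c phi psi).
have {}E1 := etrans E1 (ffun_lin c (ind_val phi) (ind_val psi) e).
apply: (etrans (congr1 (fun w : subvs_of minW => vsval w z) E1)).
exact: (ffun_lin c (vsval (ind_val phi e)) (vsval (ind_val psi e)) z).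
Qed.

Let ev_inj phi psi : (forall e z, ev phi e z = ev psi e z) -> phi = psi.
Proof.
move=> E; apply: ind_val_inj; apply/ffunP=> e; apply: vsval_inj; apply/ffunP=> z.
exact: E.
Qed.

Let ev_act d phi e' z : ev (dr_act d phi) e' z =
  \sum_(e : cell s | dmul d (val e) == val e') (a * b) ^+ dloops d (val e) *: ev phi e z.
Proof.
have E1 := congr1 (fun f : fun_space s _ => f e') (ind_val_act d phi).
have {}E1 := etrans E1 (fun_actE (a * b) d (ind_val phi) e').
apply: (etrans (congr1 (fun w : subvs_of minW => vsval w z) E1)).
have lev : linear (fun w : subvs_of minW => vsval w z).
  by move=> c u v; exact: (ffun_lin c (vsval u) (vsval v) z).
rewrite (linear_sum_fact _ _ _ lev); apply: eq_bigr => e _.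
exact: (linearZ_fact _ _ lev).
Qed.

Let ev_cact phi t e z : ev phi (cact t e) z = ev phi e (tact t z).
Proof.
have E := congr1 (fun w : subvs_of minW => vsval w (tact t z)) (ind_eqv phi t e).
apply: (etrans _ E); apply: (etrans _ (esym (min_actE _ _ _))).
by rewrite -tactM mulVg tact1.
Qed.

Let ev_mact phi g e z : uact rho1 rho2 g (ev phi e (mact g z)) = ev phi e z.
Proof.
have /eqv_spaceP H := subvsP (ind_val phi e); exact: (H g z).
Qed.

Let slice_fun t : fun_space s (subvs_of minW) := [ffun e => slice t e].

Let slice_funE t e z : vsval (slice_fun t e) z = Theta t (up e z).
Proof.
apply: (etrans (congr1 (fun w : subvs_of minW => vsval w z) (ffunE _ _))); exact: sliceE.
Qed.

Let slice_equivariant t : equivariant min_act (slice_fun t).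
Proof.
move=> r e; apply: vsval_inj; apply/ffunP=> z.
apply: (etrans (min_actE _ _ _)); rewrite !slice_funE up_cact -tactM mulgV tact1.
by [].
Qed.

Let restrict (t : dr_space (supp_lt_rep s.+1)) : I :=
  ind_in (a * b) min_lin_action (slice_equivariant (val t)).

Let restrictE t e z : ev (restrict t) e z = Theta (val t) (up e z).
Proof. exact: slice_funE. Qed.

(** The quotient map restricts a function on pairs to those of size s, written as [up e z]. Its
    kernel consists of the functions that vanish there too. *)
Lemma step_exact : exists f g, @short_exact k n (a * b) (supp_lt_rep s) (supp_lt_rep s.+1)
  (ind_rep (a * b) min_lin_action) f g.
Proof.
have inc t : supp_lt s t -> supp_lt s.+1 t by move=> ht z /ltnW; exact: ht.
pose mk m t (ht : supp_lt m t) : dr_space (supp_lt_rep m) := @sub_in k n (a * b) M _ (supp_lt_closed m) t ht.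
have supp_ltP m (t : dr_space (supp_lt_rep m)) : supp_lt m (val t).
  exact: (@sub_spaceP k n (a * b) M _ (supp_lt_closed m)).
have lth z := theta_app_linear m1 m2 z.
have lev0 e z : ev 0 e z = 0 by have [] := linear_facts (ev_linear e z).
exists (fun t => mk s.+1 _ (inc _ (supp_ltP s t))), restrict; split.
- by split=> [c u v|d v]; apply: val_inj.
- split=> [c u v|d v]; apply: ev_inj => e z.
    apply: (etrans (restrictE _ e z)); apply: (etrans _ (esym (ev_linear e z c _ _))).
    apply: (etrans (lth (up e z) c (val u) (val v))).
    by rewrite !restrictE.
  apply: (etrans (restrictE _ e z)); apply: (etrans _ (esym (ev_act d _ e z))).
  apply: (etrans (theta_act m1 m2 d (val v) (up e z))).
  (* Of the pairs that [d] sends to [up e z], those of size above s contribute 0 by the support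
     condition, and the others are the [up e' z] with [e'] in [A], each obtained once. *)
  pose A := [set e' : cell s | dmul d (val e') == val e].
  pose B := [set z' : Z | diag_maps d z' (up e z)].
  have sAB : (fun e' => up e' z) @: A \subset B.
    apply/subsetP=> _ /imsetP[e' + ->]; rewrite !inE => /eqP; exact: diag_maps_up.
  rewrite (eq_bigl (fun z' => z' \in B)) => [|z']; last by rewrite inE.
  rewrite (big_setID ((fun e' => up e' z) @: A)) /= (setIidPr sAB).
  rewrite [X in _ + X]big1 ?addr0 => [|z']; last first.
    rewrite inE => /andP[nA]; rewrite inE => Bz.
    case: (ltnP s (zsize z')) => [lt|le].
      by rewrite (supp_ltP _ v _ lt) scaler0.
    have [e' Ee' Ez'] := diag_maps_up_exists le Bz.
    by case/negP: nA; rewrite Ez'; apply: imset_f; rewrite inE Ee'.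
  rewrite big_imset => [|e1 e2] /=; last first.
    by rewrite !inE => /eqP H1 /eqP H2; exact: up_inj H1 H2.
  rewrite (eq_bigl (fun e' : cell s => dmul d (val e') == val e)) => [|e']; last by rewrite inE.
  apply: eq_bigr => e' /eqP He'.
  by rewrite (diag_coef_up _ He') restrictE.
- by move=> u v /(congr1 val) E; apply: val_inj.
- move=> phi.
  (* The preimage of [phi] is its extension by zero off the pairs of size s; [ev_cact] makes the
     value independent of the chosen factorization. *)
  pose F (z : Z) : U := if [pick x : cell s * minT | up x.1 x.2 == z] is Some x
    then ev phi x.1 x.2 else 0.
  have F_up e z : F (up e z) = ev phi e z.
    rewrite /F; case: pickP => [x /eqP/up_eq[t [-> ->]]|/(_ (e, z))]; last by rewrite eqxx.
    by rewrite ev_cact.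
  have F0 z : (forall e z0, up e z0 <> z) -> F z = 0.
    by move=> nz; rewrite /F; case: pickP => // x /eqP /nz.
  have hF g z : uact rho1 rho2 g (F (zact g z)) = F z.
    have [[e [z0 <-]]|nz] := pselect (exists e z0, up e z0 = z).
      by rewrite -up_mact !F_up ev_mact.
    rewrite !F0 => [||e z0 E].
    - by have [] := linear_facts (uact_linear h1 h2 g).
    - by move=> e z0 E; case: nz; exists e, z0.
    case: nz; exists e, (mact (g.1^-1, g.2^-1)%g z0); rewrite up_mact E.
    by case: z {E} => x y; rewrite /zact /= !cactK.
  pose t := theta_inv rho1 rho2 Q1 Q2 F.
  have Et : Theta t =1 F := theta_invK char_k h1 h2 m1 m2 hF.
  have ht : supp_lt s.+1 t.
    move=> z lt; rewrite Et F0 // => e z0 E.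
    by move: lt; rewrite -E zsize_up ltnn.
  exists (mk s.+1 t ht); apply: ev_inj => e z; rewrite restrictE.
  by apply: (etrans (Et _)).
- move=> t Rt; have ht : supp_lt s (val t).
    move=> z; rewrite leq_eqVlt => /predU1P[Es|]; last exact: (supp_ltP _ t).
    have [e [z0 <-]] := up_exists (esym Es).
    by rewrite -restrictE Rt.
  by exists (mk s _ ht); apply: val_inj.
move=> t; apply: ev_inj => e z; rewrite restrictE lev0.
by apply: (supp_ltP s t); rewrite zsize_up.
Qed.

End Step.

(** At level 0 every value vanishes, so the element is 0 by [thetaK]. Sizes run from 0 to n, so the
    whole module is reached at level [n.+1]. *)
Lemma filt_supp_lt m : (m <= n.+1)%N -> filt (supp_lt_rep m).
Proof.
elim: m => [_|m IH lt].
  apply: filt_nil => t; apply: val_inj.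
  have t0 : supp_lt 0 (val t) := @sub_spaceP k n (a * b) M _ (supp_lt_closed 0) t.
  rewrite -[LHS](thetaK char_k h1 h2 m1 m2) /theta_inv.
  apply: (etrans (congr1 _ (_ : _ = 0))); last exact: scaler0.
  apply: big1 => z _; rewrite t0 //.
  by have [] := linear_facts (tmap_linear
    (comp_linear (fm_inv_linear m1) (orbit_fun_linear h1 z.1))
    (comp_linear (fm_inv_linear m2) (orbit_fun_linear h2 z.2))).
have [f [g se]] := step_exact (Ordinal lt).
apply: (filt_exact se); first exact/IH/ltnW.
exact: filt_ind_rep.
Qed.

Lemma filt_fun_model_tens : filt M.
Proof.
apply: (@filt_iso _ _ _ (supp_lt_rep n.+1) M (fun t => \val t)); last exact: filt_supp_lt.
- exact: sub_rep_val.
- exact: val_inj.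
move=> t; have ht : supp_lt n.+1 t by move=> z; rewrite ltnNge psize_le.
by exists (@sub_in k n (a * b) M _ (supp_lt_closed n.+1) t ht).
Qed.

End StandardTensor.

Theorem proposition20 (k : closedFieldType) (char_k : [pchar k] =i pred0)
    (n : nat) (n_gt0 : (0 < n)%N) (a b : k) (a_neq0 : a != 0) (b_neq0 : b != 0)
    (X : lmodType (partalg n a)) (Y : lmodType (partalg n b)) :
  has_standard_filtration X -> has_standard_filtration Y ->
  has_standard_filtration (tensor_product X Y).
Proof.
move=> /has_filt fX /has_filt fY; apply: filt_has; apply: filt_tensor_rep.
apply: filt_tens fX fY => [x i la|i j la mu _ _]; first exact: kproj_standard.
exact: (filt_fun_model_tens char_k (specht_lin_action k i la) (specht_lin_action k j mu)
  (standard_fun_model a i la char_k) (standard_fun_model b j mu char_k)).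
Qed.
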